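(* Let $(M,\mathbf m)$ be a metric projective geometry of dimension $n\ge2$ with Weyl nullity and such that the functions $B^g$ ($g\in\mathbf m$) are smooth. If $B^g$ is constant for one metric $g\in\mathbf m$ then $B^{\bar g}$ is constant for all metrics $\bar g\in\mathbf m$.
   Context: Manifolds are smooth and connected; metrics have arbitrary signature; indices are abstract. Two metrics are projectively equivalent if they have the same geodesics up to reparametrisation; a metric projective structure $\mathbf m$ is an equivalence class of projectively equivalent metrics. For the Levi-Civita connection $\nabla$ of $g$: $[\nabla_\ell,\nabla_k]v^j=R^j{}_{i\ell k}v^i$, $R_{jk}=R^a{}_{jak}$, $\mathsf P_{jk}=\frac1{n-1}R_{jk}$, $\mathsf P^i{}_j=g^{ik}\mathsf P_{kj}$. The projective Weyl tensor $W^i{}_{jk\ell}=R^i{}_{jk\ell}+\delta^i_\ell\mathsf P_{jk}-\delta^i_k\mathsf P_{j\ell}$ is the same for all $g\in\mathbf m$. $(M,\mathbf m)$ has Weyl nullity if at every $x$ there is $0\ne v\in T_xM$ with $W^i{}_{jk\ell}v^j=0$. Then each $g\in\mathbf m$ determines a function $B^g:M\to\mathbb R$ by $\mathsf P^i{}_jv^j=B^gv^i$ for all $v$ in the nullity (independent of $v$). *)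

(* Defs.v *)
From HB Require Import structures.
From mathcomp Require Import all_boot all_order all_algebra.
From mathcomp Require Import all_classical all_reals all_analysis.

Set Implicit Arguments.
Unset Strict Implicit.
Unset Printing Implicit Defensive.

Import Order.TTheory GRing.Theory Num.Theory.
Import numFieldNormedType.Exports.

Local Open Scope classical_set_scope.
Local Open Scope ring_scope.

Section Smoothness.
Context {R : realType} {V W : normedModType R}.

Definition iter_derive (vs : seq V) (f : V -> W) : V -> W :=
  foldr (fun v h => 'D_v h) f vs.

(* Meant for V of finite dimension and U open, where it says that f is C^oo on
   U: directional derivatives of all orders exist and are continuous. *)
Definition smooth_on (U : set V) (f : V -> W) : Prop :=
  forall (vs : seq V) (x : V), U x ->
    {for x, continuous (iter_derive vs f)} /\
    forall v : V, derivable (iter_derive vs f) x v.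

End Smoothness.

(* Connected smooth n-manifolds, given by a smooth atlas (not required to be
   maximal).  coord a and param a are total functions; they are meaningful only
   on dom a and on its image in R^n respectively. *)
Record manifold (R : realType) (n : nat) := Manifold {
  carrier :> topologicalType;
  manifold_hausdorff : hausdorff_space carrier;
  manifold_second_countable : @second_countable carrier;
  manifold_connected : connected [set: carrier];
  chart : Type;
  dom : chart -> set carrier;
  coord : chart -> carrier -> 'rV[R]_n;
  param : chart -> 'rV[R]_n -> carrier;
  dom_open : forall a, open (dom a);
  dom_cover : forall x, exists a, dom a x;
  image_open : forall a, open (coord a @` dom a);
  coordK : forall a x, dom a x -> param a (coord a x) = x;
  coord_continuous : forall a x, dom a x -> {for x, continuous (coord a)};
  param_continuous : forall a u, (coord a @` dom a) u ->
    {for u, continuous (param a)};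
  transition_smooth : forall a b,
    smooth_on (coord a @` (dom a `&` dom b)) (coord b \o param a) }.

Arguments chart {R n} m.
Arguments dom {R n m} a.
Arguments coord {R n m} a.
Arguments param {R n m} a.

Section Manifolds.
Context {R : realType} {n : nat} {M : manifold R n}.

Definition chart_image (a : chart M) : set 'rV[R]_n := coord a @` dom a.

Definition transition (a b : chart M) : 'rV[R]_n -> 'rV[R]_n :=
  coord b \o param a.

Definition smooth_function (f : M -> R) : Prop :=
  forall a : chart M, smooth_on (chart_image a) (f \o param a).

Definition constant_function (f : M -> R) : Prop :=
  exists c : R, forall x, f x = c.

(* T_x M: a tangent vector is the family of its components in the charts around
   x (and the value 0 at the other charts).  Components are row vectors, so the
   Jacobian of a transition map acts on the right. *)
Definition tangent_space (x : M) : set (chart M -> 'rV[R]_n) :=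
  [set v | (forall a, ~ dom a x -> v a = 0) /\
           (forall a b, dom a x -> dom b x ->
              v b = v a *m jacobian (transition a b) (coord a x))].

(* Semi-Riemannian metrics of arbitrary signature: g a u is the matrix (g_ij) in
   the chart a at the point with coordinates u; only u in chart_image a matters. *)
Record metric := Metric {
  metric_comp :> chart M -> 'rV[R]_n -> 'M[R]_n;
  metric_smooth : forall a i j,
    smooth_on (chart_image a) (fun u => metric_comp a u i j);
  metric_sym : forall a u, chart_image a u ->
    (metric_comp a u)^T = metric_comp a u;
  metric_nondegenerate : forall a u, chart_image a u ->
    metric_comp a u \in unitmx;
  metric_transform : forall a b x, dom a x -> dom b x ->
    let J := jacobian (transition a b) (coord a x) in
    metric_comp a (coord a x) = J *m metric_comp b (coord b x) *m J^T }.

Definition partial (k : 'I_n) (f : 'rV[R]_n -> R) : 'rV[R]_n -> R :=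
  'D_(delta_mx 0 k) f.

Section Curvature.
Variables (g : metric) (a : chart M).
Implicit Types (u : 'rV[R]_n) (i j k l : 'I_n).

Definition metric_inv u : 'M[R]_n := invmx (g a u).

(* Gamma^i_jk of the Levi-Civita connection, nabla_j v^i = d_j v^i + Gamma^i_jk v^k *)
Definition christoffel i j k u : R :=
  2^-1 * \sum_l metric_inv u i l *
    (partial j (fun w => g a w l k) u + partial k (fun w => g a w l j) u
     - partial l (fun w => g a w j k) u).

(* R^j_ilk, read off from [nabla_l, nabla_k] v^j = R^j_ilk v^i *)
Definition riemann j i l k u : R :=
  partial l (christoffel j k i) u - partial k (christoffel j l i) u
  + \sum_p (christoffel j l p u * christoffel p k i u
            - christoffel j k p u * christoffel p l i u).

Definition ricci j k u : R := \sum_p riemann p j p k u.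

Definition schouten j k u : R := (n%:R - 1)^-1 * ricci j k u.

(* P^i_j = g^ik P_kj *)
Definition schouten_up i j u : R :=
  \sum_k metric_inv u i k * schouten k j u.

(* W^i_jkl *)
Definition weyl i j k l u : R :=
  riemann i j k l u
  + (i == l)%:R * schouten j k u - (i == k)%:R * schouten j l u.

End Curvature.

Definition open_interval (I : set R) : Prop := open I /\ is_interval I.

(* Affinely parametrised: nabla_gam' gam' = 0 in every chart. *)
Definition geodesic (g : metric) (I : set R) (gam : R -> M) : Prop :=
  (forall t, I t -> {for t, continuous gam}) /\
  forall a : chart M,
    let c := coord a \o gam in
    smooth_on (I `&` gam @^-1` dom a) c /\
    forall t, I t -> dom a (gam t) -> forall k : 'I_n,
      'D_1 ('D_1 c) t 0 k
      + \sum_i \sum_j christoffel g a k i j (c t) *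
          ('D_1 c t 0 i * 'D_1 c t 0 j) = 0.

(* s is a diffeomorphism from J onto I *)
Definition reparametrisation (J I : set R) (s : R -> R) : Prop :=
  [/\ smooth_on J s, forall t, J t -> 'D_1 s t != 0 & s @` J = I].

Definition geodesics_included (g h : metric) : Prop :=
  forall (I : set R) (gam : R -> M),
    open_interval I -> geodesic g I gam ->
    exists (J : set R) (s : R -> R),
      [/\ open_interval J, reparametrisation J I s & geodesic h J (gam \o s)].

Definition projectively_equivalent (g h : metric) : Prop :=
  geodesics_included g h /\ geodesics_included h g.

Definition metric_projective_structure (m : set metric) : Prop :=
  exists g : metric, m = [set h | projectively_equivalent g h].

Definition weyl_nullity (g : metric) (x : M) : set (chart M -> 'rV[R]_n) :=
  [set v | tangent_space x v /\
     forall a, dom a x -> forall i k l : 'I_n,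
       \sum_j weyl g a i j k l (coord a x) * v a 0 j = 0].

(* The Weyl tensor is the same for all metrics of a metric projective structure
   m, so it may be computed from any g in m. *)
Definition has_weyl_nullity (m : set metric) : Prop :=
  exists2 g, m g & forall x : M, exists2 v, weyl_nullity g x v & v <> 0.

(* B^g(x) is the number b such that P^i_j v^j = b v^i for all v in the nullity
   at x.  It exists for every metric g, and it is unique as soon as the nullity
   is nonzero; the default value 0 is then not used. *)
Definition Bfun (g : metric) (x : M) : R :=
  xget 0 [set b : R | forall v, weyl_nullity g x v ->
    forall a, dom a x -> forall i : 'I_n,
      \sum_j schouten_up g a i j (coord a x) * v a 0 j = b * v a 0 i].

End Manifolds.

Arguments metric {R n} M.

(* Main.v *)
(* Let g and h be projectively equivalent. Comparing their geodesics with arbitrary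
   initial velocity at a point shows that the Christoffel symbols differ by
   delta^k_i Y_j + delta^k_j Y_i for a 1-form Y. Symmetry of both Ricci tensors forces
   dY = 0, so that P_h = P_g - (nabla Y - Y Y) and the Weyl tensors agree.

   If v is in the nullity, then W^i_jkl v^l = v^i (P_g - B_g g)_jk; hence the tensor
   P - B g is the same for g and h, that is
     nabla_k Y_l = Y_k Y_l + B_g g_kl - B_h h_kl.
   Suppose that B_g is constant. Differentiating once more and using the Ricci identity
   for Y gives, with beta = dB_h,
     R^p_ljk Y_p + B_g (Y_k g_jl - Y_j g_kl) - beta_j h_kl + beta_k h_jl = 0.
   Contracting with v^k cancels the first two terms and leaves
   beta(v) h_jl = beta_j h_lk v^k; the h-trace gives n beta(v) = beta(v), so beta(v) = 0,
   and then beta = 0. Thus B_h is locally constant.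

   The existence of geodesics is Picard iteration, and the chart independence of B
   rests on the transformation law of the Ricci tensor. *)
From Pilot Require Import Defs.
From HB Require Import structures.
From mathcomp Require Import all_boot all_order all_algebra.
From mathcomp Require Import all_classical all_reals all_analysis.
From mathcomp Require Import ring lra.

Set Implicit Arguments.
Unset Strict Implicit.
Unset Printing Implicit Defensive.

Import Order.TTheory GRing.Theory Num.Theory.
Import numFieldNormedType.Exports.
(* [coord], [coord_continuous] and [metric_sym] are also names of MathComp. *)
Import Pilot.Defs.

Local Open Scope classical_set_scope.
Local Open Scope ring_scope.

(** * Functions of class C^k *)

(** Smoothness is given through directional derivatives only, so Fréchet differentiability of C^1
    functions, the chain rule and Schwarz's theorem are derived before any geometry.

    Nullity puts v into the second slot of W, while the formula for P - B g needs it in the last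
    one. The pair symmetry R_ijkl = R_klij bridges the two, so the full set of curvature symmetries
    is proved for [riemann]. In the last slot the curvature of g acts on v like one of constant
    curvature B_g, which is why it drops out of the final contraction.

    The equation for nabla Y is a closed first-order system, and the displayed identity is its
    integrability condition. There dB_g would enter just as beta does; the constancy of B_g removes
    it.

    Pointwise algebra is kept apart from analysis: tensors are arrays over a field, and derivatives
    are free symbols subject to relations. [geodesic] and [Bfun] refer to all charts at once, so the
    transformation law of the Christoffel symbols serves twice: to carry geodesics between charts
    and to make the Ricci tensor a tensor. *)

Section Lines.
Context {R : realType} {V : normedModType R}.

Lemma is_derive_line (W : normedModType R) (f : V -> W) (y v : V) (t : R) :
  derivable f (y + t *: v) v ->
  is_derive t (1 : R) (fun s => f (y + s *: v)) ('D_v f (y + t *: v)).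
Proof.
move=> df.
have E : (fun h : R => h^-1 *: (f (y + (h *: (1:R) + t) *: v) - f (y + t *: v))) =
         (fun h : R => h^-1 *: (f (h *: v + (y + t *: v)) - f (y + t *: v))).
  apply/funext => h; congr (_ *: (f _ - _)).
  by rewrite -[h *: 1]/(h * 1) mulr1 scalerDl addrCA.
split; first by rewrite /derivable /= E.
by rewrite /derive /= E.
Qed.

Lemma derivable_line_continuous (f : V -> R) (y v : V) (t : R) :
  derivable f (y + t *: v) v -> {for t, continuous (fun s : R => f (y + s *: v))}.
Proof.
move=> /is_derive_line H; apply: differentiable_continuous.
by apply/derivable1_diffP; have [] := H.
Qed.

(** Reduces claims about directional derivatives to calculus in one real variable. *)
Lemma is_derive_lineP (W : normedModType R) (f : V -> W) (y v : V) (l : W) :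
  is_derive (0 : R) (1 : R) (fun s : R => f (y + s *: v)) l -> is_derive y v f l.
Proof.
have E : (fun h : R => h^-1 *: (f (y + (h *: (1:R) + 0) *: v) - f (y + 0 *: v))) =
         (fun h : R => h^-1 *: (f (h *: v + y) - f y)).
  apply/funext => h; congr (_ *: (f _ - f _)); last by rewrite scale0r addr0.
  by rewrite -[h *: 1]/(h * 1) mulr1 addr0 addrC.
move=> [D1 D2]; split; first by move: D1; rewrite /derivable /= E.
by move: D2; rewrite /derive /= E.
Qed.

Lemma is_derive_line0 (W : normedModType R) (f : V -> W) (y v : V) :
  derivable f y v ->
  is_derive (0 : R) (1 : R) (fun s : R => f (y + s *: v)) ('D_v f y).
Proof.
by move=> df; have := @is_derive_line _ f y v 0; rewrite scale0r addr0; exact.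
Qed.

Lemma is_derive_scale (W : normedModType R) (f : V -> W) (y v : V) (c : R) :
  derivable f y v -> is_derive y (c *: v) f (c *: 'D_v f y).
Proof.
move=> df; apply: is_derive_lineP.
have D : is_derive 0 (1:R) (fun s : R => f (y + s *: v)) ('D_v f y).
  have := @is_derive_line _ f y v 0; rewrite scale0r addr0; exact.
have -> : (fun s : R => f (y + s *: (c *: v))) =
          (fun s : R => f (y + s *: v)) \o ( *%R c : R -> R).
  by apply/funext => s /=; rewrite scalerA mulrC.
have d1 : is_diff (0 : R) ( *%R c : R -> R) ( *%R c : R -> R).
  exact: (@is_diff_scaler R R c 0).
have d2 : differentiable (fun s : R => f (y + s *: v)) (c * 0).
  by rewrite mulr0; apply/derivable1_diffP; have [] := D.
have d1' : differentiable ( *%R c : R -> R) (0 : R) by [].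
have d3 := differentiable_comp d1' d2.
split; first exact: diff_derivable.
rewrite deriveE// diff_comp//= diff_val mulr0 -[c * 1]/(c *: (1:R)) linearZ /=.
rewrite -deriveE; last by move: d2; rewrite mulr0.
by rewrite derive_val.
Qed.

Lemma mvt_line (f : V -> R) (y v : V) :
  (forall t : R, 0 <= t <= 1 -> derivable f (y + t *: v) v) ->
  exists2 t : R, 0 <= t <= 1 & f (y + v) - f y = 'D_v f (y + t *: v).
Proof.
move=> df.
have D (t : R) : t \in `]0, 1[ -> is_derive t (1 : R) (fun s => f (y + s *: v)) ('D_v f (y + t *: v)).
  by rewrite in_itv/= => /andP[t0 th]; apply: is_derive_line; apply: df; rewrite !ltW.
have C : {within `[0, 1], continuous (fun s : R => f (y + s *: v))}.
  apply/continuous_in_subspaceT => t /[!inE] /=; rewrite in_itv/= => t01.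
  exact/derivable_line_continuous/df.
have [t + E] := MVT ltr01 D C.
rewrite in_itv/= => /andP[t0 t1]; exists t; first by rewrite !ltW.
by move: E; rewrite scale0r addr0 scale1r subr0 mulr1.
Qed.

Lemma mvt_scale (f : V -> R) (y v : V) (h : R) :
  (forall t : R, 0 <= t <= 1 -> derivable f (y + (t * h) *: v) v) ->
  exists2 t : R, 0 <= t <= 1 &
    f (y + h *: v) - f y = h * 'D_v f (y + (t * h) *: v).
Proof.
move=> df.
have [t t01|t t01 ->] := @mvt_line f y (h *: v).
  by have [] := is_derive_scale h (df t t01); rewrite scalerA.
exists t => //; have [_] := is_derive_scale h (df t t01).
by rewrite scalerA => ->.
Qed.
End Lines.

(** [smooth_on] truncated at order [k]: the recursion supplies the induction that the closure rules
    need. Continuity is kept at every order, since directional derivatives alone do not give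
    differentiability. *)
Fixpoint ck {R : realType} {V W : normedModType R} (k : nat) (U : set V)
    (f : V -> W) : Prop :=
  (forall x, U x -> {for x, continuous f}) /\
  if k is k'.+1 then
    (forall x v, U x -> derivable f x v) /\ forall v, ck k' U ('D_v f)
  else True.

Section Ck.
Context {R : realType} {V : normedModType R}.
Implicit Types (W : normedModType R) (U : set V) (k : nat).

Lemma smooth_onP W U (f : V -> W) : smooth_on U f <-> forall k, ck k U f.
Proof.
split=> [sf k|ckf vs x Ux].
  elim: k f sf => [|k IH] f sf.
    by split=> // x Ux; have [] := sf [::] x Ux.
  split; first by move=> x Ux; have [] := sf [::] x Ux.
  split=> [x v Ux|v]; first by have [_] := sf [::] x Ux; exact.
  apply: IH => vs x Ux; have := sf (rcons vs v) x Ux.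
  by rewrite /iter_derive foldr_rcons.
(* [iter_derive] applies the last entry of the list first, and [ck] peels off the derivative taken
   first; hence the induction from the right. *)
elim/last_ind: vs f ckf => [|vs w IH] f ckf.
  split; first by have [+ _] := ckf 0%N; exact.
  by have [_ [+ _]] := ckf 1%N; move=> + v; exact.
rewrite /iter_derive foldr_rcons; apply: IH => k.
by have [_ [_]] := ckf k.+1; exact.
Qed.

Lemma ckW W U k (f : V -> W) : ck k.+1 U f -> ck k U f.
Proof.
elim: k f => [|k IH] f [cf [df ckf]]; first by split.
by split=> //; split=> // v; apply: IH.
Qed.

Lemma ck_le W U k l (f : V -> W) : (k <= l)%N -> ck l U f -> ck k U f.
Proof.
by move=> /subnK <-; elim: (l - k)%N => // j IH; rewrite addSn => /ckW.
Qed.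

Lemma ck_continuous W U k (f : V -> W) x : ck k U f -> U x -> {for x, continuous f}.
Proof. by case: k => [|k] [+ _]; exact. Qed.

Lemma ck_derivable W U k (f : V -> W) x v : ck k.+1 U f -> U x -> derivable f x v.
Proof. by move=> [_ [+ _]]; exact. Qed.

Lemma ck_derive W U k (f : V -> W) v : ck k.+1 U f -> ck k U ('D_v f).
Proof. by move=> [_ [_]]; exact. Qed.

Lemma eq_near_open W U (f g : V -> W) x : open U -> {in U, f =1 g} -> U x ->
  \forall y \near x, f y = g y.
Proof.
move=> oU fg Ux; have := open_nbhs_nbhs (conj oU Ux).
by apply: filterS => y Uy; apply: fg; rewrite inE.
Qed.

Lemma near_eq_continuous W (f g : V -> W) x : (\forall y \near x, f y = g y) ->
  {for x, continuous f} -> {for x, continuous g}.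
Proof.
move=> fg cf; have E : f x = g x := nbhs_singleton fg.
rewrite /prop_for /continuous_at -E.
by apply: cvg_trans cf; apply: near_eq_cvg.
Qed.

(** On an open set derivatives depend only on the values in the set, so agreement there is
    enough. *)
Lemma eq_ck W U k (f g : V -> W) : open U -> {in U, f =1 g} -> ck k U f -> ck k U g.
Proof.
move=> oU; elim: k f g => [|k IH] f g fg [cf].
  by move=> _; split=> // x Ux; apply: near_eq_continuous (cf x Ux); exact: (eq_near_open oU fg Ux).
move=> [df ckf]; split.
  by move=> x Ux; apply: near_eq_continuous (cf x Ux); exact: (eq_near_open oU fg Ux).
split=> [x v Ux|v].
  by apply: near_eq_derivable (df x v Ux); exact: (eq_near_open oU fg Ux).
apply: IH (ckf v) => x /[!inE] Ux.
by apply: near_eq_derive; exact: (eq_near_open oU fg Ux).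
Qed.

Lemma ck_cst W U k (c : W) : ck k U (cst c : V -> W).
Proof.
elim: k c => [|k IH] c; first by split=> // x _; exact: cvg_cst.
split=> [x _|]; first exact: cvg_cst.
split=> [x v _|v]; first exact: derivable_cst.
suff -> : 'D_v (cst c) = cst 0 :> (V -> W) by apply: IH.
by apply/funext => x; rewrite derive_cst.
Qed.

Lemma ckD W U k (f g : V -> W) : open U -> ck k U f -> ck k U g -> ck k U (f + g).
Proof.
move=> oU; elim: k f g => [|k IH] f g [cf +] [cg].
  by move=> _ _; split=> // x Ux; apply: cvgD; [exact: cf|exact: cg].
move=> [df ckf] [dg ckg]; split.
  by move=> x Ux; apply: cvgD; [exact: cf|exact: cg].
split=> [x v Ux|v]; first by apply: derivableD; [exact: df|exact: dg].
apply: eq_ck (IH _ _ (ckf v) (ckg v)) => // x /[!inE] Ux.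
by rewrite deriveD//; [exact: df|exact: dg].
Qed.

Lemma ckZ W U k (c : R) (f : V -> W) : open U -> ck k U f -> ck k U (c \*: f).
Proof.
move=> oU; elim: k f => [|k IH] f [cf].
  by move=> _; split=> // x Ux; apply: cvgZl_tmp; exact: cf.
move=> [df ckf]; split.
  by move=> x Ux; apply: cvgZl_tmp; exact: cf.
split=> [x v Ux|v]; first by apply: derivableZ; exact: df.
apply: eq_ck (IH _ (ckf v)) => // x /[!inE] Ux.
by rewrite deriveZ//; exact: df.
Qed.

Lemma ckN W U k (f : V -> W) : open U -> ck k U f -> ck k U (- f).
Proof.
move=> oU /(ckZ (-1) oU); apply: eq_ck => // x _.
by rewrite /= scaleN1r.
Qed.

Lemma ck_sum W U k (I : Type) (r : seq I) (P : pred I) (f : I -> V -> W) : open U ->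
  (forall i, P i -> ck k U (f i)) -> ck k U (fun x => \sum_(i <- r | P i) f i x).
Proof.
move=> oU ckf; elim: r => [|i r IH].
  by apply: eq_ck (ck_cst U k 0) => // x _; rewrite big_nil.
have [Pi|Pi] := boolP (P i).
  by apply: eq_ck (ckD oU (ckf i Pi) IH) => // x _; rewrite big_cons Pi.
by apply: eq_ck IH => // x _; rewrite big_cons (negPf Pi).
Qed.

Lemma ckM U k (f g : V -> R) : open U -> ck k U f -> ck k U g -> ck k U (f * g).
Proof.
move=> oU; elim: k f g => [|k IH] f g ckf ckg.
  by split=> // x Ux; exact: (cvgM (ck_continuous ckf Ux) (ck_continuous ckg Ux)).
split.
  by move=> x Ux; exact: (cvgM (ck_continuous ckf Ux) (ck_continuous ckg Ux)).
split=> [x v Ux|v]; first by exact: derivableM (ck_derivable ckf Ux) (ck_derivable ckg Ux).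
apply: eq_ck (ckD oU (IH _ _ (ckW ckf) (ck_derive v ckg))
                     (IH _ _ (ckW ckg) (ck_derive v ckf))) => // x /[!inE] Ux.
exact: esym (deriveM (ck_derivable ckf Ux) (ck_derivable ckg Ux)).
Qed.

Lemma ck_prod U k (I : Type) (r : seq I) (f : I -> V -> R) : open U ->
  (forall i, ck k U (f i)) -> ck k U (fun x => \prod_(i <- r) f i x).
Proof.
move=> oU ckf; elim: r => [|i r IH].
  by apply: eq_ck (ck_cst U k (1:R)) => // x _; rewrite big_nil.
by apply: eq_ck (ckM oU (ckf i) IH) => // x _; rewrite big_cons.
Qed.

(** The derivative of 1/f is -(1/f)^2 Df, so order k for 1/f itself yields order k + 1. *)
Lemma ckV U k (f : V -> R) : open U -> (forall x, U x -> f x != 0) ->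
  ck k U f -> ck k U (fun x => (f x)^-1).
Proof.
move=> oU f0; elim: k => [|k IH] ckf.
  by split=> // x Ux; apply: cvgV; [exact: f0|exact: ck_continuous ckf Ux].
have ckVf := IH (ckW ckf).
split=> [x Ux|].
  by apply: cvgV; [exact: f0|exact: ck_continuous ckf Ux].
split=> [x v Ux|v].
  by apply: derivableV; [exact: f0|exact: ck_derivable ckf Ux].
apply: eq_ck (ckN oU (ckM oU (ckM oU ckVf ckVf) (ck_derive v ckf))) => // x /[!inE] Ux.
rewrite deriveV ?f0//; last exact: ck_derivable ckf Ux.
by rewrite -[in RHS]exprVn expr2 scaleNr.
Qed.

Lemma continuous_mxP m n (M : V -> 'M[R]_(m, n)) x :
  {for x, continuous M} <-> forall i j, {for x, continuous (fun y => M y i j)}.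
Proof.
split=> [cM i j|cM]; first exact: continuous_comp cM (@matrix_normedtype.coord_continuous _ _ _ i j _).
move=> A [P nP PA]; apply: filterS PA _ => /=.
rewrite /=.
have : \forall y \near x, forall i j, P i j (M y i j).
  apply: filter_forall => i; apply: filter_forall => j.
  exact: (cM i j).
exact: filterS.
Qed.

Lemma ck_mxP m n U k (M : V -> 'M[R]_(m, n)) : open U ->
  ck k U M <-> forall i j, ck k U (fun x => M x i j).
Proof.
move=> oU; elim: k M => [|k IH] M.
  split=> [[cM _] i j|cM]; first by split=> // x Ux; exact: (continuous_mxP M x).1 (cM x Ux) i j.
  by split=> // x Ux; apply/continuous_mxP => i j; have [+ _] := cM i j; exact.
split=> [ckM i j|ckM].
  split=> [x Ux|]; first exact: (continuous_mxP M x).1 (ck_continuous ckM Ux) i j.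
  split=> [x v Ux|v].
    exact: (derivable_mxP M x v).1 (ck_derivable ckM Ux) i j.
  have := (IH _).1 (ck_derive v ckM) i j; apply: eq_ck => // x /[!inE] Ux.
  by rewrite derive_mx ?mxE//; exact: ck_derivable ckM Ux.
have dM x v : U x -> derivable M x v.
  by move=> Ux; apply/derivable_mxP => i j; exact: ck_derivable (ckM i j) Ux.
split=> [x Ux|].
  by apply/continuous_mxP => i j; exact: ck_continuous (ckM i j) Ux.
split=> [x v|v]; first exact: dM.
apply/IH => i j; apply: eq_ck (ck_derive v (ckM i j)) => // x /[!inE] Ux.
by rewrite derive_mx ?mxE//; exact: dM.
Qed.

End Ck.

(** * Differentiability of C^1 functions and the chain rule *)

Section Differentiable.
Context {R : realType}.

Lemma mx_norm_coord_le m n (M : 'M[R]_(m, n)) i j : `|M i j| <= `|M|.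
Proof.
by rewrite [leRHS]/Num.Def.normr/= mx_normrE; exact: (le_bigmax _ _ (i, j)).
Qed.

Lemma mx_norm_leP m n (M : 'M[R]_(m, n)) (c : R) : 0 <= c ->
  (forall i j, `|M i j| <= c) -> `|M| <= c.
Proof.
move=> c0 H; rewrite [leLHS]/Num.Def.normr/= mx_normrE.
by apply: bigmax_le => // -[i j] _; exact: H.
Qed.

Lemma nbhs_ballP_norm (V : normedModType R) (x : V) (A : set V) :
  nbhs x A -> exists2 r : R, 0 < r & forall y, `|y - x| < r -> A y.
Proof.
move=> /nbhs_ballP[r /= r0 rA]; exists r => // y yx; apply: rA.
by rewrite -ball_normE /= distrC.
Qed.

Lemma dist_le_add (a b c e : R) : `|c - a| <= e -> `|c - b| <= e -> `|a - b| <= e + e.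
Proof. by rewrite !ler_norml => /andP[? ?] /andP[? ?]; apply/andP; split; lra. Qed.

Lemma second_difference_inj (a b c d k A B : R) : 0 < k ->
  a - b - c + d = k * k * A -> a - c - b + d = k * k * B -> A = B.
Proof.
move=> k0 E1 E2; apply: (@mulfI _ (k * k)); first by rewrite mulf_neq0// gt_eqF.
by rewrite -E1 -E2; ring.
Qed.

Lemma two_thirds_lt (d : R) : 0 < d -> d <= d / 3 + d / 3 -> False.
Proof. by lra. Qed.

Lemma near_dist_le (V : normedModType R) (f : V -> R) (x : V) (e : R) :
  {for x, continuous f} -> 0 < e -> \forall y \near x, `|f y - f x| <= e.
Proof.
move=> /cvgrPdist_le cf e0; have := cf e e0.
by apply: filterS => y; rewrite distrC.
Qed.

(** Epsilon-delta access to the little-o notation behind [differentiable]. *)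
Lemma differentiable_estimate (V W : normedModType R) (f : V -> W)
    (df : {linear V -> W}) (x : V) : continuous df ->
  (forall e : R, 0 < e -> exists2 r : R, 0 < r &
     forall h, `|h| < r -> `|f (x + h) - f x - df h| <= e * `|h|) ->
  differentiable f x /\ 'd f x = df :> (V -> W).
Proof.
move=> cdf H.
have E : f \o shift x = cst (f x) + df +o_ 0 id.
  apply/eqaddoP => e e0; have [r r0 Hr] := H e e0.
  apply/nbhs_ballP; exists r => //= h; rewrite -ball_normE /= sub0r normrN => hr.
  by have := Hr h hr; rewrite [x + h]addrC !fctE /= opprD addrA.
have D := diff_unique cdf E.
by split=> //; apply/diff_locallyP; rewrite D.
Qed.

Variable n : nat.
Implicit Types (f : 'rV[R]_n -> R) (O : set 'rV[R]_n).

Local Notation e_ i := (delta_mx 0 i : 'rV[R]_n).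

Definition total_diff f (x h : 'rV[R]_n) : R := \sum_i h 0 i * 'D_(e_ i) f x.

Fact total_diff_linear f x : linear (total_diff f x).
Proof.
move=> a u v; rewrite /total_diff /= scaler_sumr -big_split/=.
by apply: eq_bigr => i _; rewrite !mxE mulrDl -mulrA.
Qed.
HB.instance Definition _ f x :=
  GRing.isLinear.Build R 'rV[R]_n R *:%R (total_diff f x) (total_diff_linear f x).

Fact total_diff_continuous f x : continuous (total_diff f x).
Proof.
move=> y; rewrite /total_diff.
apply: (@ck_continuous _ _ _ setT 0) => //; apply: ck_sum; first exact: openT.
move=> i _; apply: ckM; first exact: openT.
  by split=> // z _; exact: matrix_normedtype.coord_continuous.
exact: ck_cst.
Qed.

(* The increment is telescoped along the coordinate directions, with the mean
   value theorem on each edge. *)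
Lemma c1_estimate f O x (e : R) : open O -> ck 1 O f -> O x -> 0 < e ->
  exists2 r : R, 0 < r &
    forall h, `|h| < r -> `|f (x + h) - f x - total_diff f x h| <= e * `|h|.
Proof.
move=> oO cf Ox e0.
(* Each of the n edges may contribute e' |h|; dividing by n + 1 avoids a zero denominator for n =
   0. *)
pose e' := e / n.+1%:R.
have e'0 : 0 < e' by rewrite divr_gt0.
have [r r0 Hr] : exists2 r : R, 0 < r & forall y, `|y - x| < r ->
    O y /\ forall i, `|'D_(e_ i) f y - 'D_(e_ i) f x| <= e'.
  apply: (@nbhs_ballP_norm _ x
    (O `&` [set y | forall i, `|'D_(e_ i) f y - 'D_(e_ i) f x| <= e'])).
  apply: filterI; first exact: open_nbhs_nbhs.
  suff : \forall y \near x, forall i, `|'D_(e_ i) f y - 'D_(e_ i) f x| <= e' by [].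
  apply: (@filter_forall _ _ (fun i => [set y | `|'D_(e_ i) f y - 'D_(e_ i) f x| <= e']) (nbhs x)) => i.
  have := ck_continuous (ck_derive (e_ i) cf) Ox.
  by move=> /near_dist_le; exact.
exists r => // h hr.
(* [p m] keeps the first m coordinates of h, so consecutive values differ along one basis vector. *)
pose p m : 'rV[R]_n := \row_j (if (j < m)%N then h 0 j else 0).
have p0 : p 0%N = 0 by apply/rowP => j; rewrite !mxE.
have pn : p n = h by apply/rowP => j; rewrite !mxE ltn_ord.
have pS (m : 'I_n) : p m.+1 = p m + h 0 m *: e_ m.
  apply/rowP => j; rewrite !mxE eqxx/= ltnS leq_eqVlt.
  have [jm|jm] := eqVneq (j : nat) m.
    by rewrite (val_inj jm) ltnn eqxx/= mulr1 add0r.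
  have -> : (j == m) = false by apply/negbTE/eqP => E; rewrite E eqxx in jm.
  by rewrite /= mulr0 addr0.
(* In the sup norm, truncating or shrinking coordinates of h does not increase the norm, so every
   edge stays in the ball. *)
have pt (m : 'I_n) (t : R) : 0 <= t <= 1 -> `|x + p m + (t * h 0 m) *: e_ m - x| < r.
  move=> /andP[t0 t1]; rewrite -[x + p m + _]addrA [x + _]addrC addrK.
  rewrite addrC; apply: le_lt_trans hr; apply: mx_norm_leP => // i j; rewrite ord1 !mxE eqxx/=.
  have [jm|jm] := eqVneq j m.
    rewrite jm ltnn addr0 mulr1 normrM (ger0_norm t0).
    by apply: le_trans (mx_norm_coord_le h 0 m); rewrite ler_piMl.
  rewrite mulr0 add0r; case: ifP => _; first exact: mx_norm_coord_le.
  by rewrite normr0.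
have step (m : 'I_n) :
    `|f (x + p m.+1) - f (x + p m) - h 0 m * 'D_(e_ m) f x| <= `|h| * e'.
  rewrite pS addrA.
  have [t t01|t t01 ->] := @mvt_scale _ _ f (x + p m) (e_ m) (h 0 m).
    by apply: ck_derivable cf _; have [] := Hr _ (pt m t t01).
  rewrite -mulrBr normrM; apply: ler_pM => //; first exact: mx_norm_coord_le.
  by have [_] := Hr _ (pt m t t01); exact.
have -> : f (x + h) - f x - total_diff f x h =
    \sum_(m < n) (f (x + p m.+1) - f (x + p m) - h 0 m * 'D_(e_ m) f x).
  rewrite big_split/= sumrN; congr (_ - _).
  have := @telescope_sumr _ 0%N n (fun m => f (x + p m)) (leq0n n).
  by rewrite pn p0 addr0 => <-; rewrite big_mkord.
apply: le_trans (ler_norm_sum _ _ _) _.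
apply: le_trans (ler_sum _ (fun m _ => step m)) _.
rewrite sumr_const card_ord -mulrnAr mulrC ler_wpM2r//.
rewrite /e' -mulr_natr -mulrA ler_piMr ?(ltW e0)// mulrC ler_pdivrMr//.
by rewrite mul1r ler_nat.
Qed.

Lemma c1_differentiable f O x : open O -> ck 1 O f -> O x ->
  differentiable f x /\ 'd f x = total_diff f x :> ('rV[R]_n -> R).
Proof.
move=> oO cf Ox.
apply: (differentiable_estimate (@total_diff_continuous f x)) => e e0.
exact: c1_estimate oO cf Ox e0.
Qed.

Lemma c1_deriveE f O x v : open O -> ck 1 O f -> O x ->
  'D_v f x = \sum_i v 0 i * 'D_(e_ i) f x.
Proof.
by move=> oO cf Ox; have [df E] := c1_differentiable oO cf Ox; rewrite deriveE// E.
Qed.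

(** [phi] has a derivative in the direction [v] only. Restricted to the line through x along v it is
    a differentiable curve, to which the composition rule for differentials applies. *)
Lemma derivable_chain (V : normedModType R) f O (phi : V -> 'rV[R]_n) (x v : V) :
  open O -> ck 1 O f -> O (phi x) -> derivable phi x v ->
  is_derive x v (f \o phi) (\sum_i 'D_v phi x 0 i * 'D_(e_ i) f (phi x)).
Proof.
move=> oO cf Ox dphi; have [df E] := c1_differentiable oO cf Ox.
pose ga (s : R) := phi (x + s *: v).
have ga0 : ga 0 = phi x by rewrite /ga scale0r addr0.
have [D1 D2] : is_derive (0 : R) (1 : R) ga ('D_v phi x).
  exact: is_derive_line0.
have dD : differentiable ga 0 by apply/derivable1_diffP.
have dfD : differentiable f (ga 0) by rewrite ga0.
have dC := differentiable_comp dD dfD.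
apply: is_derive_lineP; change (is_derive (0 : R) (1 : R) (f \o ga) 
  (\sum_i 'D_v phi x 0 i * 'D_(e_ i) f (phi x))).
split; first exact: diff_derivable.
by rewrite (deriveE _ dC) (diff_comp dD dfD) /comp -(deriveE _ dD) D2 ga0 E.
Qed.

(** Induction on the order: a derivative of the composite is a sum of products of derivatives of
    [phi] with (partial derivative of f) o phi, and the latter is again a composite, of lower
    order. *)
Lemma ck_comp (V : normedModType R) k f O (phi : V -> 'rV[R]_n) (U : set V) :
  open O -> open U -> ck k O f -> ck k U phi -> (forall x, U x -> O (phi x)) ->
  ck k U (f \o phi).
Proof.
move=> oO oU + + UO; elim: k f => [|k IH] f cf cphi.
  split=> // x Ux; apply: continuous_comp; first exact: ck_continuous cphi Ux.
  by apply: ck_continuous cf _; exact: UO.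
split=> [x Ux|].
  apply: continuous_comp; first exact: ck_continuous cphi Ux.
  by apply: ck_continuous cf _; exact: UO.
have cf1 : ck 1 O f by apply: ck_le cf.
have D x v : U x -> is_derive x v (f \o phi)
    (\sum_i 'D_v phi x 0 i * 'D_(e_ i) f (phi x)).
  by move=> Ux; apply: (derivable_chain oO cf1 (UO x Ux)); exact: ck_derivable cphi Ux.
split=> [x v Ux|v]; first by have [] := D x v Ux.
apply: (@eq_ck _ _ _ _ _ (fun x => \sum_i 'D_v phi x 0 i * 'D_(e_ i) f (phi x))) => //.
  by move=> x /[!inE] Ux; have [_ ->] := D x v Ux.
apply: ck_sum => // i _; apply: ckM => //.
  by apply: (ck_mxP _ _ oU).1; exact: ck_derive.
by apply: (IH ('D_(e_ i) f)); [exact: ck_derive|exact: ckW].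
Qed.

End Differentiable.

(** * Symmetry of second derivatives *)

Section Schwarz.
Context {R : realType} {V : normedModType R}.

(* The second difference is symmetric in v and w, whence Schwarz's theorem. *)
Lemma derive_second_difference (f : V -> R) (O : set V) (x v w : V) (h : R) :
  ck 2 O f ->
  (forall s t : R, 0 <= s <= 1 -> 0 <= t <= 1 -> O (x + (s * h) *: v + (t * h) *: w)) ->
  exists s t : R, [/\ 0 <= s <= 1, 0 <= t <= 1 &
    f (x + h *: v + h *: w) - f (x + h *: v) - f (x + h *: w) + f x =
    h * h * 'D_w ('D_v f) (x + (s * h) *: v + (t * h) *: w)].
Proof.
move=> cf HO.
have c01 : 0 <= (1 : R) <= 1 by rewrite ler01 lexx.
have c00 : 0 <= (0 : R) <= 1 by rewrite ler01 lexx.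
pose G (y : V) := f (y + h *: w) - f y.
have DG y : O (y + h *: w) -> O y ->
    is_derive y v G ('D_v f (y + h *: w) - 'D_v f y).
  move=> O1 O2.
  have d1 : is_derive y v (fun y => f (y + h *: w)) ('D_v f (y + h *: w)).
    apply: is_derive_lineP.
    have -> : (fun s : R => f (y + s *: v + h *: w)) =
              (fun s : R => f (y + h *: w + s *: v)).
      by apply/funext => s; rewrite addrAC.
    have := @is_derive_line _ _ _ f (y + h *: w) v 0; rewrite scale0r addr0.
    by apply; exact: ck_derivable cf O1.
  have d2 : is_derive y v f ('D_v f y) by apply/derivableP; exact: ck_derivable cf O2.
  exact: is_deriveB.
have G1 (s : R) : 0 <= s <= 1 -> O (x + (s * h) *: v + h *: w).
  by move=> s01; have := HO s 1 s01 c01; rewrite mul1r.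
have G2 (s : R) : 0 <= s <= 1 -> O (x + (s * h) *: v).
  by move=> s01; have := HO s 0 s01 c00; rewrite mul0r scale0r addr0.
have [s s01|s s01 E] := @mvt_scale _ _ G x v h.
  by have [] := DG _ (G1 s s01) (G2 s s01).
have [t t01|t t01 E2] := @mvt_scale _ _ ('D_v f) (x + (s * h) *: v) w h.
  exact: ck_derivable (ck_derive v cf) (HO s t s01 t01).
exists s, t; split=> //.
rewrite -mulrA -E2; have [_ <-] := DG _ (G1 s s01) (G2 s s01).
by rewrite -E /G; lra.
Qed.

(** If the two mixed derivatives differed by d > 0 at x, then on a ball where each varies by at most
    d/3 the common second difference would force d <= 2d/3. *)
Lemma schwarz (f : V -> R) (O : set V) (x v w : V) :
  open O -> ck 2 O f -> O x -> 'D_w ('D_v f) x = 'D_v ('D_w f) x.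
Proof.
move=> oO cf Ox; apply/eqP; rewrite -subr_eq0 -normr_le0 leNgt; apply/negP => d0.
set d := `|_| in d0.
have d20 : 0 < d / 3 by rewrite divr_gt0.
have [r r0 Hr] : exists2 r : R, 0 < r & forall y, `|y - x| < r ->
    O y /\ (`|'D_w ('D_v f) y - 'D_w ('D_v f) x| <= d / 3 /\
            `|'D_v ('D_w f) y - 'D_v ('D_w f) x| <= d / 3).
  apply: (@nbhs_ballP_norm _ _ x (O `&` ([set y | `|'D_w ('D_v f) y - 'D_w ('D_v f) x| <= d / 3] `&`
    [set y | `|'D_v ('D_w f) y - 'D_v ('D_w f) x| <= d / 3]))).
  apply: filterI; first exact: open_nbhs_nbhs.
  have c1 := ck_continuous (ck_derive w (ck_derive v cf)) Ox.
  have c2 := ck_continuous (ck_derive v (ck_derive w cf)) Ox.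
  apply: filterI.
    exact: near_dist_le c1 d20.
  exact: near_dist_le c2 d20.
(* The summand 1 keeps [c] positive when v = w = 0. *)
pose c := `|v| + `|w| + 1.
have c0 : 0 < c by rewrite /c ltr_wpDl// addr_ge0.
have [h h0 hcr] : exists2 h : R, 0 < h & h * c < r.
  exists (r / (2 * c)); first by rewrite divr_gt0// mulr_gt0.
  rewrite invfM mulrA -mulrA mulVf ?gt_eqF// mulr1.
  by rewrite ltr_pdivrMr// mulr2n mulrDr mulr1 ltrDl.
have near_x (s t : R) : 0 <= s <= 1 -> 0 <= t <= 1 ->
    `|x + (s * h) *: v + (t * h) *: w - x| < r.
  move=> /andP[s0 s1] /andP[t0 t1].
  rewrite -[x + _ + _]addrA [x + _]addrC addrK.
  apply: le_lt_trans (ler_normD _ _) _.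
  rewrite !normrZ !(ger0_norm s0) !(ger0_norm t0) !(gtr0_norm h0).
  have A1 : s * h * `|v| <= h * `|v| by rewrite ler_wpM2r// ler_piMl// ltW.
  have A2 : t * h * `|w| <= h * `|w| by rewrite ler_wpM2r// ler_piMl// ltW.
  apply: le_lt_trans (lerD A1 A2) _.
  by move: hcr; rewrite /c; lra.
have [s [t [s01 t01 E1]]] :
    exists s t : R, [/\ 0 <= s <= 1, 0 <= t <= 1 &
    f (x + h *: v + h *: w) - f (x + h *: v) - f (x + h *: w) + f x =
    h * h * 'D_w ('D_v f) (x + (s * h) *: v + (t * h) *: w)].
  apply: derive_second_difference cf _ => s t s01 t01.
  by have [] := Hr _ (near_x s t s01 t01).
have [s' [t' [s'01 t'01 E2]]] :
    exists s t : R, [/\ 0 <= s <= 1, 0 <= t <= 1 &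
    f (x + h *: w + h *: v) - f (x + h *: w) - f (x + h *: v) + f x =
    h * h * 'D_v ('D_w f) (x + (s * h) *: w + (t * h) *: v)].
  apply: derive_second_difference cf _ => s' t' s01' t01'.
  by rewrite addrAC; have [] := Hr _ (near_x t' s' t01' s01').
have [_ [A1 _]] := Hr _ (near_x s t s01 t01).
have [_ [_ A2]] := Hr _ (near_x t' s' t'01 s'01).
rewrite addrAC in A2.
have E : 'D_w ('D_v f) (x + (s * h) *: v + (t * h) *: w) =
         'D_v ('D_w f) (x + (s' * h) *: w + (t' * h) *: v).
  have Exy : x + h *: v + h *: w = x + h *: w + h *: v by rewrite addrAC.
  have E2' := etrans (congr1 (fun z => f z - f (x + h *: w) - f (x + h *: v) + f x) Exy) E2.
  exact: second_difference_inj h0 E1 E2'.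
rewrite E in A1.
exact: two_thirds_lt d0 (dist_le_add A1 A2).
Qed.

Lemma derive_eq0_cst (f : V -> R) (O : set V) (x : V) :
  open O -> ck 1 O f -> (forall y v, O y -> 'D_v f y = 0) -> O x ->
  \forall y \near x, f y = f x.
Proof.
move=> oO cf f0 Ox.
have [r r0 Hr] := nbhs_ballP_norm (open_nbhs_nbhs (conj oO Ox)).
apply/nbhs_ballP; exists r => //= y; rewrite -ball_normE /= distrC => yr.
have HO (t : R) : 0 <= t <= 1 -> O (x + t *: (y - x)).
  move=> /andP[t0 t1]; apply: Hr; rewrite [x + _]addrC addrK normrZ (ger0_norm t0).
  by apply: le_lt_trans yr; rewrite ler_piMl.
have [t t01|t t01] := @mvt_line _ _ f x (y - x); first exact: ck_derivable cf (HO t t01).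
rewrite f0; last exact: HO.
by move/eqP; rewrite subr_eq0 [x + _]addrC subrK => /eqP.
Qed.

End Schwarz.

(** * Existence of solutions of ordinary differential equations *)

Section RealSequences.
Context {R : realType}.

(** Stands in for the passage to the limit in Picard iteration: closed conditions on the limit are
    checked up to an error C / 2^k. *)
Lemma le_geometric_error (x y C : R) : (forall k, x <= y + C / 2 ^+ k) -> x <= y.
Proof.
move=> H; rewrite leNgt; apply/negP => yx.
have d0 : 0 < x - y by rewrite subr_gt0.
have C0 : 0 < C by have := H 0%N; rewrite expr0 divr1 => h; lra.
have [k Hk] : exists k : nat, C / (x - y) < k%:R.
  by exists (Num.truncn (C / (x - y))).+1; rewrite truncnS_gt.
have k2 : (k%:R : R) < 2 ^+ k by rewrite -natrX ltr_nat ltn_expl.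
have := H k; rewrite -lerBlDl => /(lt_le_trans _) H'.
have : C / 2 ^+ k < x - y.
  rewrite ltr_pdivrMr ?exprn_gt0// mulrC -ltr_pdivrMr//.
  exact: lt_trans Hk k2.
by move/H'; rewrite ltxx.
Qed.

(* The limit is the supremum of the lower bounds [u k - 2 b / 2 ^ k]. *)
Lemma geometric_cauchy_limit (u : nat -> R) (b : R) :
  (forall k, `|u k.+1 - u k| <= b / 2 ^+ k) ->
  exists l, forall k, `|u k - l| <= 2 * b / 2 ^+ k.
Proof.
move=> H; pose e k := 2 * b / 2 ^+ k.
have eS k : e k.+1 = e k - b / 2 ^+ k.
  rewrite /e exprS invfM; lra.
have b0 k : 0 <= b / 2 ^+ k by apply: le_trans (H k).
have e0 k : 0 <= e k.
  by rewrite /e -mulrA; have := b0 k; lra.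
have lo j k : u j - e j <= u (j + k)%N - e (j + k)%N.
  elim: k => [|k IH]; first by rewrite addn0.
  rewrite addnS eS; have := H (j + k)%N; rewrite ler_norml => /andP[].
  by move: IH; lra.
have hi j k : u (j + k)%N + e (j + k)%N <= u j + e j.
  elim: k => [|k IH]; first by rewrite addn0.
  rewrite addnS eS; have := H (j + k)%N; rewrite ler_norml => /andP[].
  by move: IH; lra.
have lohi j k : u j - e j <= u k + e k.
  have A := lo j k; have B := hi k j; have C := e0 (j + k)%N.
  by rewrite addnC in B; move: A B C; lra.
pose A := range (fun k => u k - e k).
have A0 : A !=set0 by exists (u 0%N - e 0%N), 0%N.
have Aub k : ubound A (u k + e k) by move=> _ [j _ <-].
have Asup : has_sup A by split=> //; exists (u 0%N + e 0%N).
exists (sup A) => k; rewrite ler_norml -/(e k); apply/andP; split.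
  by rewrite lerBrDl -lerBrDr opprK; apply: ge_sup.
by rewrite lerBlDl -lerBlDr; apply: ub_le_sup; [exists (u 0%N + e 0%N)|exists k].
Qed.

Lemma continuous_primitive (f : R -> R) (e : R) : 0 < e -> continuous f ->
  exists2 P : R -> R, P 0 = 0 & forall t, `|t| <= e -> is_derive t (1 : R) P (f t).
Proof.
(* The fundamental theorem holds at interior points, so the interval is enlarged by 1 on both sides.
   The integral starts at [a], whence the later subtraction of F 0. *)
move=> e0 cf; pose a := - (e + 1); pose b := e + 1.
have ab : a <= b by rewrite /a /b; move: e0; lra.
have intf : lebesgue_measure.-integrable `[a, b] (EFin \o f).
  apply: continuous_compact_integrable; first exact: segment_compact.
  exact: continuous_subspaceT.
pose F (x : R) := (\int[lebesgue_measure]_(t in `[a, x]) (f t))%R.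
exists (fun x => F x - F 0); first by rewrite subrr.
move=> t; rewrite ler_norml => /andP[t1 t2].
have tb : t < b by rewrite /b; move: t2; lra.
have at_ : a < t by rewrite /a; move: t1; lra.
have [dF F'] := continuous_FTC1_closed tb intf at_ (cf t).
have D : is_derive t (1 : R) F (f t) by split; [exact: dF|rewrite -derive1E].
have := is_deriveB D (is_derive_cst (F 0) t 1); rewrite subr0.
exact.
Qed.

End RealSequences.

Section VectorCurves.
Context {R : realType} {n : nat}.
Implicit Types (c p : R -> 'rV[R]_n) (e C : R).

Lemma is_derive_rowP c (t v : R) (l : 'rV[R]_n) :
  is_derive t v c l <-> forall i, is_derive t v (fun s => c s 0 i) (l 0 i).
Proof.
split=> [[dc <-] i|H].
  have /derivable_mxP dci := dc; split; first exact: dci.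
  by rewrite derive_mx// mxE.
have dc : derivable c t v.
  by apply/derivable_mxP => i j; rewrite ord1; have [] := H j.
split=> //; rewrite derive_mx//; apply/rowP => i; rewrite mxE.
by have [_] := H i.
Qed.

Lemma continuous_primitive_row p e : 0 < e -> continuous p ->
  exists2 P : R -> 'rV[R]_n, P 0 = 0 &
    forall t, `|t| <= e -> is_derive t (1 : R) P (p t).
Proof.
move=> e0 cp.
have /choice[P HP] (i : 'I_n) : exists P : R -> R, P 0 = 0 /\
    forall t, `|t| <= e -> is_derive t (1 : R) P (p t 0 i).
  have [P P0 HP] := @continuous_primitive R (fun t => p t 0 i) e e0
    (fun t => (continuous_mxP p t).1 (cp t) 0 i).
  by exists P.
exists (fun t => \row_i P i t).
  by apply/rowP => i; rewrite !mxE; have [] := HP i.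
move=> t te; apply/is_derive_rowP => i.
have [_ /(_ t te)] := HP i.
by congr (is_derive _ _ _ _); apply/funext => s; rewrite mxE.
Qed.

(** In the sup norm the mean value inequality follows from the mean value theorem for each
    component. *)
Lemma le_derive_lipschitz p c e C : 0 <= C ->
  (forall t, `|t| <= e -> is_derive t (1 : R) c (p t)) ->
  (forall t, `|t| <= e -> `|p t| <= C) ->
  forall s t, `|s| <= e -> `|t| <= e -> `|c s - c t| <= C * `|s - t|.
Proof.
move=> C0 dc pC s t se te; apply: mx_norm_leP; first by rewrite mulr_ge0.
move=> i0 i; rewrite ord1 !mxE {i0}.
have seg (x : R) : 0 <= x <= 1 -> `|t + x * (s - t)| <= e.
  move: se te; rewrite !ler_norml => /andP[s1 s2] /andP[t1 t2] /andP[x0 x1].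
  apply/andP; split.
    have : 0 <= (1 - x) * (t + e) + x * (s + e).
      by rewrite addr_ge0// mulr_ge0//; [move: x1|move: t1|move: s1]; lra.
    by lra.
  have : 0 <= (1 - x) * (e - t) + x * (e - s).
    by rewrite addr_ge0// mulr_ge0//; [move: x1|move: t2|move: s2]; lra.
  by lra.
have D x : `|x| <= e -> is_derive x (1 : R) (fun s => c s 0 i) (p x 0 i).
  by move=> xe; have /is_derive_rowP := dc x xe; exact.
have E (x : R) : t + (x * (s - t)) *: (1 : R) = t + x * (s - t).
  by congr (_ + _); exact: mulr1.
have [x /seg x01|x x01] := @mvt_scale R R (fun s => c s 0 i) t 1 (s - t).
  by rewrite E; have [] := D _ x01.
have -> : t + (s - t) *: (1 : R) = s by have := E 1; rewrite !mul1r => ->; rewrite addrC subrK.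
rewrite E; have [_ ->] := D _ (seg x x01) => ->.
rewrite normrM mulrC ler_wpM2r//.
exact: le_trans (mx_norm_coord_le _ _ _) (pC _ (seg x x01)).
Qed.

Lemma lipschitz_continuous_curve p C :
  (forall s t, `|p s - p t| <= C * `|s - t|) -> continuous p.
Proof.
move=> H t; apply/cvgrPdist_lt => e e0.
have C0 : 0 < `|C| + 1 by rewrite ltr_wpDl.
have d0 : 0 < e / (`|C| + 1) by rewrite divr_gt0.
apply/nbhs_ballP; exists (e / (`|C| + 1)) => //= s; rewrite /ball /= => ts.
apply: le_lt_trans (H _ _) _.
have ts' : `|t - s| * (`|C| + 1) < e by rewrite -ltr_pdivlMr.
apply: le_lt_trans ts'; rewrite mulrC ler_wpM2l//.
by apply: le_trans (ler_norm C) _; rewrite lerDl.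
Qed.

End VectorCurves.

(** * Lipschitz bounds, Picard iteration and flows *)

Section LocalLipschitz.
Context {R : realType} {n : nat}.

Lemma c1_locally_lipschitz (F : 'rV[R]_n -> 'rV[R]_n) (O : set 'rV[R]_n) z0 :
  open O -> ck 1 O F -> O z0 ->
  exists r K : R, [/\ 0 < r, 0 < K,
    forall z, `|z - z0| <= r -> O z /\ `|F z| <= K &
    forall y z, `|y - z0| <= r -> `|z - z0| <= r -> `|F y - F z| <= K * `|y - z|].
Proof.
move=> oO cF Oz.
have cFi i : ck 1 O (fun z => F z 0 i) by apply: (ck_mxP _ _ oO).1.
pose d (i j : 'I_n) z := 'D_(delta_mx 0 j) (fun z => F z 0 i) z.
pose C := \sum_i \sum_j `|d i j z0| + 1.
have C1 : 1 <= C by rewrite /C lerDr; apply: sumr_ge0 => i _; apply: sumr_ge0.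
have dC i j : `|d i j z0| + 1 <= C.
  rewrite /C lerD2r (bigD1 i)//= (bigD1 j)//= -addrA lerDl addr_ge0//.
    by apply: sumr_ge0.
  by apply: sumr_ge0 => ? _; apply: sumr_ge0.
have near_d i j : \forall z \near z0, `|d i j z - d i j z0| <= 1.
  by apply: near_dist_le => //; exact: ck_continuous (ck_derive _ (cFi i)) Oz.
have near_F i : \forall z \near z0, `|F z 0 i - F z0 0 i| <= 1.
  by apply: (@near_dist_le _ _ (fun z => F z 0 i)) => //; exact: ck_continuous (cFi i) Oz.
have near_ds : \forall z \near z0, forall i j, `|d i j z - d i j z0| <= 1.
  apply: (@filter_forall _ _ (fun i => [set z | forall j, `|d i j z - d i j z0| <= 1]) (nbhs z0)) => i.
  by apply: (@filter_forall _ _ (fun j => [set z | `|d i j z - d i j z0| <= 1]) (nbhs z0)) => j; exact: near_d.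
have near_Fs : \forall z \near z0, forall i, `|F z 0 i - F z0 0 i| <= 1.
  by apply: (@filter_forall _ _ (fun i => [set z | `|F z 0 i - F z0 0 i| <= 1]) (nbhs z0)) => i; exact: near_F.
have [r r0 Hr] := nbhs_ballP_norm (filterI (open_nbhs_nbhs (conj oO Oz))
   (filterI near_ds near_Fs)).
have r2 z : `|z - z0| <= r / 2 -> `|z - z0| < r.
  by move=> h; apply: le_lt_trans h _; move: r0; lra.
(* One constant serves as bound and as Lipschitz constant: n C comes from the n partial derivatives,
   |F z0| + 1 from the values near z0. *)
pose K := n%:R * C + `|F z0| + 1.
have K0 : 0 < K.
  rewrite /K ltr_wpDl// addr_ge0// mulr_ge0//.
  exact: le_trans C1.
exists (r / 2), K; split=> //; first by rewrite divr_gt0.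
  move=> z /r2/Hr[Oz' [_ Fz]]; split=> //.
  apply: mx_norm_leP; first exact: ltW.
  move=> i0 i; rewrite ord1.
  have A : `|F z 0 i| <= `|F z0 0 i| + 1.
    rewrite -(subrK (F z0 0 i) (F z 0 i)) addrC.
    by apply: le_trans (ler_normD _ _) _; rewrite lerD2l.
  apply: le_trans A _; rewrite /K lerD2r.
  apply: le_trans (mx_norm_coord_le _ _ _) _; rewrite lerDr mulr_ge0//.
  exact: le_trans C1.
move=> y z yr zr; apply: mx_norm_leP; first by rewrite mulr_ge0// ltW.
move=> i0 i; rewrite ord1 !mxE {i0}.
(* Balls are convex, so the mean value theorem can be used along the segment from z to y. *)
have seg (t : R) : 0 <= t <= 1 -> `|z + t *: (y - z) - z0| < r.
  move=> /andP[t0 t1].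
  have -> : z + t *: (y - z) - z0 = t *: (y - z0) + (1 - t) *: (z - z0).
    by apply/matrixP => ? ?; rewrite !mxE; ring.
  apply: le_lt_trans (ler_normD _ _) _; rewrite !normrZ.
  rewrite (ger0_norm t0) ger0_norm ?subr_ge0//.
  apply: (@le_lt_trans _ _ (r / 2)); last by rewrite ltr_pdivrMr// mulr2n mulrDr mulr1 ltrDl.
  have -> : r / 2 = t * (r / 2) + (1 - t) * (r / 2) by rewrite -mulrDl addrC subrK mul1r.
  by apply: lerD; apply: ler_wpM2l => //; rewrite subr_ge0.
have [t t01|t /seg t01] := @mvt_line R _ (fun z => F z 0 i) z (y - z).
  by apply: ck_derivable (cFi i) _; have [] := Hr _ (seg t t01).
rewrite [z + (y - z)]addrC subrK => ->.
have [Oy [Hd _]] := Hr _ t01.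
rewrite (c1_deriveE _ oO (cFi i) Oy).
apply: le_trans (ler_norm_sum _ _ _) _.
apply: (@le_trans _ _ (\sum_(j < n) `|y - z| * C)).
  apply: ler_sum => j _; rewrite normrM; apply: ler_pM => //.
    exact: mx_norm_coord_le.
  apply: le_trans (dC i j); rewrite -/(d i j _).
  rewrite -(subrK (d i j z0) (d i j (_ + _))) addrC.
  by apply: le_trans (ler_normD _ _) _; rewrite lerD2l.
rewrite sumr_const card_ord -mulrnAr -mulr_natl mulrC ler_wpM2r//.
by rewrite /K -addrA lerDl addr_ge0.
Qed.

End LocalLipschitz.

Section Picard.
Context {R : realType} {n : nat}.
Variables (F : 'rV[R]_n -> 'rV[R]_n) (z0 : 'rV[R]_n) (r K e : R).
Hypotheses (r0 : 0 < r) (K0 : 0 < K) (e0 : 0 < e) (Ker : K * e <= r)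
  (Ke2 : K * e <= 1 / 2).
Hypothesis F_bound : forall z, `|z - z0| <= r -> `|F z| <= K.
Hypothesis F_lip : forall y z, `|y - z0| <= r -> `|z - z0| <= r ->
  `|F y - F z| <= K * `|y - z|.

(* Curves are defined on all of R, but constrained only on [-e, e]; clamping time
   to [-e, e] makes the integrand continuous everywhere. *)
Definition picard_curve (c : R -> 'rV[R]_n) : Prop :=
  [/\ c 0 = z0, forall t, `|t| <= e -> `|c t - z0| <= r &
   forall s t, `|s| <= e -> `|t| <= e -> `|c s - c t| <= K * `|s - t|].

Let clamp (t : R) : R := Num.max (- e) (Num.min t e).

Let clamp_le t : `|clamp t| <= e.
Proof.
rewrite /clamp ler_norml; apply/andP; split; first by rewrite le_max lexx.
by rewrite ge_max ge_min lexx orbT andbT; move: e0; lra.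
Qed.

Let clamp_id t : `|t| <= e -> clamp t = t.
Proof.
rewrite ler_norml /clamp => /andP[t1 t2].
by rewrite min_l// max_r.
Qed.

Let clamp_lip s t : `|clamp s - clamp t| <= `|s - t|.
Proof.
have A := ler_norm (s - t); have B := ler_norm (t - s); rewrite distrC in B.
have ee : - e <= e by move: e0; lra.
have cases x : [\/ clamp x = x, clamp x = e /\ e <= x | clamp x = - e /\ x <= - e].
  have [xe|/ltW xe] := leP x e; last first.
    by constructor 2; rewrite /clamp min_r// max_r.
  have [ex|/ltW xe'] := leP (- e) x.
    by constructor 1; rewrite /clamp min_l// max_r.
  by constructor 3; rewrite /clamp min_l// max_l.
have := clamp_le s; have := clamp_le t.
rewrite !ler_norml => /andP[t1 t2] /andP[s1 s2].
by apply/andP; case: (cases s) => [E1|[E1 ?]|[E1 ?]]; case: (cases t) => [E2|[E2 ?]|[E2 ?]];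
  move: t1 t2 s1 s2; rewrite E1 E2 => *; split; lra.
Qed.

(** The integral of F o c has speed at most K, so K e <= r keeps the new curve in the ball. *)
Lemma picard_step c : picard_curve c -> exists c', picard_curve c' /\
  forall t, `|t| <= e -> is_derive t (1 : R) c' (F (c t)).
Proof.
move=> [c0 cr cK].
have Flip s t : `|F (c (clamp s)) - F (c (clamp t))| <= K * K * `|s - t|.
  apply: le_trans (F_lip (cr _ (clamp_le s)) (cr _ (clamp_le t))) _.
  rewrite -mulrA ler_wpM2l ?(ltW K0)//.
  apply: le_trans (cK _ _ (clamp_le s) (clamp_le t)) _.
  by rewrite ler_wpM2l ?(ltW K0).
have [P P0 HP] := continuous_primitive_row e0 (lipschitz_continuous_curve Flip).
have dP t : `|t| <= e -> is_derive t (1 : R) P (F (c t)).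
  by move=> te; have := HP t te; rewrite clamp_id.
have Pb t : `|t| <= e -> `|F (c t)| <= K by move=> te; apply: F_bound; exact: cr.
have PK := le_derive_lipschitz (ltW K0) dP Pb.
have z_e : `|0 : R| <= e by rewrite normr0 ltW.
exists (fun t => z0 + P t); split; last first.
  move=> t te; have d0 : is_derive t (1 : R) (cst z0 : R -> 'rV[R]_n) 0.
    exact: is_derive_cst.
  have d1 := dP t te.
  by have := is_deriveD d0 d1; rewrite add0r.
split; first by rewrite P0 addr0.
  move=> t te; rewrite addrC addKr.
  have := PK t 0 te z_e; rewrite P0 !subr0 => h; apply: le_trans h _.
  by apply: le_trans Ker; rewrite ler_wpM2l// ltW.
move=> s t se te; rewrite opprD addrACA subrr add0r; exact: PK.
Qed.

(** Integrating over [-e, e] multiplies distances by at most K e <= 1/2; this is the origin of the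
    ratio 1/2 in all error bounds. *)
Lemma picard_contraction c1 c2 d1 d2 C : 0 <= C ->
  picard_curve c1 -> picard_curve c2 ->
  (forall t, `|t| <= e -> is_derive t (1 : R) d1 (F (c1 t))) ->
  (forall t, `|t| <= e -> is_derive t (1 : R) d2 (F (c2 t))) ->
  d1 0 = d2 0 ->
  (forall t, `|t| <= e -> `|c1 t - c2 t| <= C) ->
  forall t, `|t| <= e -> `|d1 t - d2 t| <= C / 2.
Proof.
move=> C0 [_ cr1 _] [_ cr2 _] D1 D2 d0 HC t te.
have D t' : `|t'| <= e -> is_derive t' (1 : R) (d1 - d2) (F (c1 t') - F (c2 t')).
  move=> t'e; have D1' := D1 t' t'e; have D2' := D2 t' t'e; exact: is_deriveB.
have Pb t' : `|t'| <= e -> `|F (c1 t') - F (c2 t')| <= K * C.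
  move=> t'e; apply: le_trans (F_lip (cr1 _ t'e) (cr2 _ t'e)) _.
  by rewrite ler_wpM2l ?(ltW K0)//; exact: HC.
have z_e : `|0 : R| <= e by rewrite normr0 ltW.
have KC0 : 0 <= K * C by rewrite mulr_ge0// ltW.
have := le_derive_lipschitz KC0 D Pb te z_e.
have -> : (d1 - d2) t - (d1 - d2) 0 = d1 t - d2 t.
  by rewrite !fctE d0 subrr subr0.
rewrite subr0 => h; apply: le_trans h _.
apply: (@le_trans _ _ (K * C * e)); first by rewrite ler_wpM2l.
by rewrite mulrAC mulrC ler_wpM2l//; move: Ke2; lra.
Qed.

Lemma picard_solution : exists c, picard_curve c /\
  forall t, `|t| <= e -> is_derive t (1 : R) c (F (c t)).
Proof.
have base : picard_curve (fun=> z0).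
  split=> // [t _|s t _ _]; first by rewrite subrr normr0 ltW.
  by rewrite subrr normr0 mulr_ge0// ltW.
(* The step exists only for curves satisfying [picard_curve], so the iterates carry that proof
   along. *)
have /choice[G HG] (c : {c | picard_curve c}) : exists c' : {c | picard_curve c},
    forall t, `|t| <= e -> is_derive t (1 : R) (sval c') (F (sval c t)).
  have [c' [pc' dc']] := picard_step (svalP c).
  by exists (exist _ c' pc').
pose u k : R -> 'rV[R]_n := sval (iter k G (exist _ _ base)).
have pu k : picard_curve (u k) by exact: svalP.
have du k t : `|t| <= e -> is_derive t (1 : R) (u k.+1) (F (u k t)).
  exact: HG.
have u0 j k : u j 0 = u k 0 by have [-> _ _] := pu j; have [-> _ _] := pu k.
(* Two curves in the ball of radius r are at most 2 r apart; each iteration halves the gap. *)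
have ustep k t : `|t| <= e -> `|u k.+1 t - u k t| <= 2 * r / 2 ^+ k.
  elim: k t => [|k IH] t te.
    rewrite expr0 divr1; have [_ /(_ t te) A _] := pu 1%N; have [_ /(_ t te) B _] := pu 0%N.
    apply: le_trans (ler_distD z0 _ _) _; rewrite mulr2n mulrDl mul1r.
    by apply: lerD => //; rewrite distrC.
  rewrite exprSr invfM mulrA.
  apply: (picard_contraction _ (pu k.+1) (pu k) (du _) (du _) (u0 _ _) IH te).
  have z_e : `|0 : R| <= e by rewrite normr0 ltW.
  exact: le_trans (IH 0 z_e).
(* Outside [-e, e] the limit curve gets an arbitrary value. *)
have /choice[c Hc] (t : R) : exists l : 'rV[R]_n, `|t| <= e ->
    forall k, `|u k t - l| <= 2 * (2 * r) / 2 ^+ k.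
  have [te|te] := pselect (`|t| <= e); last by exists 0.
  have /choice[l Hl] (i : 'I_n) : exists l, forall k, `|u k t 0 i - l| <= 2 * (2 * r) / 2 ^+ k.
    apply: geometric_cauchy_limit => k.
    apply: le_trans (ustep k t te).
    by have := mx_norm_coord_le (u k.+1 t - u k t) 0 i; rewrite !mxE.
  exists (\row_i l i) => _ k; apply: mx_norm_leP.
    by rewrite divr_ge0// ?exprn_ge0// mulr_ge0// mulr_ge0// ltW.
  by move=> i j; rewrite ord1 !mxE.
set C := 2 * (2 * r) in Hc.
have C0 : 0 <= C by rewrite /C; move: r0; lra.
have pc : picard_curve c.
  have z_e : `|0 : R| <= e by rewrite normr0 ltW.
  split.
  - apply/eqP; rewrite -subr_eq0 -normr_le0; apply: (@le_geometric_error _ _ _ C) => k.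
    by rewrite add0r distrC; have := Hc 0 z_e k; have [-> _ _] := pu k.
  - move=> t te; apply: (@le_geometric_error _ _ _ C) => k.
    apply: le_trans (ler_distD (u k t) _ _) _; rewrite addrC; apply: lerD.
      by have [_ + _] := pu k; exact.
    by rewrite distrC; exact: Hc.
  move=> s t se te; apply: (@le_geometric_error _ _ _ (C + C)) => k.
  apply: le_trans (ler_distD (u k s) _ _) _.
  apply: le_trans (lerD (lexx _) (ler_distD (u k t) _ _)) _.
  rewrite addrCA mulrDl; apply: lerD; first by have [_ _] := pu k; exact.
  by apply: lerD; [rewrite distrC|]; exact: Hc.
(* The pointwise limit [c] is not yet known to be differentiable. One more step gives [c'] with
   derivative F o c, and the contraction shows that [c'] equals [c] on [-e, e]. *)
have [c' [pc' dc']] := picard_step pc.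
have cc' t : `|t| <= e -> c' t = c t.
  move=> te; apply/eqP; rewrite -subr_eq0 -normr_le0.
  apply: (@le_geometric_error _ _ _ (C + C)) => k.
  rewrite add0r mulrDl; apply: le_trans (ler_distD (u k.+1 t) _ _) _; apply: lerD.
    rewrite distrC; have Ck : 0 <= C / 2 ^+ k by rewrite divr_ge0// exprn_ge0.
    have := picard_contraction Ck (pu k) pc (du k) dc' _ (fun t te => Hc t te k) te.
    have [-> _ _] := pu k.+1; have [-> _ _] := pc'.
    move=> /(_ erefl) h; apply: le_trans h _.
    by rewrite ler_pdivrMr// ler_peMr// ler1n.
  apply: le_trans (Hc t te k.+1) _.
  by rewrite ler_wpM2l// lef_pV2 ?posrE ?exprn_gt0// ler_eXn2l// ltr1n.
exists c'; split=> // t te; rewrite cc'//; exact: dc'.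
Qed.

End Picard.

Section Flow.
Context {R : realType} {n : nat}.

Lemma c1_flow (F : 'rV[R]_n -> 'rV[R]_n) (O : set 'rV[R]_n) z0 :
  open O -> ck 1 O F -> O z0 ->
  exists e (c : R -> 'rV[R]_n), [/\ 0 < e, c 0 = z0,
    forall t, `|t| < e -> O (c t) &
    forall t, `|t| < e -> is_derive t (1 : R) c (F (c t))].
Proof.
move=> oO cF Oz; have [r [K [r0 K0 Hb Hl]]] := c1_locally_lipschitz oO cF Oz.
pose e := Num.min (r / K) (1 / 2 / K).
have e0 : 0 < e by rewrite lt_min !divr_gt0.
have Ker : K * e <= r by rewrite mulrC -ler_pdivlMr// ge_min lexx.
have Ke2 : K * e <= 1 / 2 by rewrite mulrC -ler_pdivlMr// ge_min lexx orbT.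
have Fb z : `|z - z0| <= r -> `|F z| <= K by move=> /Hb[].
have [c [[c0 cr _] dc]] := picard_solution r0 K0 e0 Ker Ke2 Fb Hl.
exists e, c; split=> // t /ltW te; last exact: dc.
by have [] := Hb _ (cr t te).
Qed.

(** Bootstrapping: c' = F o c, so c gains one order of regularity at a time. *)
Lemma flow_smooth (F : 'rV[R]_n -> 'rV[R]_n) (O : set 'rV[R]_n)
    (I : set R) (c : R -> 'rV[R]_n) :
  open O -> open I -> (forall k, ck k O F) ->
  (forall t, I t -> O (c t)) ->
  (forall t, I t -> is_derive t (1 : R) c (F (c t))) ->
  forall k, ck k I c.
Proof.
move=> oO oI cF IO dc.
have dcv t v : I t -> is_derive t v c (v *: F (c t)).
  move=> It; have [D1 D2] := dc t It.
  have := is_derive_scale v D1; rewrite D2.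
  by have -> : v *: (1 : R) = v by exact: mulr1.
have cc t : I t -> {for t, continuous c}.
  move=> It; apply: differentiable_continuous; apply/derivable1_diffP.
  by have [] := dc t It.
elim=> [|k IH]; first by split.
split; first exact: cc.
split=> [t v It|v]; first by have [] := dcv t v It.
apply: (@eq_ck _ _ _ _ _ (v \*: (F \o c))) => //.
  by move=> t /[!inE] It; have [_ ->] := dcv t v It.
apply: ckZ => //; apply/ck_mxP => // i j.
have cFij : ck k O (fun z => F z i j) by apply: (ck_mxP _ _ oO).1.
exact: (ck_comp oO oI cFij IH IO).
Qed.

End Flow.

(** * Calculus of smooth functions *)

Section SmoothOn.
Context {R : realType} {V : normedModType R} (U : set V) (oU : open U).
Implicit Types f g : V -> R.

Lemma eq_smooth_on (W : normedModType R) (f g : V -> W) :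
  {in U, f =1 g} -> smooth_on U f -> smooth_on U g.
Proof. by move=> fg /smooth_onP H; apply/smooth_onP => k; exact: eq_ck (H k). Qed.

Lemma smooth_on_cst (c : R) : smooth_on U (fun=> c).
Proof. by apply/smooth_onP => k; exact: ck_cst. Qed.

Lemma smooth_onD f g : smooth_on U f -> smooth_on U g -> smooth_on U (fun x => f x + g x).
Proof.
by move=> /smooth_onP H /smooth_onP H'; apply/smooth_onP => k; exact: ckD.
Qed.

Lemma smooth_onN f : smooth_on U f -> smooth_on U (fun x => - f x).
Proof. by move=> /smooth_onP H; apply/smooth_onP => k; exact: ckN. Qed.

Lemma smooth_onB f g : smooth_on U f -> smooth_on U g -> smooth_on U (fun x => f x - g x).
Proof. by move=> sf sg; exact: smooth_onD sf (smooth_onN sg). Qed.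

Lemma smooth_onM f g : smooth_on U f -> smooth_on U g -> smooth_on U (fun x => f x * g x).
Proof.
by move=> /smooth_onP H /smooth_onP H'; apply/smooth_onP => k; exact: ckM.
Qed.

Lemma smooth_onV f : (forall x, U x -> f x != 0) -> smooth_on U f ->
  smooth_on U (fun x => (f x)^-1).
Proof. by move=> f0 /smooth_onP H; apply/smooth_onP => k; exact: ckV. Qed.

Lemma smooth_on_sum (I : Type) (r : seq I) (P : pred I) (f : I -> V -> R) :
  (forall i, smooth_on U (f i)) -> smooth_on U (fun x => \sum_(i <- r | P i) f i x).
Proof.
move=> H; apply/smooth_onP => k; apply: ck_sum => // i _.
by have /smooth_onP := H i; exact.
Qed.

Lemma smooth_on_prod (I : Type) (r : seq I) (f : I -> V -> R) :
  (forall i, smooth_on U (f i)) -> smooth_on U (fun x => \prod_(i <- r) f i x).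
Proof.
move=> H; apply/smooth_onP => k; apply: ck_prod => // i.
by have /smooth_onP := H i; exact.
Qed.

Lemma smooth_on_mxP m n (A : V -> 'M[R]_(m, n)) :
  smooth_on U A <-> forall i j, smooth_on U (fun x => A x i j).
Proof.
split=> [/smooth_onP H i j|H]; apply/smooth_onP => k.
  exact: (ck_mxP _ _ oU).1 (H k) i j.
by apply/(ck_mxP _ _ oU) => i j; have /smooth_onP := H i j; exact.
Qed.

Lemma smooth_on_det n (A : V -> 'M[R]_n) :
  (forall i j, smooth_on U (fun x => A x i j)) -> smooth_on U (fun x => \det (A x)).
Proof.
move=> sA; rewrite /determinant; apply: smooth_on_sum => s.
by apply: smooth_onM; [exact: smooth_on_cst|apply: smooth_on_prod => i; exact: sA].
Qed.

(** Cramer's formula writes the entries as cofactors divided by a nonvanishing determinant. *)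
Lemma smooth_on_invmx n (A : V -> 'M[R]_n) :
  (forall i j, smooth_on U (fun x => A x i j)) ->
  (forall x, U x -> A x \in unitmx) ->
  forall i j, smooth_on U (fun x => invmx (A x) i j).
Proof.
move=> sA uA i j.
apply: (@eq_smooth_on _ (fun x => (\det (A x))^-1 * cofactor (A x) j i)).
  by move=> x /[!inE] Ux; rewrite /invmx uA// !mxE.
apply: smooth_onM.
  apply: smooth_onV; last exact: smooth_on_det.
  by move=> x Ux; have := uA x Ux; rewrite unitmxE unitfE.
rewrite /cofactor; apply: smooth_onM; first exact: smooth_on_cst.
apply: smooth_on_det => k l.
apply: (@eq_smooth_on _ (fun x => A x (lift j k) (lift i l))) => //.
by move=> x _; rewrite !mxE.
Qed.

Lemma smooth_on_derive (W : normedModType R) (f : V -> W) v :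
  smooth_on U f -> smooth_on U ('D_v f).
Proof.
move=> /smooth_onP H; apply/smooth_onP => k; exact: ck_derive (H k.+1).
Qed.

Lemma smooth_on_derivable (W : normedModType R) (f : V -> W) x v :
  smooth_on U f -> U x -> derivable f x v.
Proof. by move=> /smooth_onP H; exact: ck_derivable (H 1%N). Qed.

Lemma smooth_on_comp n (f : 'rV[R]_n -> R) (O : set 'rV[R]_n) (phi : V -> 'rV[R]_n) :
  open O -> smooth_on O f -> smooth_on U phi -> (forall x, U x -> O (phi x)) ->
  smooth_on U (fun x => f (phi x)).
Proof.
move=> oO /smooth_onP sf /smooth_onP sphi UO; apply/smooth_onP => k.
exact: (ck_comp oO oU (sf k) (sphi k) UO).
Qed.

Lemma smooth_on_comp_row m n (f : 'rV[R]_n -> 'rV[R]_m) (O : set 'rV[R]_n) (phi : V -> 'rV[R]_n) :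
  open O -> smooth_on O f -> smooth_on U phi -> (forall x, U x -> O (phi x)) ->
  smooth_on U (fun x => f (phi x)).
Proof.
move=> oO sf sphi UO; apply/smooth_on_mxP => i j.
apply: (@smooth_on_comp _ (fun z => f z i j) O phi oO _ sphi UO).
apply/smooth_onP => k; apply: (ck_mxP _ _ oO).1.
by move: k; apply/smooth_onP.
Qed.

Lemma smooth_on_sub (W : normedModType R) (U' : set V) (f : V -> W) :
  U' `<=` U -> smooth_on U f -> smooth_on U' f.
Proof. by move=> s H vs x /s; exact: H. Qed.

End SmoothOn.

Section Partial.
Context {R : realType} {n : nat} (O : set 'rV[R]_n) (oO : open O).
Implicit Types (f h : 'rV[R]_n -> R) (u : 'rV[R]_n).

Lemma eq_partial k f h u : {in O, f =1 h} -> O u -> partial k f u = partial k h u.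
Proof. by move=> fh Ou; apply: near_eq_derive; exact: eq_near_open fh Ou. Qed.

Lemma partialD k f h u : smooth_on O f -> smooth_on O h -> O u ->
  partial k (fun w => f w + h w) u = partial k f u + partial k h u.
Proof.
move=> sf sh Ou.
exact (deriveD (smooth_on_derivable sf Ou) (smooth_on_derivable sh Ou)).
Qed.

Lemma partialN k f u : smooth_on O f -> O u ->
  partial k (fun w => - f w) u = - partial k f u.
Proof. by move=> sf Ou; exact (deriveN (smooth_on_derivable sf Ou)). Qed.

Lemma partialB k f h u : smooth_on O f -> smooth_on O h -> O u ->
  partial k (fun w => f w - h w) u = partial k f u - partial k h u.
Proof. by move=> sf sh Ou; rewrite (partialD _ sf (smooth_onN oO sh) Ou) (partialN _ sh Ou). Qed.

Lemma partialM k f h u : smooth_on O f -> smooth_on O h -> O u ->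
  partial k (fun w => f w * h w) u = partial k f u * h u + f u * partial k h u.
Proof.
move=> sf sh Ou.
rewrite addrC [partial k f u * _]mulrC.
exact (deriveM (smooth_on_derivable sf Ou) (smooth_on_derivable sh Ou)).
Qed.

Lemma partial_cst k (c : R) u : partial k (fun=> c) u = 0.
Proof. exact: derive_cst. Qed.

Lemma partial_sum k (I : Type) (r : seq I) (f : I -> 'rV[R]_n -> R) u :
  (forall i, smooth_on O (f i)) -> O u ->
  partial k (fun w => \sum_(i <- r) f i w) u = \sum_(i <- r) partial k (f i) u.
Proof.
move=> sf Ou; elim: r => [|i r IH].
  by rewrite big_nil (@eq_partial _ _ (fun=> 0)) ?partial_cst// => w _; rewrite big_nil.
rewrite big_cons -IH -partialD//; last exact: smooth_on_sum.
by apply: eq_partial => // w _; rewrite big_cons.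
Qed.

Lemma partialC k l f u : smooth_on O f -> O u ->
  partial k (partial l f) u = partial l (partial k f) u.
Proof. by move=> /smooth_onP sf Ou; exact: schwarz oO (sf 2%N) Ou. Qed.

Definition smooth_mx p q (A : 'rV[R]_n -> 'M[R]_(p, q)) : Prop :=
  forall i j, smooth_on O (fun u => A u i j).

Definition partial_mx k p q (A : 'rV[R]_n -> 'M[R]_(p, q)) u : 'M[R]_(p, q) :=
  \matrix_(i, j) partial k (fun w => A w i j) u.

Lemma eq_partial_mx k p q (A B : 'rV[R]_n -> 'M[R]_(p, q)) u :
  {in O, A =1 B} -> O u -> partial_mx k A u = partial_mx k B u.
Proof.
move=> AB Ou; apply/matrixP => i j; rewrite !mxE; apply: eq_partial => // w Ow.
by rewrite AB.
Qed.

Lemma smooth_mx_partial k p q (A : 'rV[R]_n -> 'M[R]_(p, q)) :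
  smooth_mx A -> smooth_mx (partial_mx k A).
Proof.
move=> sA i j; apply: (eq_smooth_on oO _ (smooth_on_derive (delta_mx 0 k) (sA i j))).
by move=> w _; rewrite mxE.
Qed.

Lemma smooth_mxM p q r (A : 'rV[R]_n -> 'M[R]_(p, q)) (B : 'rV[R]_n -> 'M[R]_(q, r)) :
  smooth_mx A -> smooth_mx B -> smooth_mx (fun u => A u *m B u).
Proof.
move=> sA sB i j; apply: (@eq_smooth_on _ _ _ oO _ (fun u => \sum_k A u i k * B u k j)).
  by move=> w _; rewrite mxE.
by apply: smooth_on_sum => // k; apply: smooth_onM.
Qed.

Lemma smooth_mx_tr p q (A : 'rV[R]_n -> 'M[R]_(p, q)) :
  smooth_mx A -> smooth_mx (fun u => (A u)^T).
Proof.
by move=> sA i j; apply: (eq_smooth_on oO _ (sA j i)) => w _; rewrite mxE.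
Qed.

Lemma partial_mxM k p q r (A : 'rV[R]_n -> 'M[R]_(p, q)) (B : 'rV[R]_n -> 'M[R]_(q, r)) u :
  smooth_mx A -> smooth_mx B -> O u ->
  partial_mx k (fun w => A w *m B w) u = partial_mx k A u *m B u + A u *m partial_mx k B u.
Proof.
move=> sA sB Ou; apply/matrixP => i j; rewrite !mxE.
rewrite (@eq_partial _ _ (fun w => \sum_l A w i l * B w l j))//; last by move=> w _; rewrite mxE.
rewrite partial_sum//; last by move=> l; apply: smooth_onM.
by rewrite -big_split/=; apply: eq_bigr => l _; rewrite partialM// !mxE.
Qed.

Lemma partial_mxD k p q (A B : 'rV[R]_n -> 'M[R]_(p, q)) u :
  smooth_mx A -> smooth_mx B -> O u ->
  partial_mx k (fun w => A w + B w) u = partial_mx k A u + partial_mx k B u.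
Proof.
move=> sA sB Ou; apply/matrixP => i j; rewrite !mxE.
rewrite (@eq_partial _ _ (fun w => A w i j + B w i j))//; last by move=> w _; rewrite mxE.
by rewrite partialD.
Qed.

Lemma partial_mx_tr k p q (A : 'rV[R]_n -> 'M[R]_(p, q)) u : O u ->
  partial_mx k (fun w => (A w)^T) u = (partial_mx k A u)^T.
Proof.
move=> Ou; apply/matrixP => i j; rewrite !mxE.
by apply: eq_partial => // w _; rewrite mxE.
Qed.

Lemma partial_mxC k l p q (A : 'rV[R]_n -> 'M[R]_(p, q)) u : smooth_mx A -> O u ->
  partial_mx k (partial_mx l A) u = partial_mx l (partial_mx k A) u.
Proof.
move=> sA Ou; apply/matrixP => i j.
have E r : {in O, (fun w => partial_mx r A w i j) =1 partial r (fun w => A w i j)}.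
  by move=> w _; rewrite mxE.
have F r s : partial_mx r (partial_mx s A) u i j = partial r (partial s (fun w => A w i j)) u.
  by rewrite mxE; exact: eq_partial (E s) Ou.
exact: etrans (F k l) (etrans (partialC k l (sA i j) Ou) (esym (F l k))).
Qed.

Lemma derive_partial v f u : smooth_on O f -> O u ->
  'D_v f u = \sum_i v 0 i * partial i f u.
Proof. by move=> /smooth_onP sf Ou; exact: c1_deriveE oO (sf 1%N) Ou. Qed.

Lemma partial_chain (m : nat) (phi : 'rV[R]_m -> 'rV[R]_n) (U : set 'rV[R]_m)
    (k : 'I_m) f (u : 'rV[R]_m) :
  open U -> smooth_on O f -> smooth_on U phi -> U u -> O (phi u) ->
  partial k (fun w => f (phi w)) u =
  \sum_i partial k (fun w => phi w 0 i) u * partial i f (phi u).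
Proof.
move=> oU /smooth_onP sf sphi Uu Ophi.
have dphi : derivable phi u (delta_mx 0 k : 'rV_m) := smooth_on_derivable sphi Uu.
have [_ E] := derivable_chain oO (sf 1%N) Ophi dphi.
apply: etrans E _; apply: eq_bigr => i _.
by rewrite (derive_mx dphi) mxE.
Qed.

End Partial.

(** * The Levi-Civita connection *)

(* Otherwise unification unfolds derivatives down to limits of filters. *)
Local Opaque partial derive.

(** The hypothesis equates the second derivatives of a metric in both orders, with first derivatives
    expressed by connection matrices [A], [B]. The mixed terms (gA)^T B and (gB)^T A are transposes
    of each other and cancel; the skew-symmetry of the lowered curvature remains. *)
Lemma skew_of_symmetric_hessian (R : realFieldType) n (g A B dA dB : 'M[R]_n) : g^T = g ->
  (g *m A + (g *m A)^T) *m B + g *m dB + ((g *m A + (g *m A)^T) *m B + g *m dB)^T =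
  (g *m B + (g *m B)^T) *m A + g *m dA + ((g *m B + (g *m B)^T) *m A + g *m dA)^T ->
  (g *m (dB - dA + (A *m B - B *m A)))^T = - (g *m (dB - dA + (A *m B - B *m A))).
Proof.
move=> gT; set S := (g *m A)^T *m B; set S' := (g *m B)^T *m A.
have SS' : S^T = S' by rewrite /S /S' trmx_mul trmxK trmx_mul gT mulmxA.
rewrite !mulmxDl -/S -/S' mulmxDr !mulmxBr !mulmxA -SS' => /matrixP E.
by apply/matrixP => i j; have := E i j; rewrite !mxE; lra.
Qed.

Section LeviCivita.
Context {R : realType} {n : nat} {M : manifold R n}.
Variables (g : metric M) (a : chart M).
Local Notation O := (chart_image a).
Implicit Types (u : 'rV[R]_n) (i j k l : 'I_n).

Lemma chart_image_open : open O.
Proof. exact: image_open. Qed.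
Let oO := chart_image_open.

Lemma metric_symE i j u : O u -> g a u i j = g a u j i.
Proof. by move=> Ou; rewrite -[in LHS](metric_sym g Ou) mxE. Qed.

Lemma smooth_mx_metric : smooth_mx O (g a).
Proof. by move=> i j; exact: metric_smooth. Qed.

Lemma smooth_metric_inv i j : smooth_on O (fun u => metric_inv g a u i j).
Proof.
apply: (smooth_on_invmx oO smooth_mx_metric) => u.
exact: metric_nondegenerate.
Qed.

Lemma smooth_on_partial k (f : 'rV[R]_n -> R) : smooth_on O f -> smooth_on O (partial k f).
Proof. exact: smooth_on_derive. Qed.

Lemma smooth_christoffel i j k : smooth_on O (christoffel g a i j k).
Proof.
have sp p q r := smooth_on_partial p (@metric_smooth _ _ _ g a q r).
apply: (@smooth_onM _ _ _ oO (fun=> 2^-1) (fun u => \sum_l metric_inv g a u i l *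
    (partial j (fun w => g a w l k) u + partial k (fun w => g a w l j) u
     - partial l (fun w => g a w j k) u))); first exact: smooth_on_cst.
apply: (smooth_on_sum oO) => l; apply: (smooth_onM oO (smooth_metric_inv i l)).
exact (smooth_onB oO (smooth_onD oO (sp j l k) (sp k l j)) (sp l j k)).
Qed.

Lemma partial_metricC i j k u : O u ->
  partial k (fun w => g a w i j) u = partial k (fun w => g a w j i) u.
Proof.
by move=> Ou; apply: (eq_partial oO) => // w; rewrite inE; exact: metric_symE.
Qed.

Lemma christoffelC i j k u : O u -> christoffel g a i j k u = christoffel g a i k j u.
Proof.
move=> Ou; congr (_ * _); apply: eq_bigr => l _; congr (_ * _).
by rewrite [partial l _ _]partial_metricC// [_ + partial k _ _]addrC.
Qed.

Lemma christoffel_lower i j k u : O u ->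
  \sum_p g a u i p * christoffel g a p j k u =
  2^-1 * (partial j (fun w => g a w i k) u + partial k (fun w => g a w i j) u
          - partial i (fun w => g a w j k) u).
Proof.
move=> Ou; pose D l := partial j (fun w => g a w l k) u + partial k (fun w => g a w l j) u
     - partial l (fun w => g a w j k) u.
have E : g a u *m (metric_inv g a u *m \col_l D l) = \col_l D l.
  by rewrite mulmxA mulmxV ?mul1mx//; exact: metric_nondegenerate.
have := congr1 (fun A : 'cV[R]_n => A i 0) E; rewrite [RHS]mxE -/(D i) => <-.
rewrite [in RHS]mxE mulr_sumr; apply: eq_bigr => p _.
rewrite mulrCA; congr (_ * _); rewrite [in RHS]mxE.
by congr (_ * _); apply: eq_bigr => l _; rewrite [in RHS]mxE.
Qed.

(* The connection matrices act on column vectors: [conn k u i j] is Gamma^i_kj. *)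
Definition conn k u : 'M[R]_n := \matrix_(i, j) christoffel g a i k j u.

Lemma smooth_conn k : smooth_mx O (conn k).
Proof.
move=> i j; apply: (eq_smooth_on oO _ (smooth_christoffel i k j)) => u _.
by rewrite mxE.
Qed.

(** This is nabla g = 0 in terms of the connection matrices. *)
Lemma metric_compatible k u : O u ->
  partial_mx k (g a) u = g a u *m conn k u + (g a u *m conn k u)^T.
Proof.
move=> Ou; apply/matrixP => i j; rewrite !mxE.
have E p q : \sum_l g a u p l * conn k u l q =
    2^-1 * (partial k (fun w => g a w p q) u + partial q (fun w => g a w p k) u
          - partial p (fun w => g a w k q) u).
  by rewrite -christoffel_lower//; apply: eq_bigr => l _; rewrite mxE.
rewrite !E (@partial_metricC j i)// (@partial_metricC k j)// (@partial_metricC k i)//.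
by field.
Qed.

(** The curvature form d omega + omega ^ omega of the connection matrices, on the coordinate fields
    l and k. *)
Definition curv l k u : 'M[R]_n :=
  partial_mx l (conn k) u - partial_mx k (conn l) u
  + (conn l u *m conn k u - conn k u *m conn l u).

Lemma riemannE j i l k u : riemann g a j i l k u = curv l k u j i.
Proof.
rewrite /riemann !mxE -!sumrB; congr (_ - _ + _).
- by congr (partial l _ u); apply/funext => w; rewrite mxE.
- by congr (partial k _ u); apply/funext => w; rewrite mxE.
by apply: eq_bigr => p _; rewrite !mxE.
Qed.

Lemma curv_skew l k u : O u -> (g a u *m curv l k u)^T = - (g a u *m curv l k u).
Proof.
move=> Ou; have sg := smooth_mx_metric.
have H p q : partial_mx p (partial_mx q (g a)) u =
   (g a u *m conn p u + (g a u *m conn p u)^T) *m conn q u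
   + g a u *m partial_mx p (conn q) u
   + ((g a u *m conn p u + (g a u *m conn p u)^T) *m conn q u
   + g a u *m partial_mx p (conn q) u)^T.
  have s1 := smooth_mxM oO sg (smooth_conn q).
  rewrite (@eq_partial_mx _ _ _ oO _ _ _ _
    (fun w => g a w *m conn q w + (g a w *m conn q w)^T))//; last first.
    by move=> w /[!inE] Ow; exact: metric_compatible.
  rewrite (partial_mxD oO _ s1 (smooth_mx_tr oO s1) Ou) (partial_mx_tr oO _ _ Ou).
  by rewrite (partial_mxM oO _ sg (smooth_conn q) Ou) metric_compatible.
apply: skew_of_symmetric_hessian; first exact: metric_sym.
exact: etrans (esym (H l k)) (etrans (partial_mxC oO l k sg Ou) (H k l)).
Qed.

End LeviCivita.

(** * Algebra of curvature tensors *)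

Section Kronecker.
Context {R : comNzRingType} {n : nat}.

Lemma sum_deltal (k : 'I_n) (f : 'I_n -> R) : \sum_i (i == k)%:R * f i = f k.
Proof.
rewrite (bigD1 k)//= eqxx mul1r big1 ?addr0// => i /negPf ->.
by rewrite mul0r.
Qed.

Lemma sum_deltar (k : 'I_n) (f : 'I_n -> R) : \sum_i (k == i)%:R * f i = f k.
Proof. by rewrite -[RHS]sum_deltal; apply: eq_bigr => i _; rewrite eq_sym. Qed.

Lemma sum_mx_inj (g : 'M[R]_n) (f f' : 'I_n -> R) : (exists h, h *m g = 1%:M) ->
  (forall m, \sum_i g m i * f i = \sum_i g m i * f' i) -> f =1 f'.
Proof.
move=> [h hg] E i.
have : g *m \col_i f i = g *m \col_i f' i.
  apply/matrixP => m z; rewrite !mxE.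
  under eq_bigr do rewrite mxE; under [in RHS]eq_bigr do rewrite mxE.
  exact: E.
move=> /(congr1 (mulmx h)); rewrite !mulmxA hg !mul1mx.
by move=> /matrixP/(_ i 0); rewrite !mxE.
Qed.

End Kronecker.

Section CurvatureTensor.
Context {R : realFieldType} {n : nat}.
Variables (g : 'M[R]_n) (Rm : 'I_n -> 'I_n -> 'I_n -> 'I_n -> R).
Implicit Types (i j k l m p : 'I_n) (v w : 'I_n -> R).

Definition lower_index i j k l : R := \sum_p g i p * Rm p j k l.

(* [Rm i j k l] stands for R^i_jkl; the first index is lowered with [g]. *)
Record curvature_tensor : Prop := CurvatureTensor {
  curv_metric_sym : forall i j, g i j = g j i;
  curv_metric_unit : g \in unitmx;
  curv_skew34 : forall i j k l, Rm i j l k = - Rm i j k l;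
  curv_skew12 : forall i j k l, lower_index j i k l = - lower_index i j k l;
  curv_bianchi : forall i j k l, Rm i j k l + Rm i k l j + Rm i l j k = 0 }.

Definition ricci_of j k : R := \sum_p Rm p j p k.
Definition schouten_of j k : R := (n%:R - 1)^-1 * ricci_of j k.
Definition weyl_of i j k l : R :=
  Rm i j k l + (i == l)%:R * schouten_of j k - (i == k)%:R * schouten_of j l.

Hypothesis ct : curvature_tensor.

Let ginj f f' : (forall m, \sum_i g m i * f i = \sum_i g m i * f' i) -> f =1 f'.
Proof.
by apply: sum_mx_inj; exists (invmx g); rewrite mulVmx// (curv_metric_unit ct).
Qed.

Lemma low_skew34 i j k l : lower_index i j l k = - lower_index i j k l.
Proof.
by rewrite -sumrN; apply: eq_bigr => p _; rewrite (curv_skew34 ct) mulrN.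
Qed.

Lemma low_bianchi i j k l : lower_index i j k l + lower_index i k l j + lower_index i l j k = 0.
Proof.
rewrite -!big_split/= big1// => p _.
by rewrite -!mulrDr (curv_bianchi ct) mulr0.
Qed.

(** Octahedron argument: the Bianchi identities at the four cyclic shifts of (i, j, k, l), combined
    by skewness in both pairs. *)
Lemma low_pair i j k l : lower_index i j k l = lower_index k l i j.
Proof.
have b1 := low_bianchi i j k l; have b2 := low_bianchi j k l i.
have b3 := low_bianchi k l i j; have b4 := low_bianchi l i j k.
have a := curv_skew12 ct; have c := low_skew34.
have := a i j k l; have := a k l i j; have := a i k j l; have := c i k l j.
have := a j l k i; have := c j l i k; have := a i l j k; have := a j k l i.
by clear -b1 b2 b3 b4; lra.
Qed.

(** As the trace h^ai R_ijak with the inverse metric h, the Ricci tensor inherits its symmetry from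
    [low_pair]. *)
Lemma ric_sym j k : ricci_of j k = ricci_of k j.
Proof.
pose h := invmx g.
have hg := mulVmx (curv_metric_unit ct).
have hs a i : h a i = h i a.
  have gT : g^T = g by apply/matrixP => p q; rewrite mxE (curv_metric_sym ct).
  by rewrite /h -[in RHS]gT -trmx_inv mxE.
have E p q : ricci_of p q = \sum_a \sum_i h a i * lower_index i p a q.
  apply: eq_bigr => a _; rewrite /lower_index.
  under eq_bigr do rewrite mulr_sumr.
  rewrite exchange_big/=.
  transitivity (\sum_m (a == m)%:R * Rm m p a q); first by rewrite sum_deltar.
  apply: eq_bigr => m _; under eq_bigr do rewrite mulrA.
  rewrite -mulr_suml; congr (_ * _).
  by have := congr1 (fun A : 'M[R]_n => A a m) hg; rewrite !mxE.
rewrite !E exchange_big/=; apply: eq_bigr => i _; apply: eq_bigr => a _.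
by rewrite hs low_pair.
Qed.

Lemma sch_sym j k : schouten_of j k = schouten_of k j.
Proof. by rewrite /schouten_of ric_sym. Qed.

Definition flat v k : R := \sum_j g k j * v j.

Lemma flat_neq0 v : (exists i, v i != 0) -> exists i, flat v i != 0.
Proof.
move=> [i vi]; apply/existsP; apply: contraT; rewrite negb_exists => /forallP H.
have : v =1 (fun=> 0).
  apply: ginj => m; rewrite [RHS]big1; last by move=> *; rewrite mulr0.
  by apply/eqP; have := H m; rewrite negbK.
by move=> E; rewrite E eqxx in vi.
Qed.

Definition null_vector v : Prop := forall i k l, \sum_j weyl_of i j k l * v j = 0.

Lemma null_vector_riemann v i k l : null_vector v ->
  \sum_j Rm i j k l * v j =
  (i == k)%:R * (\sum_j schouten_of l j * v j) - (i == l)%:R * \sum_j schouten_of k j * v j.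
Proof.
move=> nv; have := nv i k l.
have -> : \sum_j weyl_of i j k l * v j = \sum_j (Rm i j k l * v j
    + (i == l)%:R * (schouten_of j k * v j) - (i == k)%:R * (schouten_of j l * v j)).
  by apply: eq_bigr => j _; rewrite /weyl_of; ring.
have S p q : \sum_j (i == q)%:R * (schouten_of j p * v j) = (i == q)%:R * \sum_j schouten_of p j * v j.
  by rewrite mulr_sumr; apply: eq_bigr => j _; rewrite sch_sym.
by rewrite sumrB big_split/= !S; clear; lra.
Qed.

(* Contracting the nullity condition with the covector of v kills the curvature
   term and leaves P v and v proportional. *)
Lemma null_vector_eigen v : null_vector v -> (exists i, v i != 0) ->
  exists b, forall k, \sum_j schouten_of k j * v j = b * flat v k.
Proof.
move=> nv /flat_neq0[m vm]; pose Pv k := \sum_j schouten_of k j * v j.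
(* The lowered curvature is skew in its first two indices, whereas v v is symmetric. *)
have X0 k l : \sum_i flat v i * \sum_j Rm i j k l * v j = 0.
  have E : \sum_i flat v i * \sum_j Rm i j k l * v j =
           \sum_p \sum_j v p * v j * lower_index p j k l.
    transitivity (\sum_i \sum_p \sum_j v p * v j * (g p i * Rm i j k l)).
      apply: eq_bigr => i _; rewrite /flat mulr_suml; apply: eq_bigr => p _.
      rewrite mulr_sumr; apply: eq_bigr => j _; rewrite (curv_metric_sym ct i p).
      by ring.
    rewrite exchange_big/=; apply: eq_bigr => p _.
    by rewrite exchange_big/=; apply: eq_bigr => j _; rewrite -mulr_sumr.
  have E2 : \sum_p \sum_j v p * v j * lower_index p j k l = - \sum_p \sum_j v p * v j * lower_index p j k l.
    rewrite {1}exchange_big/= -sumrN; apply: eq_bigr => p _; rewrite -sumrN.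
    by apply: eq_bigr => j _; rewrite (curv_skew12 ct) mulrN [v j * _]mulrC.
  by move: E2; rewrite E; lra.
have X1 k l : flat v k * Pv l = flat v l * Pv k.
  have := X0 k l; under eq_bigr do rewrite (null_vector_riemann _ _ _ nv) mulrBr.
  rewrite sumrB.
  under eq_bigr do rewrite mulrCA; under [X in _ - X]eq_bigr do rewrite mulrCA.
  by rewrite !sum_deltal -/(Pv l) -/(Pv k); lra.
exists (Pv m / flat v m) => k; apply: (mulIf vm); rewrite mulrAC divfK//.
by rewrite -/(Pv k) mulrC X1 mulrC.
Qed.

Section Eigen.
Variables (v : 'I_n -> R) (b : R).
Hypotheses (nv : null_vector v) (ev : forall k, \sum_j schouten_of k j * v j = b * flat v k).

(** The pair symmetry turns the last slot of R_ijkl into the second slot of R_klij, where nullity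
    evaluates the contraction. *)
Lemma null_vector_riemann4 i j k :
  \sum_l Rm i j k l * v l = b * ((i == k)%:R * flat v j - g k j * v i).
Proof.
move: i; apply: ginj => m.
transitivity (\sum_l lower_index m j k l * v l).
  under eq_bigr do rewrite mulr_sumr; rewrite exchange_big/=.
  apply: eq_bigr => l _; rewrite /lower_index mulr_suml.
  by apply: eq_bigr => i _; rewrite mulrA.
under eq_bigr do rewrite low_pair.
transitivity (\sum_p g k p * \sum_l Rm p l m j * v l).
  under [RHS]eq_bigr do rewrite mulr_sumr; rewrite exchange_big/=.
  apply: eq_bigr => l _; rewrite /lower_index mulr_suml.
  by apply: eq_bigr => i _; rewrite mulrA.
under eq_bigr do rewrite (null_vector_riemann _ _ _ nv) !ev mulrBr.
rewrite sumrB.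
under eq_bigr do rewrite mulrCA; under [X in _ - X]eq_bigr do rewrite mulrCA.
rewrite !sum_deltal.
under [RHS]eq_bigr do rewrite mulrCA mulrBr.
rewrite -mulr_sumr sumrB.
under [X in _ = _ * (X - _)]eq_bigr do rewrite mulrCA.
rewrite sum_deltal.
under [X in _ = _ * (_ - X)]eq_bigr do rewrite mulrCA.
rewrite -mulr_sumr -/(flat v m) (curv_metric_sym ct m k).
by ring.
Qed.

(** The two terms in delta^i_k cancel: b v_j from the curvature against P_jl v^l from the Weyl
    correction. *)
Lemma null_vector_weyl4 i j k :
  \sum_l weyl_of i j k l * v l = v i * (schouten_of j k - b * g j k).
Proof.
have -> : \sum_l weyl_of i j k l * v l = \sum_l (Rm i j k l * v l
    + (i == l)%:R * (schouten_of j k * v l) - (i == k)%:R * (schouten_of j l * v l)).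
  by apply: eq_bigr => l _; rewrite /weyl_of; ring.
have S : \sum_l (i == k)%:R * (schouten_of j l * v l) = (i == k)%:R * (b * flat v j).
  by rewrite -ev mulr_sumr.
rewrite sumrB big_split/= null_vector_riemann4 sum_deltar S.
by rewrite (curv_metric_sym ct j k); ring.
Qed.

(* Contract W^i_jkl v^l = v^i (P - b g)_jk with w^j. *)
Lemma null_vector_eigen_unique w b' : null_vector w -> (exists i, w i != 0) ->
  (exists i, v i != 0) -> (forall k, \sum_j schouten_of k j * w j = b' * flat w k) -> b' = b.
Proof.
move=> nw w0 [i vi] ew; have [m wm] := flat_neq0 w0.
have : \sum_j (\sum_l weyl_of i j m l * v l) * w j = 0.
  under eq_bigr do rewrite mulr_suml; rewrite exchange_big/= big1// => l _.
  under eq_bigr do rewrite mulrAC; rewrite -mulr_suml nw.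
  by rewrite mul0r.
under eq_bigr do rewrite null_vector_weyl4 -mulrA mulrBl.
rewrite -mulr_sumr sumrB.
under eq_bigr do rewrite sch_sym.
under [X in _ * (_ - X)]eq_bigr do rewrite (curv_metric_sym ct) -mulrA.
rewrite ew -mulr_sumr -/(flat w m) -mulrBl => /eqP.
by rewrite !mulf_eq0 (negPf vi) (negPf wm) /= orbF subr_eq0 => /eqP.
Qed.

End Eigen.

End CurvatureTensor.

(** * Two projectively related metrics at a point *)

Section ProjectivePair.
Context {R : realFieldType} {n : nat}.
Variables (g h : 'M[R]_n) (Rg Rh : 'I_n -> 'I_n -> 'I_n -> 'I_n -> R).
Hypotheses (cg : curvature_tensor g Rg) (ch : curvature_tensor h Rh).
Hypothesis eq_weyl : forall i j k l, weyl_of Rg i j k l = weyl_of Rh i j k l.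
Variables (v : 'I_n -> R) (b c : R).
Hypotheses (nv : null_vector Rg v) (v0 : exists i, v i != 0).
Hypotheses (eg : forall k, \sum_j schouten_of Rg k j * v j = b * flat g v k)
  (eh : forall k, \sum_j schouten_of Rh k j * v j = c * flat h v k).

Lemma null_vector_eq : null_vector Rh v.
Proof. by move=> i k l; rewrite -[RHS](nv i k l); apply: eq_bigr => j _; rewrite eq_weyl. Qed.

(* P - b g is read off from W^i_jkl v^l = v^i (P - b g)_jk, where W is invariant. *)
Lemma schouten_shift_invariant j k :
  schouten_of Rg j k - b * g j k = schouten_of Rh j k - c * h j k.
Proof.
have [i vi] := v0; apply: (mulfI vi).
rewrite -(null_vector_weyl4 cg nv eg) -(null_vector_weyl4 ch null_vector_eq eh).
by apply: eq_bigr => l _; rewrite eq_weyl.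
Qed.

(** The hypothesis is the integrability condition for [ups], with [be] the differential of the
    second eigenvalue. The vector v goes into the slot [k] because [null_vector_riemann4] evaluates
    the curvature there. *)
Lemma null_contraction (ups be : 'I_n -> R) : (2 <= n)%N ->
  (forall j k l, \sum_p Rg p l j k * ups p + b * (ups k * g j l - ups j * g k l)
    - be j * h k l + be k * h j l = 0) -> forall j, be j = 0.
Proof.
move=> n2 E.
pose bv := \sum_k be k * v k; pose uv := \sum_p ups p * v p.
have E1 j l : bv * h j l = be j * flat h v l.
  have : \sum_k (\sum_p Rg p l j k * ups p + b * (ups k * g j l - ups j * g k l)
    - be j * h k l + be k * h j l) * v k = 0 by rewrite big1// => k _; rewrite E mul0r.
  (* The value is exactly -b times the sum in [S2], so the two terms cancel. *)
  have S1 : \sum_k (\sum_p Rg p l j k * ups p) * v k =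
            b * (ups j * flat g v l - uv * g j l).
    under eq_bigr do rewrite mulr_suml; rewrite exchange_big/=.
    transitivity (\sum_p ups p * \sum_k Rg p l j k * v k).
      apply: eq_bigr => p _; rewrite mulr_sumr; apply: eq_bigr => k _.
      by rewrite mulrAC mulrC.
    under eq_bigr do rewrite (null_vector_riemann4 cg nv eg) mulrCA mulrBr.
    rewrite -mulr_sumr sumrB; congr (_ * (_ - _)).
      by under eq_bigr do rewrite mulrCA; rewrite sum_deltal.
    rewrite /uv mulr_suml; apply: eq_bigr => p _.
    by ring.
  have S2 : \sum_k (ups k * g j l - ups j * g k l) * v k = uv * g j l - ups j * flat g v l.
    under eq_bigr do rewrite mulrBl; rewrite sumrB; congr (_ - _).
      by rewrite /uv mulr_suml; apply: eq_bigr => k _; rewrite mulrAC.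
    rewrite /flat mulr_sumr; apply: eq_bigr => k _.
    by rewrite (curv_metric_sym cg k l) mulrA.
  have S3 : \sum_k be j * h k l * v k = be j * flat h v l.
    rewrite /flat mulr_sumr; apply: eq_bigr => k _.
    by rewrite (curv_metric_sym ch k l) mulrA.
  have S4 : \sum_k be k * h j l * v k = bv * h j l.
    by rewrite /bv mulr_suml; apply: eq_bigr => k _; rewrite mulrAC.
  under eq_bigr do rewrite mulrDl mulrBl mulrDl -[b * _ * _]mulrA.
  by rewrite big_split sumrB big_split/= -mulr_sumr S1 S2 S3 S4; lra.
pose hi := invmx h; have hhi := mulmxV (curv_metric_unit ch).
(* Trace of [E1] with the inverse of h: the left side gives n bv, and on the right the inverse
   undoes the lowering in [flat h v], leaving be(v) = bv. *)
have nb : n%:R * bv = bv.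
  have T1 : \sum_j \sum_l bv * h j l * hi l j = n%:R * bv.
    transitivity (\sum_(j < n) bv).
      apply: eq_bigr => j _; under eq_bigr do rewrite -mulrA.
      rewrite -mulr_sumr; have := congr1 (fun A : 'M[R]_n => A j j) hhi.
      by rewrite !mxE eqxx => ->; rewrite mulr1.
    by rewrite sumr_const card_ord mulr_natl.
  rewrite -[LHS]T1; under eq_bigr do under eq_bigr do rewrite E1.
  apply: eq_bigr => j _; rewrite -[X in _ = _ * X](sum_deltar j v).
  under eq_bigr do rewrite -mulrA; rewrite -mulr_sumr; congr (_ * _).
  transitivity (\sum_i \sum_l hi j l * h l i * v i).
    rewrite exchange_big/=; apply: eq_bigr => l _; rewrite /flat mulr_suml.
    have hs : hi l j = hi j l.
      have hT : h^T = h by apply/matrixP => p q; rewrite mxE (curv_metric_sym ch).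
      by rewrite /hi -[in RHS]hT -trmx_inv mxE.
    by apply: eq_bigr => i _; rewrite hs mulrC mulrA.
  apply: eq_bigr => i _; rewrite -mulr_suml; congr (_ * _).
  have := congr1 (fun A : 'M[R]_n => A j i) (mulVmx (curv_metric_unit ch)).
  by rewrite !mxE.
have bv0 : bv = 0.
  have : (n%:R - 1) * bv = 0 by rewrite mulrBl nb mul1r subrr.
  move=> /eqP; rewrite mulf_eq0 => /orP[|/eqP//].
  by rewrite subr_eq0 -[1]/(1%:R) eqr_nat => /eqP n1; rewrite n1 in n2.
(* With bv = 0, [E1] reads 0 = be_j times the lowered v, which is nonzero because h is
   nondegenerate. *)
move=> j; have [m hm] := flat_neq0 ch v0.
apply/eqP; have := E1 j m; rewrite bv0 mul0r => /esym/eqP.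
by rewrite mulf_eq0 (negPf hm) orbF.
Qed.

End ProjectivePair.

Section TensorOfPointwiseProjective.
Context {R : realFieldType} {n : nat}.

(* Polarization at the vectors e_p + x e_q with x = 1 and x = -1. *)
Lemma projective_tensor (T : 'I_n -> 'I_n -> 'I_n -> R) :
  (forall i j k, T i j k = T i k j) ->
  (forall c : 'I_n -> R, exists lam, forall k,
     \sum_i \sum_j T k i j * (c i * c j) = lam * c k) ->
  forall k i j, T k i j = (k == i)%:R * (2^-1 * T j j j) + (k == j)%:R * (2^-1 * T i i i).
Proof.
move=> Ts H.
have S (x : R) (p q k : 'I_n) : p != q ->
    \sum_i \sum_j T k i j * (((i == p)%:R + x * (i == q)%:R) * ((j == p)%:R + x * (j == q)%:R))
    = T k p p + 2 * x * T k p q + x * x * T k q q.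
  move=> pq.
  transitivity (\sum_i ((i == p)%:R + x * (i == q)%:R) * (T k i p + x * T k i q)).
    apply: eq_bigr => i _.
    transitivity (\sum_j ((j == p)%:R * (((i == p)%:R + x * (i == q)%:R) * T k i j)
        + (j == q)%:R * (x * ((i == p)%:R + x * (i == q)%:R) * T k i j))).
      by apply: eq_bigr => j _; ring.
    by rewrite big_split/= !sum_deltal; ring.
  transitivity (\sum_i ((i == p)%:R * (T k i p + x * T k i q) +
      (i == q)%:R * (x * (T k i p + x * T k i q)))).
    by apply: eq_bigr => i _; ring.
  by rewrite big_split/= !sum_deltal (Ts k q p); ring.
(* With x = 0 the vector is e_p; [k] is only a placeholder distinct from p, as [S] requires. *)
have D p k : k != p -> T k p p = 0.
  move=> kp; have [lam E] := H (fun i => (i == p)%:R + 0 * (i == k)%:R).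
  have pk : p != k by rewrite eq_sym.
  by have := E k; rewrite (S _ _ _ _ pk) (negPf kp) eqxx/=; lra.
have E2 p q (x : R) : p != q -> exists lam,
    (forall k, k != p -> k != q -> 2 * x * T k p q = 0) /\
    (T p p p + 2 * x * T p p q = lam /\ 2 * x * T q p q + x * x * T q q q = lam * x).
  move=> pq; have [lam E] := H (fun i => (i == p)%:R + x * (i == q)%:R).
  exists lam; split=> [m mp mq|].
    by have := E m; rewrite (S _ _ _ _ pq) (negPf mp) (negPf mq) !D//=; lra.
  split.
    by have := E p; rewrite (S _ _ _ _ pq) eqxx (negPf pq) (@D q p)//=; lra.
  have qp : q != p by rewrite eq_sym.
  by have := E q; rewrite (S _ _ _ _ pq) eqxx (negPf qp) (@D p q)//=; lra.
have off p q k : p != q -> k != p -> k != q -> T k p q = 0.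
  move=> pq kp kq; have [lam [/(_ k kp kq) + _]] := E2 p q 1 pq; clear; lra.
(* Eliminating lam at x = 1 and mu at x = -1 separates [T p p q] from [T q p q]. *)
have on p q : p != q -> T p p q = 2^-1 * T q q q.
  move=> pq; have [lam [_ [A1 A2]]] := E2 p q 1 pq.
  have [mu [_ [B1 B2]]] := E2 p q (-1) pq.
  by move: A1 A2 B1 B2; lra.
move=> k i j; have [->|ij] := eqVneq i j.
  have [->|kj] := eqVneq k j; first by rewrite mul1r; lra.
  by rewrite D// !mul0r addr0.
have [->|ki] := eqVneq k i; first by rewrite (negPf ij) mul1r mul0r addr0 on.
have [->|kj] := eqVneq k j; first by rewrite mul0r add0r mul1r Ts on// eq_sym.
by rewrite off// !mul0r addr0.
Qed.

End TensorOfPointwiseProjective.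

(** * Formal identities for a projective change of connection *)

Section ConnectionAlgebra.
Context {R : realFieldType} {n : nat}.
Implicit Types (i j k l p q : 'I_n).

Lemma projective_connection_product (G : 'I_n -> 'I_n -> 'I_n -> R) (y : 'I_n -> R) j l k i :
  \sum_p (G j l p + (j == l)%:R * y p + (j == p)%:R * y l) *
         (G p k i + (p == k)%:R * y i + (p == i)%:R * y k) =
  \sum_p G j l p * G p k i + G j l k * y i + G j l i * y k
  + (j == l)%:R * \sum_p G p k i * y p + 2 * (j == l)%:R * (y k * y i) + y l * G j k i
  + (j == k)%:R * (y l * y i) + (j == i)%:R * (y l * y k).
Proof.
transitivity (\sum_p (G j l p * G p k i
  + (p == k)%:R * ((G j l p + (j == l)%:R * y p) * y i)
  + (p == i)%:R * ((G j l p + (j == l)%:R * y p) * y k)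
  + (j == l)%:R * (G p k i * y p)
  + (j == p)%:R * (y l * G p k i + (p == k)%:R * (y l * y i) + (p == i)%:R * (y l * y k)))).
  by apply: eq_bigr => p _; ring.
by rewrite !big_split/= !sum_deltal sum_deltar -mulr_sumr; ring.
Qed.

(** Here [dG], [dH], [dy] are free symbols for derivatives, so the change of curvature becomes a
    polynomial identity. [D] stands for nabla Y - Y Y, and its skew part in the last term is dY. *)
Lemma projective_riemann (G H : 'I_n -> 'I_n -> 'I_n -> R)
    (dG dH : 'I_n -> 'I_n -> 'I_n -> 'I_n -> R) (y : 'I_n -> R)
    (dy D : 'I_n -> 'I_n -> R) :
  (forall p k l, G p k l = G p l k) ->
  (forall k i j, H k i j = G k i j + (k == i)%:R * y j + (k == j)%:R * y i) ->
  (forall l j k i, dH l j k i = dG l j k i + (j == k)%:R * dy l i + (j == i)%:R * dy l k) ->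
  (forall k i, D k i = dy k i - \sum_p G p k i * y p - y k * y i) ->
  forall j i l k,
  dH l j k i - dH k j l i + \sum_p (H j l p * H p k i - H j k p * H p l i) =
  dG l j k i - dG k j l i + \sum_p (G j l p * G p k i - G j k p * G p l i)
  + (j == k)%:R * D l i - (j == l)%:R * D k i + (j == i)%:R * (D l k - D k l).
Proof.
move=> Gs HE dHE DE j i l k; rewrite !sumrB !dHE.
have S p q : \sum_r H j p r * H r q i =
   \sum_r (G j p r + (j == p)%:R * y r + (j == r)%:R * y p) *
          (G r q i + (r == q)%:R * y i + (r == i)%:R * y q).
  by apply: eq_bigr => r _; rewrite !HE.
rewrite !S !projective_connection_product (Gs j k l) !DE.
have -> : \sum_p G p k l * y p = \sum_p G p l k * y p.
  by apply: eq_bigr => p _; rewrite Gs.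
by ring.
Qed.

(* [G], [dG], [y], [dy] stand for the Christoffel symbols of g, the projective form
   and their first derivatives; the hypothesis on [X] is the symmetry of the second
   derivatives of y, and the result is the Ricci identity for y. *)
Lemma ricci_identity_contracted (G : 'I_n -> 'I_n -> 'I_n -> R)
    (dG : 'I_n -> 'I_n -> 'I_n -> 'I_n -> R) (y be : 'I_n -> R)
    (dy g h : 'I_n -> 'I_n -> R) (dg dh : 'I_n -> 'I_n -> 'I_n -> R) (B b : R) :
  (forall p k l, G p k l = G p l k) ->
  (forall k l, g k l = g l k) -> (forall k l, h k l = h l k) ->
  (forall k l, dy k l = \sum_p G p k l * y p + y k * y l + B * g k l - b * h k l) ->
  (forall j k l, dg j k l = \sum_p g k p * G p j l + \sum_p g l p * G p j k) ->
  (forall j k l, dh j k l =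
     \sum_p h k p * (G p j l + (p == j)%:R * y l + (p == l)%:R * y j)
     + \sum_p h l p * (G p j k + (p == j)%:R * y k + (p == k)%:R * y j)) ->
  forall j k l,
  let X j k := \sum_p (dG j p k l * y p + G p k l * dy j p) + (dy j k * y l + y k * dy j l)
     + B * dg j k l - (be j * h k l + b * dh j k l) in
  X j k = X k j ->
  \sum_p (dG j p k l - dG k p j l + \sum_q (G p j q * G q k l - G p k q * G q j l)) * y p
    + B * (y k * g j l - y j * g k l) - be j * h k l + be k * h j l = 0.
Proof.
move=> Gs gs hs dyE dgE dhE j k l /=.
pose gg (i j k : 'I_n) := \sum_p g i p * G p j k.
pose hh (i j k : 'I_n) := \sum_p h i p * G p j k.
pose A (k l : 'I_n) := \sum_p G p k l * y p.
have ggs i p q : gg i p q = gg i q p by apply: eq_bigr => r _; rewrite Gs.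
have hhs i p q : hh i p q = hh i q p by apply: eq_bigr => r _; rewrite Gs.
have As p q : A p q = A q p by apply: eq_bigr => r _; rewrite Gs.
have dg' i p q : dg i p q = gg p i q + gg q i p by rewrite dgE.
have hS i p q : \sum_r h i r * (G r p q + (r == p)%:R * y q + (r == q)%:R * y p) =
   hh i p q + h i p * y q + h i q * y p.
  transitivity (\sum_r (h i r * G r p q + (r == p)%:R * (h i r * y q) + (r == q)%:R * (h i r * y p))).
    by apply: eq_bigr => r _; ring.
  by rewrite !big_split/= !sum_deltal.
have dh' i p q : dh i p q = hh p i q + h p i * y q + h p q * y i
   + (hh q i p + h q i * y p + h q p * y i) by rewrite dhE !hS.
have dy' p q : dy p q = A p q + y p * y q + B * g p q - b * h p q by rewrite dyE.
(* Inserting the equation for [dy] creates the products of Christoffel symbols that complete the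
   [dG] terms to the curvature. *)
have SG i p : \sum_r G r p l * dy i r =
   \sum_r (\sum_q G r i q * G q p l) * y r + A p l * y i + B * gg i p l - b * hh i p l.
  transitivity (\sum_r (G r p l * (\sum_q G q i r * y q) + (G r p l * y r) * y i
      + B * (g i r * G r p l) - b * (h i r * G r p l))).
    by apply: eq_bigr => r _; rewrite dyE; ring.
  rewrite sumrB !big_split/= -!mulr_sumr -mulr_suml; congr (_ + _ + _ - _).
  under eq_bigr do rewrite mulr_sumr; rewrite exchange_big/=.
  apply: eq_bigr => q _; rewrite mulr_suml; apply: eq_bigr => r _; ring.
have -> : \sum_p (dG j p k l - dG k p j l + \sum_q (G p j q * G q k l - G p k q * G q j l)) * y p =
  \sum_p dG j p k l * y p - \sum_p dG k p j l * y p
  + \sum_r (\sum_q G r j q * G q k l) * y r - \sum_r (\sum_q G r k q * G q j l) * y r.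
  rewrite -sumrB -big_split/= -sumrB; apply: eq_bigr => p _; rewrite sumrB; ring.
rewrite !big_split/= !SG !dg' !dh' !dy'.
rewrite (ggs l k j) (hhs l k j) (As k j) (hs k j) (gs k j) (hs l k) (hs l j).
set u1 := \sum_p dG j p k l * y p; set u2 := \sum_p dG k p j l * y p.
set u3 := \sum_r _ * y r; set u4 := \sum_r _ * y r.
by move: u1 u2 u3 u4 (ggs k j l) (hhs k j l) => *; lra.
Qed.

End ConnectionAlgebra.

(** * Linear algebra of coordinate changes *)

Section LeviCivitaUniqueness.
Context {R : realFieldType} {n : nat}.

(** The difference with lowered index is symmetric in its first two indices and skew in the last
    two; such an array vanishes. *)
Lemma levi_civita_unique (g : 'M[R]_n) (N N' : 'I_n -> 'M[R]_n) : g \in unitmx ->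
  (forall l, N l *m g + (N l *m g)^T = N' l *m g + (N' l *m g)^T) ->
  (forall l j i, N l j i = N j l i) -> (forall l j i, N' l j i = N' j l i) ->
  forall l, N l = N' l.
Proof.
move=> ug E s s' l.
pose C l j i := (N l *m g) j i - (N' l *m g) j i.
have Ck p q r : C p q r = - C p r q.
  have := congr1 (fun A : 'M[R]_n => A q r) (E p); rewrite !mxE /C => E1.
  by move: E1; rewrite !mxE; lra.
have Cs p q r : C p q r = C q p r.
  by rewrite /C !mxE; congr (_ - _); apply: eq_bigr => m _; rewrite 1?s 1?s'.
have C0 p q r : C p q r = 0.
  have := Ck p q r; have := Cs p r q; have := Ck r p q; have := Cs r q p.
  have := Ck q r p; have := Cs q p r; by clear; lra.
have : N l *m g = N' l *m g.
  by apply/matrixP => j i; apply/eqP; rewrite -subr_eq0; apply/eqP; exact: C0.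
by move/(congr1 (mulmx^~ (invmx g))); rewrite -!mulmxA mulmxV// !mulmx1.
Qed.

(** The Leibniz rule for J G J^T, with [X] for the derivative of J and [P + P^T] for that of G,
    regrouped as Q + Q^T to fit [levi_civita_unique]. *)
Lemma congruence_leibniz (J G X P : 'M[R]_n) : G^T = G ->
  (X *m G + J *m (P + P^T)) *m J^T + J *m G *m X^T =
  X *m G *m J^T + J *m P *m J^T + (X *m G *m J^T + J *m P *m J^T)^T.
Proof.
move=> Gs.
have -> : (X *m G *m J^T + J *m P *m J^T)^T = J *m G *m X^T + J *m P^T *m J^T.
  by rewrite linearD/= !trmx_mul !trmxK Gs !mulmxA.
by rewrite mulmxDr !mulmxDl -!addrA; congr (_ + (_ + _)); exact: addrC.
Qed.

(** The curvature matrices are conjugated by J; in the trace J^-1 meets the J of the contracted form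
    index, leaving one J for each free index. *)
Lemma ricci_transform (J Ji : 'M[R]_n) (Fa Fb : 'I_n -> 'I_n -> 'M[R]_n) :
  Ji *m J = 1%:M -> J *m Ji = 1%:M ->
  (forall l k, Fa l k *m J =
     J *m \sum_d \sum_e (J l d * J k e) *: Fb d e) ->
  \matrix_(j, k) (\sum_p Fa p k j p) =
  J *m (\matrix_(j, k) (\sum_p Fb p k j p)) *m J^T.
Proof.
move=> JiJ JJi E; apply/matrixP => j k; rewrite mxE.
have E1 p : Fa p k j p = \sum_a \sum_d \sum_e J j a * (J p d * J k e) * \sum_q Fb d e a q * Ji q p.
  have -> : Fa p k = J *m (\sum_d \sum_e (J p d * J k e) *: Fb d e) *m Ji.
    by rewrite -E -mulmxA JJi mulmx1.
  rewrite -mulmxA mxE; apply: eq_bigr => a _.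
  rewrite mulmx_suml summxE mulr_sumr; apply: eq_bigr => d _.
  rewrite mulmx_suml summxE mulr_sumr; apply: eq_bigr => e _.
  by rewrite -scalemxAl !mxE mulrA.
transitivity (\sum_a \sum_e J j a * J k e * \sum_p Fb p e a p); last first.
  rewrite -mulmxA mxE; apply: eq_bigr => a _; rewrite mxE mulr_sumr.
  by apply: eq_bigr => e _; rewrite !mxE; ring.
under eq_bigr do rewrite E1; rewrite exchange_big/=; apply: eq_bigr => a _.
transitivity (\sum_d \sum_e \sum_p J j a * (J p d * J k e) * \sum_q Fb d e a q * Ji q p).
  by rewrite [LHS]exchange_big; apply: eq_bigr => d _; rewrite [LHS]exchange_big.
rewrite exchange_big/=; apply: eq_bigr => e _.
rewrite [RHS]mulr_sumr; apply: eq_bigr => d _.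
transitivity (\sum_q J j a * J k e * Fb d e a q * \sum_p Ji q p * J p d).
  under [RHS]eq_bigr do rewrite mulr_sumr.
  rewrite exchange_big/=; apply: eq_bigr => p _.
  by rewrite mulr_sumr; apply: eq_bigr => q _; ring.
have JiJE q : \sum_p Ji q p * J p d = (q == d)%:R.
  by have := congr1 (fun A : 'M[R]_n => A q d) JiJ; rewrite !mxE.
by under eq_bigr do rewrite JiJE mulrC; rewrite sum_deltal.
Qed.

(** Curvature commutes with pull-back: [x], [y] are two rows of the Jacobian, and the terms in their
    derivatives [X], [X'] cancel because these agree. *)
Lemma pulled_curvature (x y X X' : 'I_n -> R) (N : 'I_n -> 'M[R]_n)
    (dN : 'I_n -> 'I_n -> 'M[R]_n) : X =1 X' ->
  \sum_d X d *: N d + \sum_e \sum_d (x d * y e) *: dN d e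
  - (\sum_d X' d *: N d + \sum_e \sum_d (y d * x e) *: dN d e)
  + ((\sum_d y d *: N d) *m (\sum_d x d *: N d)
     - (\sum_d x d *: N d) *m (\sum_d y d *: N d)) =
  \sum_d \sum_e (x d * y e) *: (dN d e - dN e d + (N e *m N d - N d *m N e)).
Proof.
move=> XX'.
have -> : \sum_d X d *: N d = \sum_d X' d *: N d by apply: eq_bigr => d _; rewrite XX'.
have PP (p q : 'I_n -> R) : (\sum_d p d *: N d) *m (\sum_d q d *: N d) =
    \sum_d \sum_e (p d * q e) *: (N d *m N e).
  rewrite mulmx_suml; apply: eq_bigr => d _.
  rewrite mulmx_sumr; apply: eq_bigr => e _.
  by rewrite -scalemxAl -scalemxAr scalerA.
rewrite !PP [X in X - _ + _]addrC addrKA [X in X - _ + _]exchange_big/= [X in _ + (X - _)]exchange_big/=.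
rewrite -!sumrB -big_split/=; apply: eq_bigr => d _.
rewrite -!sumrB -big_split/=; apply: eq_bigr => e _.
by rewrite [y e * x d]mulrC -!scalerBr -scalerDr.
Qed.

(* [A], [B] are the connection matrices of the first chart in two directions, [L],
   [K] those pulled back from the second one, and [H] is the second derivative of
   the Jacobian [J]. *)
Lemma gauge_curvature (J A B L K dJl dJk dAB dBA dL dK H : 'M[R]_n) :
  A *m J = dJl + J *m L -> B *m J = dJk + J *m K ->
  dAB *m J + B *m dJl = H + (dJl *m K + J *m dK) ->
  dBA *m J + A *m dJk = H + (dJk *m L + J *m dL) ->
  (dAB - dBA + (B *m A - A *m B)) *m J = J *m (dK - dL + (K *m L - L *m K)).
Proof.
move=> EA EB E1 E2.
have e1 : dAB *m J = H + (dJl *m K + J *m dK) - B *m dJl by rewrite -E1 addrK.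
have e2 : dBA *m J = H + (dJk *m L + J *m dL) - A *m dJk by rewrite -E2 addrK.
have f1 : B *m A *m J = B *m dJl + (dJk *m L + J *m K *m L).
  by rewrite -mulmxA EA mulmxDr [B *m (J *m L)]mulmxA EB mulmxDl.
have f2 : A *m B *m J = A *m dJk + (dJl *m K + J *m L *m K).
  by rewrite -mulmxA EB mulmxDr [A *m (J *m K)]mulmxA EA mulmxDl.
rewrite mulmxDl !mulmxBl e1 e2 f1 f2 mulmxDr !mulmxBr !mulmxA.
apply/matrixP => i j; rewrite !mxE; lra.
Qed.

End LeviCivitaUniqueness.

Section GeodesicAlgebra.
Context {R : realFieldType} {n : nat}.
(** The chain rule for the second derivative of a curve, with the derivative of the Jacobian [J]
    already replaced by means of the transformation law. The new geodesic expression is then the old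
    one times J. *)
Lemma geodesic_algebra (Ga Gb : 'I_n -> 'I_n -> 'I_n -> R) (X1 X2 : 'rV[R]_n) (J : 'M[R]_n) k :
  (forall m, X2 0 m + \sum_i \sum_j Ga m i j * (X1 0 i * X1 0 j) = 0) ->
  \sum_j (X2 0 j * J j k + X1 0 j * \sum_i X1 0 i *
     (\sum_m Ga m i j * J m k - \sum_p \sum_q J j p * (J i q * Gb k q p)))
  + \sum_i \sum_j Gb k i j * ((\sum_l X1 0 l * J l i) * (\sum_l X1 0 l * J l j)) = 0.
Proof.
move=> XE.
have E1 : \sum_m (X2 0 m + \sum_i \sum_j Ga m i j * (X1 0 i * X1 0 j)) * J m k = 0.
  by rewrite big1// => m _; rewrite XE mul0r.
rewrite -[RHS]E1.
have A1 : \sum_j X1 0 j * (\sum_i X1 0 i * (\sum_m Ga m i j * J m k)) =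
    \sum_m (\sum_i \sum_j Ga m i j * (X1 0 i * X1 0 j)) * J m k.
  transitivity (\sum_j \sum_i \sum_m Ga m i j * (X1 0 i * X1 0 j) * J m k).
    apply: eq_bigr => j _; rewrite mulr_sumr; apply: eq_bigr => i _.
    by rewrite !mulr_sumr; apply: eq_bigr => m _; ring.
  under [RHS]eq_bigr do rewrite mulr_suml.
  under [RHS]eq_bigr do under eq_bigr do rewrite mulr_suml.
  rewrite [RHS]exchange_big/= [LHS]exchange_big/=; apply: eq_bigr => i _.
  by rewrite [RHS]exchange_big.
have A2 : \sum_j X1 0 j * (\sum_i X1 0 i * \sum_p \sum_q J j p * (J i q * Gb k q p)) =
    \sum_i \sum_j Gb k i j * ((\sum_l X1 0 l * J l i) * (\sum_l X1 0 l * J l j)).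
  transitivity (\sum_q \sum_p \sum_i \sum_j (X1 0 j * J j p) * (X1 0 i * J i q) * Gb k q p).
    transitivity (\sum_j \sum_i \sum_p \sum_q (X1 0 j * J j p) * (X1 0 i * J i q) * Gb k q p).
      apply: eq_bigr => j _; rewrite mulr_sumr; apply: eq_bigr => i _.
      rewrite !mulr_sumr; apply: eq_bigr => p _.
      by rewrite !mulr_sumr; apply: eq_bigr => q _; ring.
    under eq_bigr do under eq_bigr do rewrite exchange_big/=.
    under eq_bigr do rewrite exchange_big/=.
    rewrite exchange_big/=; apply: eq_bigr => q _.
    under eq_bigr do rewrite exchange_big/=.
    rewrite exchange_big/=; apply: eq_bigr => p _.
    by rewrite exchange_big.
  apply: eq_bigr => q _; apply: eq_bigr => p _.
  rewrite mulrCA mulr_suml; apply: eq_bigr => i _.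
  rewrite mulr_sumr mulr_sumr; apply: eq_bigr => j _; ring.
transitivity (\sum_j X2 0 j * J j k
   + (\sum_j X1 0 j * (\sum_i X1 0 i * (\sum_m Ga m i j * J m k))
     - \sum_j X1 0 j * (\sum_i X1 0 i * \sum_p \sum_q J j p * (J i q * Gb k q p)))
   + \sum_i \sum_j Gb k i j * ((\sum_l X1 0 l * J l i) * (\sum_l X1 0 l * J l j))).
  congr (_ + _); rewrite -sumrB -big_split/=; apply: eq_bigr => j _; congr (_ + _).
  by rewrite -mulrBr -sumrB; congr (_ * _); apply: eq_bigr => i _; rewrite mulrBr.
rewrite A1 A2 -addrA subrK -big_split/=; apply: eq_bigr => m _; by rewrite mulrDl.
Qed.
End GeodesicAlgebra.

(** * Projective change of metric *)

Local Opaque christoffel.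

Section CurvatureOfMetric.
Context {R : realType} {n : nat} {M : manifold R n}.
Variables (g : metric M) (a : chart M).
Local Notation O := (chart_image a).
Let oO : open O := @chart_image_open _ _ _ a.

Lemma riemann_curvature_tensor u : O u ->
  curvature_tensor (g a u) (fun i j k l => riemann g a i j k l u).
Proof.
move=> Ou; split.
- by move=> i j; exact: metric_symE.
- exact: metric_nondegenerate.
- move=> i j k l; rewrite /riemann opprD opprB -sumrN; congr (_ + _).
  by apply: eq_bigr => p _; rewrite opprB.
- move=> i j k l; have S := curv_skew g k l Ou.
  have E p q : lower_index (g a u) (fun i j k l => riemann g a i j k l u) p q k l =
               (g a u *m curv g a k l u) p q.
    by rewrite mxE; apply: eq_bigr => r _; rewrite riemannE.
  by have := congr1 (fun A : 'M[R]_n => A i j) S; rewrite mxE [RHS]mxE -!E.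
- move=> i j k l.
  (* The cyclic sum cancels by the symmetry of the lower Christoffel indices alone; [dG] and [SG]
     abstract the terms so that [ring] can see this. *)
  have [dG [SG [E P S]]] : exists dG SG : 'I_n -> 'I_n -> 'I_n -> R,
      [/\ forall p q r, riemann g a i p q r u = dG q r p - dG r q p + (SG q r p - SG r q p),
        forall p q r, dG p q r = dG p r q & forall p q r, SG p q r = SG p r q].
    exists (fun p q r => partial p (christoffel g a i q r) u).
    exists (fun p q r => \sum_m christoffel g a i p m u * christoffel g a m q r u).
    split=> p q r; first by rewrite /riemann sumrB.
      by apply: (eq_partial oO) => // w; rewrite inE; exact: christoffelC.
    by apply: eq_bigr => m _; rewrite [christoffel g a m q r u]christoffelC.
  by rewrite !E (P k l j) (P l k j) (P j l k) (S k l j) (S l k j) (S j l k); ring.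
Qed.

End CurvatureOfMetric.

Section ProjectiveChange.
Context {R : realType} {n : nat} {M : manifold R n}.
Variables (g h : metric M) (a : chart M).
Local Notation O := (chart_image a).
Let oO : open O := @chart_image_open _ _ _ a.

(* The 1-form Upsilon of a projective change of connection: its diagonal components
   determine it. *)
Definition projective_form j u : R :=
  2^-1 * (christoffel h a j j j u - christoffel g a j j j u).
Local Notation ups := projective_form.

Hypothesis proj : forall u, O u -> forall k i j,
  christoffel h a k i j u =
  christoffel g a k i j u + (k == i)%:R * ups j u + (k == j)%:R * ups i u.

Lemma smooth_projective_form j : smooth_on O (ups j).
Proof.
apply: (@smooth_onM _ _ _ oO (fun=> 2^-1)); first exact: smooth_on_cst.
exact (smooth_onB oO (@smooth_christoffel _ _ _ h a j j j) (@smooth_christoffel _ _ _ g a j j j)).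
Qed.

(** The tensor nabla Y - Y Y, with nabla the connection of [g]. *)
Definition projective_defect k l u : R :=
  partial k (ups l) u - \sum_p christoffel g a p k l u * ups p u - ups k u * ups l u.
Local Notation D := projective_defect.

Lemma partial_christoffel_change l j k i u : O u ->
  partial l (christoffel h a j k i) u = partial l (christoffel g a j k i) u
   + (j == k)%:R * partial l (ups i) u + (j == i)%:R * partial l (ups k) u.
Proof.
move=> Ou.
have sc := @smooth_christoffel _ _ _ g a j k i.
have sd b p : smooth_on O (fun w => (b : bool)%:R * ups p w).
  exact (smooth_onM oO (smooth_on_cst (b%:R)) (smooth_projective_form p)).
have pd b p : partial l (fun w => (b : bool)%:R * ups p w) u = b%:R * partial l (ups p) u.
  rewrite (partialM _ (smooth_on_cst (b%:R : R)) (smooth_projective_form p) Ou).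
  by rewrite partial_cst mul0r add0r.
have E : {in O, christoffel h a j k i =1
   (fun w => christoffel g a j k i w + (j == k)%:R * ups i w + (j == i)%:R * ups k w)}.
  by move=> w; rewrite inE => Ow; exact: proj.
rewrite (eq_partial oO _ E Ou).
rewrite (partialD _ (smooth_onD oO sc (sd _ i)) (sd _ k) Ou).
by rewrite (partialD _ sc (sd _ i) Ou) !pd.
Qed.

Lemma riemann_change j i l k u : O u ->
  riemann h a j i l k u = riemann g a j i l k u
  + (j == k)%:R * D l i u - (j == l)%:R * D k i u + (j == i)%:R * (D l k u - D k l u).
Proof.
move=> Ou.
apply: (projective_riemann (G := fun p q r => christoffel g a p q r u)
  (H := fun p q r => christoffel h a p q r u)
  (dG := fun p q r s => partial p (christoffel g a q r s) u)
  (dH := fun p q r s => partial p (christoffel h a q r s) u)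
  (y := fun p => ups p u) (dy := fun p q => partial p (ups q) u) (D := fun p q => D p q u)).
- by move=> p q r; exact: christoffelC.
- by move=> p q r; exact: proj.
- by move=> p q r s; exact: partial_christoffel_change.
- by [].
Qed.

Lemma ricci_change i k u : O u ->
  ricci h a i k u = ricci g a i k u - n%:R * D k i u + D i k u.
Proof.
move=> Ou; rewrite /ricci.
under eq_bigr do rewrite riemann_change//.
rewrite big_split/= sumrB big_split/=.
under [X in _ + X - _ + _]eq_bigr do rewrite eq_sym.
rewrite [in X in _ + X - _ + _](eq_bigr (fun p => (p == k)%:R * D p i u)); last first.
  by move=> p _; rewrite eq_sym.
rewrite sum_deltal.
under [X in _ - X + _]eq_bigr do rewrite eqxx mul1r.
rewrite sumr_const card_ord -[_ *+ n]mulr_natl sum_deltal.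
by ring.
Qed.

Hypothesis n_ge2 : (2 <= n)%N.

(** Antisymmetrizing [ricci_change] leaves n + 1 times the skew part of the defect, and n + 1 is
    nonzero. *)
Lemma projective_defect_sym i k u : O u -> D i k u = D k i u.
Proof.
move=> Ou.
have alg (N r x y : R) : r - N * x + y = r - N * y + x -> (N + 1) * (y - x) = 0.
  by lra.
have sg : ricci g a i k u = ricci g a k i u.
  exact: ric_sym (riemann_curvature_tensor g Ou) i k.
have sh : ricci h a i k u = ricci h a k i u.
  exact: ric_sym (riemann_curvature_tensor h Ou) i k.
have E := etrans (esym (ricci_change i k Ou)) (etrans sh (ricci_change k i Ou)).
move: E; rewrite sg => /alg/eqP; rewrite mulf_eq0 => /orP[|]; last by rewrite subr_eq0 => /eqP.
by rewrite natr1 pnatr_eq0.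
Qed.

Lemma schouten_change i k u : O u -> schouten h a i k u = schouten g a i k u - D k i u.
Proof.
move=> Ou; rewrite /schouten ricci_change// (projective_defect_sym i k Ou).
have n1 : (n%:R - 1 : R) != 0.
  by rewrite subr_eq0 -[1]/(1%:R) eqr_nat; apply: contraTneq n_ge2 => ->.
by field.
Qed.

Lemma weyl_change i j k l u : O u -> weyl h a i j k l u = weyl g a i j k l u.
Proof.
move=> Ou.
have alg (r s1 s2 e1 e2 e3 D1 D2 D3 : R) :
    r + e1 * D1 - e2 * D2 + e3 * (D3 - D3) + e1 * (s1 - D1) - e2 * (s2 - D2) =
    r + e1 * s1 - e2 * s2 by ring.
rewrite /weyl (riemann_change i j k l Ou) (schouten_change j k Ou) (schouten_change j l Ou).
by rewrite (projective_defect_sym k l Ou) alg.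
Qed.

Section ConstantEigenvalue.
Variables (B : R) (b : 'rV[R]_n -> R).
Hypothesis b_smooth : smooth_on O b.
Hypothesis nullity : forall u, O u -> exists v : 'I_n -> R,
  [/\ exists i, v i != 0, null_vector (fun i j k l => riemann g a i j k l u) v,
    forall k, \sum_j schouten g a k j u * v j = B * flat (g a u) v k &
    forall k, \sum_j schouten h a k j u * v j = b u * flat (h a u) v k].

(** All first derivatives of Y become algebraic in Y, the metrics and the eigenvalues, so one
    further differentiation stays within known quantities. *)
Lemma partial_projective_form k l u : O u ->
  partial k (ups l) u = \sum_p christoffel g a p k l u * ups p u + ups k u * ups l u
    + B * g a u k l - b u * h a u k l.
Proof.
move=> Ou; have [v [v0 nv eg eh]] := nullity Ou.
have W i j p q : weyl_of (fun i j k l => riemann g a i j k l u) i j p q =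
                 weyl_of (fun i j k l => riemann h a i j k l u) i j p q.
  exact: esym (weyl_change _ _ _ _ Ou).
have := schouten_shift_invariant (riemann_curvature_tensor g Ou)
  (riemann_curvature_tensor h Ou) W nv v0 eg eh k l.
have -> : schouten_of (fun i j k l => riemann g a i j k l u) k l = schouten g a k l u by [].
have -> : schouten_of (fun i j k l => riemann h a i j k l u) k l = schouten h a k l u by [].
rewrite schouten_change// (projective_defect_sym l k Ou) /D.
set S := \sum_p _; set y1 := ups k u; set y2 := ups l u.
by move: (partial k _ u) (schouten _ _ _ _ _) S y1 y2 (g a u k l) (h a u k l) (b u) => *; lra.
Qed.

Lemma eigenvalue_partial_eq0 u : O u -> forall j, partial j b u = 0.
Proof.
move=> Ou; have [v [v0 nv eg eh]] := nullity Ou.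
have W i j p q : weyl_of (fun i j k l => riemann g a i j k l u) i j p q =
                 weyl_of (fun i j k l => riemann h a i j k l u) i j p q.
  exact: esym (weyl_change _ _ _ _ Ou).
apply: (null_contraction (riemann_curvature_tensor g Ou)
  (riemann_curvature_tensor h Ou) nv v0 eg (ups := fun p => ups p u)
  (be := fun p => partial p b u) n_ge2) => j k l.
have compat (m : metric M) p q r : partial p (fun w => m a w q r) u =
    \sum_s m a u q s * christoffel m a s p r u + \sum_s m a u r s * christoffel m a s p q u.
  have := congr1 (fun A : 'M[R]_n => A q r) (metric_compatible m p Ou); rewrite !mxE => ->.
  by congr (_ + _); apply: eq_bigr => s _; rewrite !mxE.
have sG := @smooth_christoffel _ _ _ g a.
have sU := smooth_projective_form.
have sGU p q r s : smooth_on O (fun w => christoffel g a p q r w * ups s w).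
  exact (smooth_onM oO (sG p q r) (sU s)).
(* The Leibniz rule applied to the first-order equation; the constant [B] contributes no
   derivative. *)
have dE p q r : partial p (partial q (ups r)) u =
   \sum_s (partial p (christoffel g a s q r) u * ups s u
           + christoffel g a s q r u * partial p (ups s) u)
   + (partial p (ups q) u * ups r u + ups q u * partial p (ups r) u)
   + B * partial p (fun w => g a w q r) u
   - (partial p b u * h a u q r + b u * partial p (fun w => h a w q r) u).
  have E : {in O, partial q (ups r) =1 (fun w => \sum_s christoffel g a s q r w * ups s w
      + ups q w * ups r w + B * g a w q r - b w * h a w q r)}.
    by move=> w; rewrite inE => Ow; exact: partial_projective_form.
  have s1 : smooth_on O (fun w => \sum_s christoffel g a s q r w * ups s w).
    exact: (smooth_on_sum oO _ _ (fun s => sGU s q r s)).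
  have s2 := smooth_onM oO (sU q) (sU r).
  have sg : smooth_on O (fun w => g a w q r) by exact: smooth_mx_metric.
  have sh : smooth_on O (fun w => h a w q r) by exact: smooth_mx_metric.
  have sB : smooth_on O (fun=> B) by exact: smooth_on_cst.
  have s3 := smooth_onM oO sB sg.
  have s4 := smooth_onM oO b_smooth sh.
  rewrite (eq_partial oO _ E Ou).
  rewrite (partialB oO _ (smooth_onD oO (smooth_onD oO s1 s2) s3) s4 Ou).
  rewrite (partialD _ (smooth_onD oO s1 s2) s3 Ou) (partialD _ s1 s2 Ou).
  rewrite (partial_sum oO _ _ (fun s => sGU s q r s) Ou).
  rewrite (partialM _ (sU q) (sU r) Ou) (partialM _ sB sg Ou) (partialM _ b_smooth sh Ou).
  rewrite partial_cst mul0r add0r; congr (_ + _ + _ - _).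
  by apply: eq_bigr => s _; rewrite (partialM _ (sG s q r) (sU s) Ou).
have := @ricci_identity_contracted _ n (fun p q r => christoffel g a p q r u)
  (fun j p k l => partial j (christoffel g a p k l) u) (fun p => ups p u)
  (fun p => partial p b u) (fun p q => partial p (ups q) u) (g a u) (h a u)
  (fun p q r => partial p (fun w => g a w q r) u)
  (fun p q r => partial p (fun w => h a w q r) u) B (b u).
apply.
- by move=> p q r; exact: christoffelC.
- by move=> q r; exact: metric_symE.
- by move=> q r; exact: metric_symE.
- by move=> q r; exact: partial_projective_form.
- by move=> p q r; exact: compat.
- move=> p q r; rewrite compat; congr (_ + _); apply: eq_bigr => s _; by rewrite proj.
(* Schwarz's theorem for Y: the two expressions for its mixed second derivatives agree. *)
have E := etrans (esym (dE j k l)) (etrans (partialC oO j k (sU l) Ou) (dE k j l)).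
exact E.
Qed.

End ConstantEigenvalue.

End ProjectiveChange.

(** * Change of charts *)

Section Jacobian.
Context {R : realType} {n m : nat}.

Lemma c1_row_differentiable (f : 'rV[R]_n -> 'rV[R]_m) (O : set 'rV[R]_n) x :
  open O -> ck 1 O f -> O x -> differentiable f x.
Proof.
move=> oO cf Ox.
have cfi i : ck 1 O (fun z => f z 0 i) by apply: (ck_mxP _ _ oO).1.
have dfi i : differentiable (fun z => f z 0 i *: (delta_mx 0 i : 'rV[R]_m)) x.
  have [d _] := c1_differentiable oO (cfi i) Ox.
  exact: differentiableZl.
have -> : f = \sum_(i < m) (fun z => f z 0 i *: (delta_mx 0 i : 'rV[R]_m)).
  apply/funext => z; rewrite fct_sumE [LHS]row_sum_delta.
  by [].
exact: differentiable_sum.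
Qed.

Lemma jacobianE (f : 'rV[R]_n -> 'rV[R]_m) (O : set 'rV[R]_n) x i j :
  open O -> smooth_on O f -> O x ->
  jacobian f x i j = partial i (fun z => f z 0 j) x.
Proof.
move=> oO /smooth_onP sf Ox.
have df := c1_row_differentiable oO (sf 1%N) Ox.
have dd : derivable f x (delta_mx 0 i) := ck_derivable (sf 1%N) Ox.
have := deriveEjacobian (delta_mx 0 i) df; rewrite -rowE => /rowP/(_ j).
by rewrite mxE => <-; rewrite (derive_mx dd) mxE.
Qed.

End Jacobian.

Section Overlap.
Context {R : realType} {n : nat} {M : manifold R n} (a b : chart M).
Implicit Types (u : 'rV[R]_n).

Definition overlap : set 'rV[R]_n := coord a @` (dom a `&` dom b).
Local Notation U := overlap.
Local Notation phi := (transition a b).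

Lemma overlap_sub : U `<=` chart_image a.
Proof. by move=> _ [x [ax bx] <-]; exists x. Qed.

Lemma overlap_open : open U.
Proof.
rewrite openE => u Uu; have Ou := overlap_sub Uu.
have : nbhs u (chart_image a `&` param a @^-1` dom b).
  apply: filterI; first exact: open_nbhs_nbhs (conj (@image_open _ _ M a) Ou).
  apply: (param_continuous Ou); apply: open_nbhs_nbhs; split; first exact: dom_open.
  by move: Uu => [x [ax bx] <-]; rewrite coordK.
apply: filterS => w [[x ax <-]]; rewrite /= coordK// => bx.
by exists x.
Qed.

Lemma transition_overlap u : U u -> chart_image b (phi u).
Proof.
by move=> [x [ax bx] <-]; rewrite /transition /= coordK//; exists x.
Qed.

Lemma smooth_transition : smooth_on U phi.
Proof. exact: transition_smooth. Qed.

Let oU := overlap_open.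
Let oB : open (chart_image b) := @chart_image_open _ _ _ b.
Let oA : open (chart_image a) := @chart_image_open _ _ _ a.

Definition jac u : 'M[R]_n := jacobian phi u.
Local Notation J := jac.

Lemma jacE u i j : U u -> J u i j = partial i (fun w => phi w 0 j) u.
Proof. exact: (jacobianE _ _ oU smooth_transition). Qed.

Lemma smooth_transition_coord j : smooth_on U (fun w => phi w 0 j).
Proof. exact: (smooth_on_mxP oU phi).1 smooth_transition 0 j. Qed.

Lemma smooth_jac : smooth_mx U J.
Proof.
move=> i j; apply: (eq_smooth_on oU _ (smooth_on_derive (delta_mx 0 i) (smooth_transition_coord j))).
by move=> w; rewrite inE => Uw; exact: esym (jacE i j Uw).
Qed.

Lemma partial_jacC i k j u : U u -> partial_mx i J u k j = partial_mx k J u i j.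
Proof.
move=> Uu.
have E p q : partial_mx p J u q j = partial p (partial q (fun w => phi w 0 j)) u.
  rewrite mxE; apply: (eq_partial oU) => // w; rewrite inE => Uw.
  exact: jacE.
exact: etrans (E i k) (etrans (partialC oU i k (smooth_transition_coord j) Uu) (esym (E k i))).
Qed.

Lemma partial_mx_transition k p q (A : 'rV[R]_n -> 'M[R]_(p, q)) u :
  smooth_mx (chart_image b) A -> U u ->
  partial_mx k (fun w => A (phi w)) u = \sum_d J u k d *: partial_mx d A (phi u).
Proof.
move=> sA Uu; apply/matrixP => i j; rewrite summxE mxE.
have E := partial_chain oB k oU (sA i j) smooth_transition Uu (transition_overlap Uu).
apply: etrans E _; apply: eq_bigr => d _; rewrite -jacE//.
by rewrite [RHS]mxE; congr (_ * _); rewrite mxE.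
Qed.

Lemma smooth_mx_transition p q (A : 'rV[R]_n -> 'M[R]_(p, q)) :
  smooth_mx (chart_image b) A -> smooth_mx U (fun w => A (phi w)).
Proof.
move=> sA i j.
exact: (smooth_on_comp oU oB (sA i j) smooth_transition transition_overlap).
Qed.

Section Metric.
Variable g : metric M.

Lemma metric_overlap u : U u -> g a u = J u *m g b (phi u) *m (J u)^T.
Proof.
move=> [x [ax bx] <-]; have /= := metric_transform g ax bx.
by rewrite /jac /transition /= coordK.
Qed.

(** Read off from g_a = J g_b J^T, whose left side is invertible. *)
Lemma jac_unit u : U u -> J u \in unitmx.
Proof.
move=> Uu; have := metric_nondegenerate g (overlap_sub Uu).
by rewrite (metric_overlap Uu) !unitmx_mul => /andP[/andP[]].
Qed.

(** The connection of the chart [b] pulled back by the transition map. The transpose lets it act on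
    row vectors from the right, like the Jacobian. *)
Definition pulled_conn l u : 'M[R]_n := \sum_d J u l d *: (conn g b d (phi u))^T.

(* Both sides define torsion-free connections compatible with the metric. *)
Lemma christoffel_transform l u : U u ->
  (conn g a l u)^T *m J u = partial_mx l J u + J u *m pulled_conn l u.
Proof.
move=> Uu; have uJ := jac_unit Uu; have Ou := overlap_sub Uu.
have Ob := transition_overlap Uu.
(* The asserted law solved for the connection of the chart [a]; uniqueness is applied to this
   candidate. *)
pose N' l := (partial_mx l J u + J u *m pulled_conn l u) *m invmx (J u).
suff -> : (conn g a l u)^T = N' l by rewrite /N' -mulmxA mulVmx// mulmx1.
move: l; apply: (levi_civita_unique (metric_nondegenerate g Ou)).
- move=> l.
  have -> : (conn g a l u)^T *m g a u + ((conn g a l u)^T *m g a u)^T = partial_mx l (g a) u.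
    by rewrite metric_compatible// !trmx_mul trmxK (metric_sym g Ou) addrC.
  have sg := smooth_mx_transition (@smooth_mx_metric _ _ _ g b).
  have sJ := smooth_jac; have sJg := smooth_mxM oU sJ sg.
  have E : {in U, g a =1 (fun w => J w *m g b (phi w) *m (J w)^T)}.
    by move=> w; rewrite inE => Uw; exact: metric_overlap.
  rewrite (eq_partial_mx oU _ E Uu) (partial_mxM oU _ sJg (smooth_mx_tr oU sJ) Uu).
  rewrite (partial_mxM oU _ sJ sg Uu) (partial_mx_tr oU _ _ Uu).
  rewrite (partial_mx_transition _ (@smooth_mx_metric _ _ _ g b) Uu).
  have -> : \sum_d J u l d *: partial_mx d (g b) (phi u) =
     pulled_conn l u *m g b (phi u) + (pulled_conn l u *m g b (phi u))^T.
    rewrite /pulled_conn mulmx_suml linear_sum /= -big_split/=; apply: eq_bigr => d _.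
    rewrite metric_compatible// scalerDr addrC -scalemxAl linearZ/=.
    by rewrite !trmx_mul trmxK (metric_sym g Ob).
  rewrite (metric_overlap Uu).
  have -> : N' l *m (J u *m g b (phi u) *m (J u)^T) =
     partial_mx l J u *m g b (phi u) *m (J u)^T
     + J u *m (pulled_conn l u *m g b (phi u)) *m (J u)^T.
    by rewrite /N' -!mulmxA mulKmx// mulmxDl -!mulmxA.
  exact: (congruence_leibniz _ _ _ (metric_sym g Ob)).
- by move=> l j i; rewrite !mxE; exact: christoffelC.
- move=> l j i; rewrite [LHS]mxE [RHS]mxE; apply: eq_bigr => c _; congr (_ * _).
  have K p q : (partial_mx p J u + J u *m pulled_conn p u) q c =
      partial_mx p J u q c
      + \sum_s \sum_d J u q s * J u p d * christoffel g b c d s (phi u).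
    rewrite [LHS]mxE; congr (_ + _); rewrite [LHS]mxE; apply: eq_bigr => s _.
    rewrite summxE mulr_sumr; apply: eq_bigr => d _; rewrite -[RHS]mulrA; congr (_ * _).
    by rewrite [LHS]mxE; congr (_ * _); rewrite !mxE.
  apply: etrans (K l j) (etrans _ (esym (K j l))); congr (_ + _).
    exact: partial_jacC.
  rewrite exchange_big/=; apply: eq_bigr => d _; apply: eq_bigr => s _.
  by rewrite (christoffelC g c s d Ob) [J u j s * _]mulrC.
Qed.

End Metric.

End Overlap.

(** * Curvature under a change of charts *)

Section CurvatureTransform.
Context {R : realType} {n : nat} {M : manifold R n} (a b : chart M) (g : metric M).
Implicit Types (u : 'rV[R]_n).
Local Notation U := (overlap a b).
Local Notation phi := (transition a b).
Local Notation J := (jac a b).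
Local Notation Nb d := (fun w => (conn g b d w)^T).
Local Notation P := (pulled_conn a b g).

Let oU : open U := @overlap_open _ _ _ a b.
Let oB : open (chart_image b) := @chart_image_open _ _ _ b.
Let oA : open (chart_image a) := @chart_image_open _ _ _ a.

Let sNb d : smooth_mx (chart_image b) (Nb d).
Proof. exact: (smooth_mx_tr oB (@smooth_conn _ _ _ g b d)). Qed.

Let sNa d : smooth_mx U (fun w => (conn g a d w)^T).
Proof.
move=> i j; apply: smooth_on_sub (@overlap_sub _ _ _ a b) _.
exact: (smooth_mx_tr oA (@smooth_conn _ _ _ g a d)).
Qed.

Let pulled_connE k i j w :
  P k w i j = \sum_d J w k d * (conn g b d (phi w))^T i j.
Proof. by rewrite summxE; apply: eq_bigr => d _; rewrite mxE. Qed.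

Lemma smooth_pulled_conn k : smooth_mx U (P k).
Proof.
move=> i j.
apply: (@eq_smooth_on _ _ _ oU _
  (fun w => \sum_d J w k d * (conn g b d (phi w))^T i j)).
  by move=> w _; rewrite pulled_connE.
apply: (smooth_on_sum oU) => d.
exact (smooth_onM oU (@smooth_jac _ _ _ a b k d) (smooth_mx_transition (sNb d) i j)).
Qed.

Lemma partial_pulled_conn l k u : U u ->
  partial_mx l (P k) u = \sum_d partial_mx l J u k d *: Nb d (phi u)
  + \sum_e \sum_d (J u l d * J u k e) *: partial_mx d (Nb e) (phi u).
Proof.
move=> Uu; apply/matrixP => i j; rewrite [LHS]mxE.
have sJ d : smooth_on U (fun w => J w k d) by exact: smooth_jac.
have sN d : smooth_on U (fun w => (conn g b d (phi w))^T i j).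
  exact: (smooth_mx_transition (sNb d)).
have E : {in U, (fun w => P k w i j) =1
    (fun w => \sum_d J w k d * (conn g b d (phi w))^T i j)}.
  by move=> w _; rewrite pulled_connE.
have dN d : partial l (fun w => (conn g b d (phi w))^T i j) u =
    \sum_c J u l c * partial_mx c (Nb d) (phi u) i j.
  have := congr1 (fun A : 'M[R]_n => A i j) (partial_mx_transition l (sNb d) Uu).
  rewrite [LHS]mxE => ->; rewrite summxE; apply: eq_bigr => c _; exact: mxE.
apply: etrans (eq_partial oU _ E Uu) _.
apply: etrans (partial_sum oU _ _ (fun d => smooth_onM oU (sJ d) (sN d)) Uu) _.
rewrite [RHS]mxE !summxE -big_split/=; apply: eq_bigr => d _.
apply: etrans (partialM _ (sJ d) (sN d) Uu) _.
rewrite dN [X in _ = X + _]mxE; congr (_ + _).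
  by congr (_ * _); rewrite [RHS]mxE.
rewrite mulr_sumr summxE; apply: eq_bigr => c _; rewrite [RHS]mxE mulrA.
by rewrite [J u k d * _]mulrC.
Qed.

(** By [christoffel_transform], J is a gauge transformation between the connection in [a] and the
    pulled back one. Curvature is covariant under it because second derivatives of J commute, and
    [pulled_curvature] evaluates the pulled back side. *)
Lemma curv_transform l k u : U u ->
  (curv g a l k u)^T *m J u =
  J u *m \sum_d \sum_e (J u l d * J u k e) *: (curv g b d e (phi u))^T.
Proof.
move=> Uu; have Ou := overlap_sub Uu; have Ob := transition_overlap Uu.
pose Na p := (fun w => (conn g a p w)^T).
have E p q : partial_mx p (Na q) u *m J u + Na q u *m partial_mx p J u =
    partial_mx p (partial_mx q J) u
    + (partial_mx p J u *m P q u + J u *m partial_mx p (P q) u).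
  have sJ := @smooth_jac _ _ _ a b; have sP := smooth_pulled_conn q.
  have C : {in U, (fun w => Na q w *m J w) =1
                  (fun w => partial_mx q J w + J w *m P q w)}.
    by move=> w; rewrite inE => Uw; exact: christoffel_transform.
  apply: etrans (esym (partial_mxM oU p (sNa q) sJ Uu)) _.
  apply: etrans (eq_partial_mx oU _ C Uu) _.
  apply: etrans (partial_mxD oU _ (smooth_mx_partial oU _ sJ) (smooth_mxM oU sJ sP) Uu) _.
  by congr (_ + _); exact: (partial_mxM oU _ sJ sP Uu).
have H : partial_mx k (partial_mx l J) u = partial_mx l (partial_mx k J) u.
  by apply: (partial_mxC oU _ _ _ Uu); exact: smooth_jac.
have E2 := E k l; rewrite H in E2.
have GC := gauge_curvature (christoffel_transform g l Uu) (christoffel_transform g k Uu)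
  (E l k) E2.
have curvT c d e w : chart_image c w -> (curv g c d e w)^T =
    partial_mx d (fun w => (conn g c e w)^T) w - partial_mx e (fun w => (conn g c d w)^T) w
    + ((conn g c e w)^T *m (conn g c d w)^T - (conn g c d w)^T *m (conn g c e w)^T).
  move=> Ow; have oC := @chart_image_open _ _ _ c.
  have T p q := partial_mx_tr oC p (conn g c q) Ow.
  apply: etrans (esym (congr2 (fun A B => A - B + _) (T d e) (T e d))).
  by rewrite /curv linearD !linearB/= !trmx_mul.
apply: etrans (congr1 (mulmx^~ (J u)) (curvT a l k u Ou)) _.
apply: etrans GC _; congr (J u *m _).
apply: etrans (congr2 (fun A B => A - B + _) (partial_pulled_conn l k Uu)
  (partial_pulled_conn k l Uu)) _.
have PC := pulled_curvature (J u l) (J u k) (fun d => Nb d (phi u))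
  (fun d e => partial_mx d (Nb e) (phi u))
  (fun d => partial_jacC l k d Uu : (fun d => partial_mx l J u k d) d = (fun d => partial_mx k J u l d) d).
apply: etrans PC _; apply: eq_bigr => d _; apply: eq_bigr => e _; congr (_ *: _).
exact: esym (curvT b d e (phi u) Ob).
Qed.

Definition ricci_mx (c : chart M) u : 'M[R]_n := \matrix_(j, k) ricci g c j k u.

Lemma ricci_mxE c u : ricci_mx c u = \matrix_(j, k) \sum_p (curv g c p k u)^T j p.
Proof.
apply/matrixP => j k; rewrite !mxE; apply: eq_bigr => p _.
by rewrite riemannE [RHS]mxE.
Qed.

Lemma ricci_transition u : U u ->
  ricci_mx a u = J u *m ricci_mx b (phi u) *m (J u)^T.
Proof.
move=> Uu; have uJ := jac_unit g Uu; rewrite !ricci_mxE.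
apply: (@ricci_transform _ _ (J u) (invmx (J u)) (fun l k => (curv g a l k u)^T)
  (fun l k => (curv g b l k (phi u))^T)).
- exact: mulVmx.
- exact: mulmxV.
- by move=> l k; exact: curv_transform.
Qed.

Definition schouten_mx (c : chart M) u : 'M[R]_n := \matrix_(j, k) schouten g c j k u.

Lemma schouten_transition u : U u ->
  schouten_mx a u = J u *m schouten_mx b (phi u) *m (J u)^T.
Proof.
move=> Uu; have E c w : schouten_mx c w = (n%:R - 1)^-1 *: ricci_mx c w.
  by apply/matrixP => j k; rewrite !mxE.
by rewrite !E ricci_transition// -scalemxAr -scalemxAl.
Qed.

End CurvatureTransform.

(** * Geodesics *)

Section CurveRules.
Context {R : realType} {V : normedModType R} (U : set V) (oU : open U) (v : V).
Implicit Types (f h : V -> R) (t : V).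

Lemma eq_deriveP f h t : {in U, f =1 h} -> U t -> 'D_v f t = 'D_v h t.
Proof. by move=> fh Ut; apply: near_eq_derive; exact: eq_near_open fh Ut. Qed.

Lemma smooth_deriveM f h t : smooth_on U f -> smooth_on U h -> U t ->
  'D_v (fun s => f s * h s) t = 'D_v f t * h t + f t * 'D_v h t.
Proof.
move=> sf sh Ut; rewrite addrC ['D_v f t * _]mulrC.
exact (deriveM (smooth_on_derivable sf Ut) (smooth_on_derivable sh Ut)).
Qed.

Lemma smooth_derive_sum (I : Type) (r : seq I) (f : I -> V -> R) t :
  (forall i, smooth_on U (f i)) -> U t ->
  'D_v (fun s => \sum_(i <- r) f i s) t = \sum_(i <- r) 'D_v (f i) t.
Proof.
move=> sf Ut; elim: r => [|i r IH].
  rewrite big_nil; apply: etrans (_ : 'D_v (fun=> 0) t = 0); last exact: derive_cst.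
  by apply: eq_deriveP => // w _; rewrite big_nil.
have sr := smooth_on_sum oU r predT sf.
rewrite big_cons -IH.
apply: etrans (_ : 'D_v (fun s => f i s + \sum_(j <- r) f j s) t = _).
  by apply: eq_deriveP => // w _; rewrite big_cons.
exact (deriveD (smooth_on_derivable (sf i) Ut) (smooth_on_derivable sr Ut)).
Qed.

Lemma smooth_derive_row n (f : V -> 'rV[R]_n) t i : smooth_on U f -> U t ->
  'D_v f t 0 i = 'D_v (fun s => f s 0 i) t.
Proof.
move=> sf Ut; have df : derivable f t v := smooth_on_derivable sf Ut.
by rewrite (derive_mx df) mxE.
Qed.

End CurveRules.

Section GeodesicCharts.
Context {R : realType} {n : nat} {M : manifold R n} (g : metric M) (a : chart M).
Local Notation O := (chart_image a).
Let oA : open O := @chart_image_open _ _ _ a.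

Variables (I : set R) (x : R -> 'rV[R]_n).
Hypotheses (oI : open I) (sx : smooth_on I x) (xO : forall t, I t -> O (x t)).
Hypothesis x_eq : forall t, I t -> forall k : 'I_n,
  'D_1 ('D_1 x) t 0 k + \sum_i \sum_j christoffel g a k i j (x t) *
     ('D_1 x t 0 i * 'D_1 x t 0 j) = 0.

(** [geodesic] asks for the equation in every chart, while a solution is found in one; the chain
    rule and [christoffel_transform] carry it over. *)
Lemma chart_curve_geodesic : geodesic g I (param a \o x).
Proof.
have cx t : I t -> {for t, continuous x}.
  by move=> It; have /smooth_onP/(_ 0%N)[+ _] := sx; exact.
have cgam t : I t -> {for t, continuous (param a \o x)}.
  move=> It; apply: continuous_comp; first exact: cx.
  exact: param_continuous (xO It).
split=> // b; set gam := param a \o x.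
have ov t : I t -> dom b (gam t) -> overlap a b (x t).
  move=> It; have [y ay yx] := xO It.
  by rewrite /gam /= -yx coordK// => bt; exists y.
pose Ib := I `&` gam @^-1` dom b.
have oIb : open Ib.
  rewrite openE => t [It bt]; apply: filterI; first exact: open_nbhs_nbhs.
  apply: (cgam t It); apply: open_nbhs_nbhs; split=> //; exact: dom_open.
have Iov t : Ib t -> overlap a b (x t) by move=> [It bt]; exact: ov.
have sIx : smooth_on Ib x by apply: smooth_on_sub sx => t [].
have oU : open (overlap a b) := @overlap_open _ _ _ a b.
have sphi := @smooth_transition _ _ _ a b.
pose c := coord b \o gam.
have sc : smooth_on Ib c by exact: (smooth_on_comp_row oIb oU sphi sIx Iov).
split=> // t It bt k.
have Ibt : Ib t by [].
have Uxt := Iov t Ibt.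
have sy i : smooth_on Ib (fun s => 'D_1 x s 0 i).
  have sx1 : smooth_on Ib ('D_1 x) by exact: smooth_on_derive.
  have H := (smooth_on_mxP oIb ('D_1 x)).1 sx1 0 i. exact H.
have sJ i j : smooth_on (overlap a b) (fun w => jac a b w i j) by exact: smooth_jac.
have sJx i j : smooth_on Ib (fun s => jac a b (x s) i j).
  exact: (smooth_on_comp oIb oU (sJ i j) sIx Iov).
have dx s : Ib s -> derivable x s 1 by move=> Ibs; exact: smooth_on_derivable sIx Ibs.
have c1 (i : 'I_n) s : Ib s -> 'D_1 c s 0 i = \sum_j 'D_1 x s 0 j * jac a b (x s) j i.
  move=> Ibs; rewrite (smooth_derive_row _ _ sc Ibs).
  have /smooth_onP sphi_i := @smooth_transition_coord _ _ _ a b i.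
  have [_ E] := derivable_chain oU (sphi_i 1%N) (Iov s Ibs) (dx s Ibs).
  apply: etrans E _; apply: eq_bigr => j _; congr (_ * _).
  by rewrite jacE//; exact: Iov.
have c2 : 'D_1 ('D_1 c) t 0 k = \sum_j ('D_1 ('D_1 x) t 0 j * jac a b (x t) j k
    + 'D_1 x t 0 j * \sum_i 'D_1 x t 0 i * partial_mx i (jac a b) (x t) j k).
  have sc1 : smooth_on Ib ('D_1 c) by exact: smooth_on_derive.
  have sx1 : smooth_on Ib ('D_1 x) by exact: smooth_on_derive.
  have Ec : 'D_1 ('D_1 c) t 0 k = 'D_1 (fun s => 'D_1 c s 0 k) t.
    exact: (smooth_derive_row _ _ sc1 Ibt).
  have Ex j : 'D_1 ('D_1 x) t 0 j = 'D_1 (fun s => 'D_1 x s 0 j) t.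
    exact: (smooth_derive_row _ _ sx1 Ibt).
  apply: etrans Ec _.
  have E : {in Ib, (fun s => 'D_1 c s 0 k) =1 (fun s => \sum_j 'D_1 x s 0 j * jac a b (x s) j k)}.
    by move=> s; rewrite inE; exact: c1.
  apply: etrans (eq_deriveP oIb _ E Ibt) _.
  apply: etrans (smooth_derive_sum oIb _ _ (fun j => smooth_onM oIb (sy j) (sJx j k)) Ibt) _.
  apply: eq_bigr => j _; apply: etrans (smooth_deriveM _ (sy j) (sJx j k) Ibt) _.
  congr (_ * _ + _ * _).
    exact: esym (Ex j).
  have /smooth_onP sJjk := sJ j k.
  have [_ E2] := derivable_chain oU (sJjk 1%N) Uxt (dx t Ibt).
  by apply: etrans E2 _; apply: eq_bigr => i _; rewrite [in RHS]mxE.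
have ct : coord b (gam t) = transition a b (x t) by [].
rewrite -[coord b \o gam]/c c2.
(* The transformation law solved for the derivative of the Jacobian, the only term foreign to the
   geodesic equations. *)
have law i j : partial_mx i (jac a b) (x t) j k =
    \sum_m christoffel g a m i j (x t) * jac a b (x t) m k
    - \sum_p \sum_q jac a b (x t) j p * (jac a b (x t) i q * christoffel g b k q p (c t)).
  have := congr1 (fun A : 'M[R]_n => A j k) (christoffel_transform g i Uxt).
  rewrite mxE => E; apply/eqP; rewrite eq_sym subr_eq; apply/eqP.
  transitivity (\sum_m (conn g a i (x t))^T j m * jac a b (x t) m k).
    by apply: eq_bigr => m _; rewrite !mxE.
  rewrite E mxE; congr (_ + _); rewrite mxE; apply: eq_bigr => p _.
  rewrite summxE mulr_sumr; apply: eq_bigr => q _; congr (_ * _).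
  by rewrite mxE; congr (_ * _); rewrite !mxE.
under eq_bigr do under eq_bigr do rewrite law.
have C1 i : 'D_1 c t 0 i = \sum_j 'D_1 x t 0 j * jac a b (x t) j i by exact: c1.
under [X in _ + X]eq_bigr do under eq_bigr do rewrite !C1.
have XE j := x_eq It j.
move: XE; set X2 := 'D_1 ('D_1 x) t; set X1 := 'D_1 x t; set J0 := jac a b (x t).
set Ga := fun m i j => christoffel g a m i j (x t).
set Gb := fun m i j => christoffel g b m i j (c t).
by move=> XE; exact: (@geodesic_algebra _ _ Ga Gb X1 X2 J0 k XE).
Qed.

End GeodesicCharts.

Section GeodesicExistence.
Context {R : realType} {n : nat} {M : manifold R n} (g : metric M) (a : chart M).
Local Notation O := (chart_image a).
Let oA : open O := @chart_image_open _ _ _ a.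

Let dom2 : set 'rV[R]_(n + n) := [set z | O (lsubmx z)].

(** The geodesic spray: the second-order equation as a first-order system for position (left half)
    and velocity (right half). *)
Let spray (z : 'rV[R]_(n + n)) : 'rV[R]_(n + n) :=
  row_mx (rsubmx z) (\row_k - \sum_i \sum_j christoffel g a k i j (lsubmx z) *
    (rsubmx z 0 i * rsubmx z 0 j)).

Let dom2_open : open dom2.
Proof.
apply: open_comp => // z _; exact: continuous_lsubmx.
Qed.

Let smooth_coord (N : nat) (U : set 'rV[R]_N) i : smooth_on U (fun z : 'rV[R]_N => z 0 i).
Proof.
apply: (@smooth_on_sub _ _ setT) => //; apply/smooth_onP => k.
apply: (ck_mxP k (@id 'rV[R]_N) openT).1.
elim: k => [|k IH]; first by split=> // x _; exact: cvg_id.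
split; first by move=> x _; exact: cvg_id.
split=> [x v _|v]; first exact: derivable_id.
apply: eq_ck (ck_cst setT k v) => //; first exact: openT.
by move=> x _; rewrite derive_id.
Qed.

Let smooth_spray : smooth_on dom2 spray.
Proof.
have sl : smooth_on dom2 (lsubmx : 'rV[R]_(n + n) -> 'rV[R]_n).
  apply/(smooth_on_mxP dom2_open) => i j.
  apply: (eq_smooth_on dom2_open _ (@smooth_coord _ dom2 (lshift n j))) => z _.
  by rewrite mxE ord1.
have sr i : smooth_on dom2 (fun z => rsubmx z 0 i).
  apply: (eq_smooth_on dom2_open _ (@smooth_coord _ dom2 (rshift n i))) => z _.
  by rewrite mxE.
have sG k i j : smooth_on dom2 (fun z => christoffel g a k i j (lsubmx z)).
  exact: (smooth_on_comp dom2_open oA (@smooth_christoffel _ _ _ g a k i j) sl).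
apply/(smooth_on_mxP dom2_open) => i0 j; rewrite ord1.
case: (splitP j) => [i ji|k jk].
  apply: (eq_smooth_on dom2_open _ (sr i)) => z _.
  by rewrite (_ : j = lshift n i) ?row_mxEl//; exact: val_inj.
apply: (@eq_smooth_on _ _ _ dom2_open _ (fun z => - \sum_i \sum_j christoffel g a k i j (lsubmx z) *
    (rsubmx z 0 i * rsubmx z 0 j))).
  move=> z _; rewrite (_ : j = rshift n k); last exact: val_inj.
  by rewrite row_mxEr mxE.
apply: (smooth_onN dom2_open); apply: (smooth_on_sum dom2_open) => i.
apply: (smooth_on_sum dom2_open) => l.
exact (smooth_onM dom2_open (sG k i l) (smooth_onM dom2_open (sr i) (sr l))).
Qed.

Lemma geodesic_existence (u w : 'rV[R]_n) : O u ->
  exists (e : R) (x : R -> 'rV[R]_n), [/\ 0 < e, x 0 = u, 'D_1 x 0 = w &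
   let I := [set` `]- e, e[] in
   [/\ smooth_on I x, forall t, I t -> O (x t) &
   forall t, I t -> forall k : 'I_n,
  'D_1 ('D_1 x) t 0 k + \sum_i \sum_j christoffel g a k i j (x t) *
     ('D_1 x t 0 i * 'D_1 x t 0 j) = 0]].
Proof.
move=> Ou; have /smooth_onP sF := smooth_spray.
have Oz : dom2 (row_mx u w) by rewrite /dom2 /= row_mxKl.
have [e [z [e0 z0 zO dz]]] := c1_flow dom2_open (sF 1%N) Oz.
pose I : set R := [set` `]- e, e[].
have oI : open I by exact: interval_open.
have Ie t : I t -> `|t| < e by rewrite /I /= in_itv /= ltr_norml.
have I0 : I 0 by rewrite /I /= in_itv/= oppr_lt0 e0.
pose x t := lsubmx (z t); pose y t := rsubmx (z t).
have sz : smooth_on I z.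
  apply/smooth_onP; apply: (flow_smooth dom2_open oI sF) => t /Ie; [exact: zO|exact: dz].
have sx : smooth_on I x.
  apply/(smooth_on_mxP oI) => i j.
  apply: (eq_smooth_on oI _ ((smooth_on_mxP oI z).1 sz 0 (lshift n j))) => t _.
  by rewrite /x mxE ord1.
have sy : smooth_on I y.
  apply/(smooth_on_mxP oI) => i j.
  apply: (eq_smooth_on oI _ ((smooth_on_mxP oI z).1 sz 0 (rshift n j))) => t _.
  by rewrite /y mxE ord1.
have dzj t j : I t -> 'D_1 (fun s => z s 0 j) t = spray (z t) 0 j.
  by move=> /Ie te; have /is_derive_rowP/(_ j)[_ ->] := dz t te.
have dx t : I t -> 'D_1 x t = y t.
  move=> It; apply/rowP => i; apply: etrans (smooth_derive_row _ _ sx It) _.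
  apply: etrans (_ : 'D_1 (fun s => z s 0 (lshift n i)) t = _).
    by apply: (eq_deriveP oI) => // s _; rewrite /x mxE.
  by rewrite dzj// row_mxEl.
have dy t k : I t -> 'D_1 y t 0 k = - \sum_i \sum_j christoffel g a k i j (x t) * (y t 0 i * y t 0 j).
  move=> It; apply: etrans (smooth_derive_row _ _ sy It) _.
  apply: etrans (_ : 'D_1 (fun s => z s 0 (rshift n k)) t = _).
    by apply: (eq_deriveP oI) => // s _; rewrite /y mxE.
  by rewrite dzj// row_mxEr mxE.
have ddx t : I t -> 'D_1 ('D_1 x) t = 'D_1 y t.
  by move=> It; apply: near_eq_derive; apply: eq_near_open oI _ It => s; rewrite inE; exact: dx.
have x0 : x 0 = u by rewrite /x z0 row_mxKl.
have dx0 : 'D_1 x 0 = w by rewrite (dx 0 I0) /y z0 row_mxKr.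
have xE t k : I t -> 'D_1 ('D_1 x) t 0 k + \sum_i \sum_j christoffel g a k i j (x t) *
     ('D_1 x t 0 i * 'D_1 x t 0 j) = 0.
  by move=> It; rewrite (ddx t It) (dy t k It) (dx t It) addNr.
exists e, x; split; [exact: e0|exact: x0|exact: dx0|split].
- exact: sx.
- by move=> t /Ie; exact: zO.
- by move=> t It k; exact: xE.
Qed.

End GeodesicExistence.

(** With q = s' and p = s'', the equation of h along x o s, where x'' has been replaced by - Sg from
    the equation of g. *)
Lemma reparam_alg (R : fieldType) (p q w Sg Sh : R) : q != 0 ->
  p * w + q * (q * - Sg) + q * q * Sh = 0 -> Sh - Sg = - p / (q * q) * w.
Proof.
move=> q0 E; apply: (@mulfI _ (q * q)); first by rewrite mulf_neq0.
rewrite mulrA [_ * (- p / _)]mulrC divfK ?mulf_neq0//.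
apply/eqP; rewrite -subr_eq0; apply/eqP; rewrite -[RHS]E; ring.
Qed.

Section ProjectiveEquivalence.
Context {R : realType} {n : nat} {M : manifold R n} (g h : metric M).
Hypothesis gh : geodesics_included g h.
Variable a : chart M.
Local Notation O := (chart_image a).

Lemma is_derive_comp_curve (f s : R -> R) (t : R) :
  derivable s t 1 -> derivable f (s t) 1 ->
  is_derive t (1 : R) (fun r => f (s r)) ('D_1 s t * 'D_1 f (s t)).
Proof.
move=> ds df.
have d1 : differentiable s t by apply/derivable1_diffP.
have d2 : differentiable f (s t) by apply/derivable1_diffP.
split; first exact: diff_derivable (differentiable_comp d1 d2).
by rewrite -derive1E (derive1_comp ds df) !derive1E mulrC.
Qed.

(* Compare the equations of g and h at t = 0 along the g-geodesic with initial
   velocity w: only a multiple of w can remain. *)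
Lemma geodesics_included_pointwise u (w : 'rV[R]_n) : O u -> exists lam, forall k,
  \sum_i \sum_j (christoffel h a k i j u - christoffel g a k i j u) * (w 0 i * w 0 j) =
  lam * w 0 k.
Proof.
move=> Ou; have [e [x [e0 x0 dx0 [sx xO xE]]]] := geodesic_existence g w Ou.
set I := [set` _] in sx xO xE.
have oI : open I by exact: interval_open.
have I0 : I 0 by rewrite /I /= in_itv/= oppr_lt0 e0.
have iI : open_interval I by split=> //; exact: interval_is_interval.
have Gg := chart_curve_geodesic oI sx xO xE.
have [J [s [[oJ _] [ss s1 sJ] [_ Gh]]]] := gh iI Gg.
(* [s] maps [J] onto [I], so the initial point is reached at some parameter t0, in general not 0. *)
have [t0 Jt0 st0] : exists2 t, J t & s t = 0 by move: I0; rewrite -sJ => -[t Jt E]; exists t.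
have JI t : J t -> I (s t) by move=> Jt; rewrite -sJ; exists t.
have domg t : J t -> dom a (((param a \o x) \o s) t).
  move=> /JI/xO/= [y ay <-]; by rewrite coordK.
have [_ /(_ t0 Jt0 (domg t0 Jt0)) Eh] := Gh a.
pose c t := x (s t).
have ccE : {in J, coord a \o ((param a \o x) \o s) =1 c}.
  move=> t; rewrite inE => /JI/xO[y ay E]; by rewrite /c /= -E coordK.
pose q := 'D_1 s t0; pose p := 'D_1 ('D_1 s) t0.
have q0 : q != 0 by exact: s1.
have sx1 : smooth_on I ('D_1 x) by exact: smooth_on_derive.
have ss1 : smooth_on J ('D_1 s) by exact: smooth_on_derive.
have sxk k : smooth_on I (fun r => x r 0 k) by exact: (smooth_on_mxP oI x).1 sx 0 k.
have sx1k k : smooth_on I (fun r => 'D_1 x r 0 k).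
  exact ((smooth_on_mxP oI ('D_1 x)).1 sx1 0 k).
have ds t : J t -> derivable s t 1 by move=> Jt; exact: smooth_on_derivable ss Jt.
have dck t k : J t -> is_derive t (1 : R) (fun r => x (s r) 0 k) ('D_1 s t * 'D_1 x (s t) 0 k).
  move=> Jt; have dxk : derivable (fun r => x r 0 k) (s t) 1.
    exact: smooth_on_derivable (sxk k) (JI t Jt).
  have := is_derive_comp_curve (ds t Jt) dxk.
  by rewrite -(smooth_derive_row _ _ sx (JI t Jt)).
have dc t : J t -> 'D_1 c t = 'D_1 s t *: 'D_1 x (s t).
  move=> Jt; have D : is_derive t (1 : R) c ('D_1 s t *: 'D_1 x (s t)).
    by apply/is_derive_rowP => k; rewrite mxE; exact: dck.
  by have [] := D.
have dx1k k : is_derive t0 (1 : R) (fun r => 'D_1 x (s r) 0 k) (q * 'D_1 ('D_1 x) 0 0 k).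
  have d1 : derivable (fun r => 'D_1 x r 0 k) (s t0) 1.
    exact: smooth_on_derivable (sx1k k) (JI t0 Jt0).
  have := is_derive_comp_curve (ds t0 Jt0) d1.
  by rewrite -(smooth_derive_row _ _ sx1 (JI t0 Jt0)) st0.
have dcck k : is_derive t0 (1 : R) (fun r => 'D_1 s r * 'D_1 x (s r) 0 k)
    (p * w 0 k + q * (q * 'D_1 ('D_1 x) 0 0 k)).
  have dp : is_derive t0 (1 : R) ('D_1 s) p.
    by apply/derivableP; exact: smooth_on_derivable ss1 Jt0.
  have := is_deriveM dp (dx1k k); rewrite st0 dx0 addrC.
  by rewrite [p * w 0 k]mulrC.
have dcc k : 'D_1 ('D_1 c) t0 0 k = p * w 0 k + q * (q * 'D_1 ('D_1 x) 0 0 k).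
  have D : is_derive t0 (1 : R) (fun t => 'D_1 s t *: 'D_1 x (s t))
      (\row_k (p * w 0 k + q * (q * 'D_1 ('D_1 x) 0 0 k))).
    apply/is_derive_rowP => i; rewrite mxE.
    have -> : (fun r => ('D_1 s r *: 'D_1 x (s r)) 0 i) = (fun r => 'D_1 s r * 'D_1 x (s r) 0 i).
      by apply/funext => r; rewrite mxE.
    exact: dcck.
  have -> : 'D_1 ('D_1 c) t0 = 'D_1 (fun t => 'D_1 s t *: 'D_1 x (s t)) t0.
    by apply: near_eq_derive; apply: eq_near_open oJ _ Jt0 => t; rewrite inE; exact: dc.
  by have [_ ->] := D; rewrite mxE.
have xx k : 'D_1 ('D_1 x) 0 0 k = - \sum_i \sum_j christoffel g a k i j u * (w 0 i * w 0 j).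
  by apply/eqP; rewrite -addr_eq0; have := xE 0 I0 k; rewrite x0 dx0 => ->.
(* This is the coordinate expression occurring in [geodesic]. It agrees with [c] on the open set
   [J], hence so do the derivatives there. *)
pose cc := coord a \o ((param a \o x) \o s).
have dcc' t : J t -> 'D_1 cc t = 'D_1 c t.
  by move=> Jt; apply: near_eq_derive; exact: eq_near_open oJ ccE Jt.
have ddcc' : 'D_1 ('D_1 cc) t0 = 'D_1 ('D_1 c) t0.
  by apply: near_eq_derive; apply: eq_near_open oJ _ Jt0 => t; rewrite inE; exact: dcc'.
have cc0 : cc t0 = u.
  by apply: etrans (ccE t0 _) _; [rewrite inE|rewrite /c st0].
(* The tangential term s'' w of the reparametrised curve, divided by s'^2. *)
exists (- p / (q * q)) => k.
have dcc0 : 'D_1 cc t0 = q *: w by rewrite (dcc' t0 Jt0) (dc t0 Jt0) st0 dx0.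
have : 'D_1 ('D_1 cc) t0 0 k + \sum_i \sum_j christoffel h a k i j (cc t0) *
    ('D_1 cc t0 0 i * 'D_1 cc t0 0 j) = 0 by exact: Eh.
rewrite ddcc' dcc0 dcc xx cc0.
set Sg := \sum_i _; set S1 := \sum_i _ => E.
have S1E : S1 = q * q * \sum_i \sum_j christoffel h a k i j u * (w 0 i * w 0 j).
  rewrite /S1 mulr_sumr; apply: eq_bigr => i _; rewrite mulr_sumr; apply: eq_bigr => j _.
  by rewrite !mxE; ring.
have -> : \sum_i \sum_j (christoffel h a k i j u - christoffel g a k i j u) * (w 0 i * w 0 j)
   = (\sum_i \sum_j christoffel h a k i j u * (w 0 i * w 0 j)) - Sg.
  rewrite -sumrB; apply: eq_bigr => i _; rewrite -sumrB; apply: eq_bigr => j _.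
  by rewrite mulrBl.
move: E; rewrite S1E; set Sh := \sum_i _ => E.
exact: reparam_alg q0 E.
Qed.

Lemma projective_christoffel u : O u -> forall k i j,
  christoffel h a k i j u = christoffel g a k i j u
   + (k == i)%:R * projective_form g h a j u + (k == j)%:R * projective_form g h a i u.
Proof.
move=> Ou k i j.
pose T k i j := christoffel h a k i j u - christoffel g a k i j u.
have Ts p q r : T p q r = T p r q by rewrite /T christoffelC// [christoffel g a p q r u]christoffelC.
have H (c : 'I_n -> R) : exists lam, forall k, \sum_i \sum_j T k i j * (c i * c j) = lam * c k.
  have [lam E] := geodesics_included_pointwise (\row_i c i) Ou.
  exists lam => m; have := E m; rewrite mxE => <-.
  by apply: eq_bigr => p _; apply: eq_bigr => r _; rewrite !mxE.
have := projective_tensor Ts H k i j.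
by rewrite /T -/(projective_form g h a j u) -/(projective_form g h a i u) => /eqP;
  rewrite subr_eq => /eqP ->; rewrite addrC addrA.
Qed.

End ProjectiveEquivalence.

(** * Weyl nullity and the function B *)

Section Connected.
Context {T : topologicalType} {S : Type}.

Lemma locally_constant_connected (f : T -> S) : connected [set: T] ->
  (forall x, \forall y \near x, f y = f x) -> forall x y, f x = f y.
Proof.
move=> cT lf x y; pose A := [set z | f z = f x].
have oA : open A.
  by rewrite openE => z; rewrite /A /= => <-; exact: lf.
have cA : closed A.
  rewrite -openC openE => z /= nz.
  have := lf z; apply: filterS => w E; rewrite /A /= E; exact: nz.
have : A = setT.
  apply: cT; first by exists x.
    by exists A; rewrite // setTI.
  by exists A; rewrite // setTI.
by move=> /seteqP[_ /(_ y I)].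
Qed.

End Connected.

Section Nullity.
Context {R : realType} {n : nat} {M : manifold R n}.
Implicit Types (g h : metric M) (a : chart M) (x : M).

Lemma chart_image_coord a x : dom a x -> chart_image a (coord a x).
Proof. by move=> ax; exists x. Qed.

(** One component determines the whole family, by the Jacobians at charts around x and by the value
    0 at all others. *)
Lemma tangent_component_neq0 a x (v : chart M -> 'rV[R]_n) :
  tangent_space x v -> v <> 0 -> dom a x -> exists i, v a 0 i != 0.
Proof.
move=> [v0 vJ] nv ax; apply: contrapT => H; apply: nv.
have va : v a = 0.
  apply/rowP => i; rewrite mxE; apply/eqP/negPn/negP => vi; apply: H; by exists i.
apply/funext => c; have [cx|/v0//] := pselect (dom c x).
by rewrite (vJ a c ax cx) va mul0mx.
Qed.

Lemma schouten_up_eigenP g a u (v : 'I_n -> R) (b : R) : chart_image a u ->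
  (forall i, \sum_j schouten_up g a i j u * v j = b * v i) <->
  (forall k, \sum_j schouten g a k j u * v j = b * flat (g a u) v k).
Proof.
move=> Ou; have ug := metric_nondegenerate g Ou.
pose V := \col_j v j.
have upE : (forall i, \sum_j schouten_up g a i j u * v j = b * v i) <->
           invmx (g a u) *m schouten_mx g a u *m V = b *: V.
  have E i : (invmx (g a u) *m schouten_mx g a u *m V) i 0 = \sum_j schouten_up g a i j u * v j.
    rewrite mxE; apply: eq_bigr => j _; rewrite [V j 0]mxE; congr (_ * _).
    by rewrite mxE; apply: eq_bigr => k _; rewrite [schouten_mx _ _ _ _ _]mxE.
  split=> [H|H i]; last by rewrite -E H !mxE.
  by apply/matrixP => i z; rewrite ord1 E H !mxE.
have lowE : (forall k, \sum_j schouten g a k j u * v j = b * flat (g a u) v k) <->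
            schouten_mx g a u *m V = b *: (g a u *m V).
  have E i : (schouten_mx g a u *m V) i 0 = \sum_j schouten g a i j u * v j.
    by rewrite mxE; apply: eq_bigr => j _; rewrite !mxE.
  have E' i : (g a u *m V) i 0 = flat (g a u) v i.
    by rewrite mxE; apply: eq_bigr => j _; rewrite mxE.
  split=> [H|H i]; last by rewrite -E H mxE E'.
  by apply/matrixP => i z; rewrite ord1 E H mxE E'.
apply: iff_trans upE (iff_trans _ (iff_sym lowE)); split=> H.
  have := congr1 (mulmx (g a u)) H.
  by rewrite !mulmxA mulmxV// mul1mx -scalemxAr.
by rewrite -mulmxA H -scalemxAr mulmxA mulVmx// mul1mx.
Qed.

Lemma weyl_nullity_null_vector g a x v : weyl_nullity g x v -> dom a x ->
  null_vector (fun i j k l => riemann g a i j k l (coord a x)) (fun j => v a 0 j).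
Proof. by move=> [_ H] ax i k l; exact: H. Qed.

(** P and g both transform by A -> J A J^T and v_c = v_a J, so multiplying the equation in [c] by J
    gives one in [a] with the same eigenvalue. *)
Lemma eigenvalue_chart_independent g a c x v (b b' : R) :
  tangent_space x v -> v <> 0 -> dom a x -> dom c x ->
  (forall k, \sum_j schouten g a k j (coord a x) * v a 0 j =
     b * flat (g a (coord a x)) (fun j => v a 0 j) k) ->
  (forall k, \sum_j schouten g c k j (coord c x) * v c 0 j =
     b' * flat (g c (coord c x)) (fun j => v c 0 j) k) -> b = b'.
Proof.
move=> tv nv ax cx Ea Ec; have Oa := chart_image_coord ax.
have Uu : overlap a c (coord a x) by exists x.
have tx : transition a c (coord a x) = coord c x by rewrite /transition /= coordK.
have toM (p : chart M) (d : R) :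
    (forall k, \sum_j schouten g p k j (coord p x) * v p 0 j =
       d * flat (g p (coord p x)) (fun j => v p 0 j) k) ->
    schouten_mx g p (coord p x) *m (v p)^T = d *: (g p (coord p x) *m (v p)^T).
  move=> E; apply/matrixP => i z; rewrite ord1 [RHS]mxE.
  have -> : (g p (coord p x) *m (v p)^T) i 0 = flat (g p (coord p x)) (fun j => v p 0 j) i.
    by rewrite mxE; apply: eq_bigr => j _; rewrite mxE.
  by rewrite -E mxE; apply: eq_bigr => j _; rewrite !mxE.
have vc : v c = v a *m jac a c (coord a x) by have [_] := tv; exact.
have E1 := toM a b Ea; have E2 := toM c b' Ec.
have F : schouten_mx g a (coord a x) *m (v a)^T = b' *: (g a (coord a x) *m (v a)^T).
  rewrite (schouten_transition g Uu) (metric_overlap g Uu) tx -!mulmxA -trmx_mul -vc.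
  by rewrite E2 -scalemxAr.
have [m fm] := flat_neq0 (riemann_curvature_tensor g Oa) (tangent_component_neq0 tv nv ax).
have := congr1 (fun A : 'cV[R]_n => A m 0) (etrans (esym E1) F).
have G : (g a (coord a x) *m (v a)^T) m 0 = flat (g a (coord a x)) (fun j => v a 0 j) m.
  by rewrite mxE; apply: eq_bigr => j _; rewrite mxE.
rewrite [LHS]mxE [RHS]mxE G; exact: (mulIf fm).
Qed.

(** One number has to serve all charts and all null vectors: the charts by
    [eigenvalue_chart_independent], the vectors by [null_vector_eigen_unique]. *)
Lemma Bfun_eigen g x v : weyl_nullity g x v -> v <> 0 ->
  forall w, weyl_nullity g x w -> forall a, dom a x ->
  forall k, \sum_j schouten g a k j (coord a x) * w a 0 j =
    Bfun g x * flat (g a (coord a x)) (fun j => w a 0 j) k.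
Proof.
move=> nv v0.
have ct a : dom a x -> curvature_tensor (g a (coord a x))
    (fun i j k l => riemann g a i j k l (coord a x)).
  by move=> ax; exact: riemann_curvature_tensor (chart_image_coord ax).
have [a0 ax0] := dom_cover x.
have [tv _] := nv.
have [b Eb] := null_vector_eigen (ct a0 ax0) (weyl_nullity_null_vector nv ax0)
  (tangent_component_neq0 tv v0 ax0).
have bE a : dom a x -> forall k, \sum_j schouten g a k j (coord a x) * v a 0 j =
    b * flat (g a (coord a x)) (fun j => v a 0 j) k.
  move=> ax; have [b' Eb'] := null_vector_eigen (ct a ax) (weyl_nullity_null_vector nv ax)
    (tangent_component_neq0 tv v0 ax).
  by rewrite (eigenvalue_chart_independent tv v0 ax0 ax Eb Eb').
pose S := [set b : R | forall v, weyl_nullity g x v ->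
    forall a, dom a x -> forall i : 'I_n,
      \sum_j schouten_up g a i j (coord a x) * v a 0 j = b * v a 0 i].
have Sb : S b.
  move=> w nw a ax; apply/(schouten_up_eigenP g _ _ (chart_image_coord ax)).
  have [w0|w0] := pselect (exists i, w a 0 i != 0).
    have [b' Eb'] := null_vector_eigen (ct a ax) (weyl_nullity_null_vector nw ax) w0.
    rewrite -(null_vector_eigen_unique (ct a ax) (weyl_nullity_null_vector nv ax) (bE a ax)
      (weyl_nullity_null_vector nw ax) w0 (tangent_component_neq0 tv v0 ax) Eb').
    exact: Eb'.
  have wz j : w a 0 j = 0 by apply/eqP/negPn/negP => wj; apply: w0; exists j.
  move=> k; rewrite /flat !big1 ?mulr0// => j _; by rewrite wz mulr0.
(* [S] is inhabited, so [xget] does not return its default 0. *)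
have SB : S (Bfun g x) by apply: xgetPex; exists b.
move=> w nw a ax; apply/(schouten_up_eigenP g _ _ (chart_image_coord ax)).
exact: SB.
Qed.

End Nullity.

(** * Metrics of one projective class *)

Section ProjectiveClass.
Context {R : realType} {n : nat} {M : manifold R n}.
Variable m : set (metric M).
Hypothesis m_structure : metric_projective_structure m.

(** Both metrics are compared with the base metric [g0] of the class; projective forms are
    differences of Christoffel symbols, so they subtract. *)
Lemma class_christoffel g h a u : m g -> m h -> chart_image a u -> forall k i j,
  christoffel h a k i j u = christoffel g a k i j u
   + (k == i)%:R * projective_form g h a j u + (k == j)%:R * projective_form g h a i u.
Proof.
have [g0 ->] := m_structure => -[gg _] [gh _] Ou k i j.
have Eg := projective_christoffel gg Ou k i j.
have Eh := projective_christoffel gh Ou k i j.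
have D p : projective_form g h a p u = projective_form g0 h a p u - projective_form g0 g a p u.
  rewrite /projective_form; move: (christoffel h _ _ _ _ _) (christoffel g _ _ _ _ _)
    (christoffel g0 _ _ _ _ _) => A B C; ring.
rewrite !D Eh Eg.
move: (christoffel g0 a k i j u) => C.
move: (projective_form g0 h a) (projective_form g0 g a) => p q; ring.
Qed.

Hypothesis n_ge2 : (2 <= n)%N.

Lemma class_weyl_nullity g h x v : m g -> m h -> weyl_nullity g x v -> weyl_nullity h x v.
Proof.
move=> mg mh [tv H]; split; first exact: tv.
move=> a ax i k l; have Ou := chart_image_coord ax.
apply: etrans (H a ax i k l); apply: eq_bigr => j _; congr (_ * _).
exact: (weyl_change (fun u Ou => class_christoffel mg mh Ou) n_ge2 _ _ _ _ Ou).
Qed.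

Hypothesis m_nullity : has_weyl_nullity m.

Lemma class_nullity g x : m g -> exists2 v, weyl_nullity g x v & v <> 0.
Proof.
move=> mg; have [g0 mg0 H] := m_nullity; have [v nv v0] := H x.
exists v; [exact: class_weyl_nullity mg0 mg nv|exact: v0].
Qed.

Lemma Bfun_locally_constant g h (c : R) a x : m g -> m h ->
  smooth_function (Bfun h) -> (forall y, Bfun g y = c) -> dom a x ->
  \forall y \near x, Bfun h y = Bfun h x.
Proof.
move=> mg mh sB gc ax; have Ou := chart_image_coord ax.
have oO := @chart_image_open _ _ _ a.
pose b := Bfun h \o param a.
have sb : smooth_on (chart_image a) b by exact: sB.
have b0 u : chart_image a u -> forall j, partial j b u = 0.
  apply: (eigenvalue_partial_eq0 (fun u Ou => class_christoffel mg mh Ou) n_ge2 (B := c) sb).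
  move=> _ [y ay <-]; have [v nv v0] := class_nullity y mg.
  exists (fun j => v a 0 j); split.
  - by apply: tangent_component_neq0 v0 ay; have [] := nv.
  - exact: weyl_nullity_null_vector.
  - by move=> k; rewrite (Bfun_eigen nv v0 nv ay) gc.
  (* The null vector of g is also one of h, so both eigenvalue equations hold for the same
     vector. *)
  have nvh := class_weyl_nullity mg mh nv.
  by move=> k; rewrite (Bfun_eigen nvh v0 nvh ay) /b /= coordK.
have /smooth_onP ckb := sb.
have db u v : chart_image a u -> 'D_v b u = 0.
  move=> Ou'; rewrite (derive_partial oO v sb Ou') big1// => i _.
  by rewrite b0// mulr0.
have near_b := derive_eq0_cst oO (ckb 1%N) (fun y v Oy => db y v Oy) Ou.
have : \forall y \near x, dom a y /\ b (coord a y) = b (coord a x).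
  apply: filterI; first by apply: open_nbhs_nbhs; split=> //; exact: dom_open.
  exact: (coord_continuous ax near_b).
by apply: filterS => y [ay]; rewrite /b /= !coordK.
Qed.

End ProjectiveClass.

Theorem theorem4p24 (R : realType) (n : nat) (n_ge2 : (2 <= n)%N)
    (M : manifold R n) (m : set (metric M))
    (m_structure : metric_projective_structure m)
    (m_nullity : has_weyl_nullity m)
    (B_smooth : forall g : metric M, m g -> smooth_function (Bfun g)) :
  (exists2 g : metric M, m g & constant_function (Bfun g)) ->
  forall gbar : metric M, m gbar -> constant_function (Bfun gbar).
Proof.
move=> [g mg [c gc]] h mh.
(* A connected carrier may be empty, and then any constant does; otherwise a base point supplies the
   value. *)
have [[x0 _]|M0] := pselect (exists x : M, True); last by exists 0 => x; case: M0; exists x.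
exists (Bfun h x0) => x.
apply: (locally_constant_connected (@manifold_connected _ _ M)) => y.
have [a ay] := dom_cover y.
exact: (Bfun_locally_constant m_structure n_ge2 m_nullity mg mh (B_smooth h mh) gc ay).
Qed.
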